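(* Let $(\mathbb S^2,g_0)$ be the standard sphere, let $p_1,p_2\in\mathbb S^2$ be antipodal points, and let $\alpha_{im}>-1$ ($i,m\in\{1,2\}$) with $(\alpha_{11},\alpha_{21})\ne(\alpha_{12},\alpha_{22})$, where $\alpha_{1m},\alpha_{2m}$ are the weights at $p_m$. Let $\rho_1,\rho_2>0$. Suppose that either $$\begin{cases}\rho_1^2+\rho_2^2-\rho_1\rho_2-4\pi(1+\alpha_{11})\rho_1-4\pi(1+\alpha_{21})\rho_2\le0\\\rho_1^2+\rho_2^2-\rho_1\rho_2-4\pi(1+\alpha_{12})\rho_1-4\pi(1+\alpha_{22})\rho_2\ge0\\\rho_1^2-\rho_2^2-4\pi(1+\alpha_{11})\rho_1+4\pi(1+\alpha_{22})\rho_2\le0\\\rho_1^2-\rho_2^2-4\pi(1+\alpha_{12})\rho_1+4\pi(1+\alpha_{21})\rho_2\ge0\end{cases}$$ with at least one of the inequalities strict, or that all the four opposite inequalities hold, with at least one of them strict. Then the system $$\begin{cases}-\Delta u_1=2\rho_1\left(\dfrac{\widetilde h_1e^{u_1}}{\int_{\mathbb S^2}\widetilde h_1e^{u_1}\,dV_{g_0}}-\dfrac1{4\pi}\right)-\rho_2\left(\dfrac{\widetilde h_2e^{u_2}}{\int_{\mathbb S^2}\widetilde h_2e^{u_2}\,dV_{g_0}}-\dfrac1{4\pi}\right)\\[2mm]-\Delta u_2=2\rho_2\left(\dfrac{\widetilde h_2e^{u_2}}{\int_{\mathbb S^2}\widetilde h_2e^{u_2}\,dV_{g_0}}-\dfrac1{4\pi}\right)-\rho_1\left(\dfrac{\widetilde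 h_1e^{u_1}}{\int_{\mathbb S^2}\widetilde h_1e^{u_1}\,dV_{g_0}}-\dfrac1{4\pi}\right)\end{cases}\quad\text{on }\mathbb S^2$$ admits no solutions $u=(u_1,u_2)\in H^1(\mathbb S^2)^2$.
   Context: $\Delta=\Delta_{g_0}$ is the Laplace-Beltrami operator of the round unit sphere, which has area $4\pi$. Here $\widetilde h_i:=e^{-4\pi(\alpha_{i1}G_{p_1}+\alpha_{i2}G_{p_2})}$ for $i=1,2$ (i.e. $h_1,h_2\equiv1$), where $G_p$ is the Green function: $-\Delta G_p=\delta_p-\frac1{4\pi}$ on $\mathbb S^2$, $\int_{\mathbb S^2}G_p\,dV_{g_0}=0$. Solutions are understood in the weak sense. *)

(* Defs.v *)
From HB Require Import structures.
From mathcomp Require Import all_boot all_order all_algebra.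
From mathcomp Require Import all_classical all_reals all_analysis.
From mathcomp Require Import measurable_realfun.
Import Order.TTheory GRing.Theory Num.Theory.
Import numFieldNormedType.Exports.

Set Implicit Arguments.
Unset Strict Implicit.
Unset Printing Implicit Defensive.

Local Open Scope classical_set_scope.
Local Open Scope ring_scope.

Definition dot {R : realType} (x y : 'rV[R]_3) : R :=
  \sum_(i < 3) x 0 i * y 0 i.

(* The library's norm on 'rV[R]_3 is the sup norm, hence the explicit Euclidean
   inner product. *)
Record sphere (R : realType) := Sphere {
  sphere_val :> 'rV[R]_3;
  _ : dot sphere_val sphere_val == 1 }.

HB.instance Definition _ (R : realType) := [isSub for @sphere_val R].
HB.instance Definition _ (R : realType) := [Choice of sphere R by <:].

Section cylindrical_coordinates.
Context {R : realType}.

Definition vec3 (a b c : R) : 'rV[R]_3 := \row_i [:: a; b; c]`_i.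

(* Only heights in [-1, 1] matter; the clamping makes [cylindrical] total. *)
Definition height (z : R) : R := Num.max (-1) (Num.min 1 z).

Lemma height_sqr (z : R) : 0 <= 1 - height z ^+ 2.
Proof.
have h1 : -1 <= height z by rewrite /height le_max lexx.
have h2 : height z <= 1.
  by rewrite /height ge_max ge_min lexx andbT -subr_ge0 opprK addr_ge0.
by rewrite subr_ge0 -(@real_normK _ (height z)) ?num_real// expr_le1//
  ler_norml h1.
Qed.

Definition cylindrical_vec (q : R * R) : 'rV[R]_3 :=
  let r := Num.sqrt (1 - height q.2 ^+ 2) in
  vec3 (r * cos q.1) (r * sin q.1) (height q.2).

Lemma cylindrical_subproof (q : R * R) :
  dot (cylindrical_vec q) (cylindrical_vec q) == 1.
Proof.
rewrite /cylindrical_vec /dot !big_ord_recr big_ord0 /= !mxE /= add0r -!expr2.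
by rewrite !exprMn -mulrDr cos2Dsin2 mulr1 sqr_sqrtr ?height_sqr// subrK.
Qed.

Definition cylindrical (q : R * R) : sphere R :=
  Sphere (cylindrical_subproof q).

HB.instance Definition _ := isPointed.Build (sphere R) (cylindrical (0, 0)).

End cylindrical_coordinates.

Section area_measure.
Context {R : realType}.

(* The sigma-algebra generated by the three ambient coordinates is the Borel
   sigma-algebra of the sphere. *)
Definition sphere_coord (i : 'I_3) (x : sphere R) : R := sphere_val x 0 i.

Definition sphere_display : measure_display. Proof. by constructor. Qed.

Lemma sphere_set0 : g_sigma_preimage sphere_coord set0.
Proof. exact: sigma_algebra0. Qed.

Lemma sphere_setC A :
  g_sigma_preimage sphere_coord A -> g_sigma_preimage sphere_coord (~` A).
Proof. exact: sigma_algebraC. Qed.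

Lemma sphere_bigcup (F : (set (sphere R))^nat) :
  (forall i, g_sigma_preimage sphere_coord (F i)) ->
  g_sigma_preimage sphere_coord (\bigcup_i (F i)).
Proof. exact: sigma_algebra_bigcup. Qed.

HB.instance Definition _ := @isMeasurable.Build sphere_display
  (sphere R) (g_sigma_preimage sphere_coord)
  sphere_set0 sphere_setC sphere_bigcup.

Lemma measurable_cylindrical : measurable_fun [set: R * R] (@cylindrical R).
Proof.
have mh : measurable_fun [set: R * R] (fun q => height q.2).
  rewrite /height; apply: measurable_maxr; first exact: measurable_cst.
  by apply: measurable_minr; [exact: measurable_cst|exact: measurable_snd].
have ms : measurable_fun [set: R * R]
    (fun q => Num.sqrt (1 - height q.2 ^+ 2)).
  apply: (measurableT_comp (continuous_measurable_fun (@sqrt_continuous R))).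
  by apply: measurable_funB => //; exact: measurable_funX.
have mc : measurable_fun [set: R * R] (fun q => cos q.1).
  apply: (measurableT_comp (continuous_measurable_fun (@continuous_cos R))).
  exact: measurable_fst.
have msi : measurable_fun [set: R * R] (fun q => sin q.1).
  apply: (measurableT_comp (continuous_measurable_fun (@continuous_sin R))).
  exact: measurable_fst.
have mcoord (i : 'I_3) :
    measurable_fun [set: R * R] (fun q => sphere_coord i (cylindrical q)).
  case: i => [[|[|[|//]]] i3].
  - apply: (eq_measurable_fun (fun q : R * R =>
      Num.sqrt (1 - height q.2 ^+ 2) * cos q.1)).
      by move=> q _; rewrite /sphere_coord /= mxE.
    exact: measurable_funM.
  - apply: (eq_measurable_fun (fun q : R * R =>
      Num.sqrt (1 - height q.2 ^+ 2) * sin q.1)).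
      by move=> q _; rewrite /sphere_coord /= mxE.
    exact: measurable_funM.
  - apply: (eq_measurable_fun (fun q : R * R => height q.2)) => //.
    by move=> q _; rewrite /sphere_coord /= mxE.
apply: (measurability (\big[setU/set0]_(i < 3)
  preimage_set_system [set: sphere R] (sphere_coord i) measurable)) => //.
move=> _ [B + <-]; rewrite -bigcup_seq => -[i _ [C mC <-]].
rewrite !setTI -[X in measurable X]setTI.
exact: (mcoord i measurableT C mC).
Qed.

Lemma measurable_cylinder :
  measurable (`[0, 2 * pi]%classic `*` `[(-1)%R, 1]%classic : set (R * R)).
Proof. by apply: measurableX; exact: measurable_itv. Qed.

(* In cylindrical coordinates the area form of the round unit sphere is
   d(longitude) /\ d(height). *)
Definition area : set (sphere R) -> \bar R :=
  pushforward
    (mrestr (lebesgue_measure \x lebesgue_measure)%E measurable_cylinder)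
    (@cylindrical R).

Lemma area0 : area set0 = 0%E.
Proof. by rewrite /area /pushforward preimage_set0 measure0. Qed.

Lemma area_ge0 A : (0 <= area A)%E.
Proof. by rewrite /area /pushforward measure_ge0. Qed.

Lemma area_sigma_additive : semi_sigma_additive area.
Proof.
have mC A : measurable A -> measurable (@cylindrical R @^-1` A).
  move=> mA; rewrite -[X in measurable X]setTI.
  exact: measurable_cylindrical.
move=> F mF tF mUF; rewrite /area /pushforward preimage_bigcup.
apply: measure_semi_sigma_additive.
- by move=> n; exact: mC.
- apply/trivIsetP => /= i j _ _ ij; rewrite -preimage_setI.
  by move/trivIsetP : tF => /(_ _ _ _ _ ij) ->//; rewrite preimage_set0.
- by rewrite -preimage_bigcup; exact: mC.
Qed.

HB.instance Definition _ := isMeasure.Build _ _ _ area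
  area0 area_ge0 area_sigma_additive.

End area_measure.

Section sphere_calculus.
Context {R : realType}.
Implicit Types (F : 'rV[R]_3 -> R) (X : 'rV[R]_3 -> 'rV[R]_3).

Definition partial (i : 'I_3) F : 'rV[R]_3 -> R :=
  fun x => 'D_(delta_mx 0 i) F x.

Fixpoint Ck (k : nat) F : Prop :=
  if k is k'.+1 then
    forall i, (forall x, derivable F x (delta_mx 0 i)) /\ Ck k' (partial i F)
  else continuous F.

(* Smooth functions on the sphere are exactly the restrictions of smooth
   functions on R^3; they are represented below by such extensions. *)
Definition smooth F : Prop := forall k, Ck k F.

Definition smooth_field X : Prop := forall i, smooth (fun x => X x 0 i).

(* At a point x of the sphere, [sgrad F x] is the orthogonal projection of the
   Euclidean gradient onto the tangent plane, i.e. the Riemannian gradient of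
   the restriction of F.  [sdiv] is the trace of the tangential derivative: it
   is the Riemannian divergence when X is tangent to the sphere, and depends
   only on the restriction of X to the sphere. *)
Definition sgrad F : 'rV[R]_3 -> 'rV[R]_3 := fun x =>
  let g := \row_i partial i F x in g - dot g x *: x.

Definition sdiv X : 'rV[R]_3 -> R := fun x =>
  \sum_(i < 3) sgrad (fun y => X y 0 i) x 0 i.

Definition laplace_beltrami F : 'rV[R]_3 -> R := sdiv (sgrad F).

End sphere_calculus.

Section weak_notions.
Context {R : realType}.
Implicit Types (u f G : sphere R -> R) (V : sphere R -> 'rV[R]_3).

Definition weak_gradient u V : Prop :=
  (forall x : sphere R, dot (V x) x = 0) /\
  (forall X : 'rV[R]_3 -> 'rV[R]_3, smooth_field X ->
     (forall x : sphere R, dot (X x) x = 0) ->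
     \int[area]_x (u x * sdiv X x) =
       - (\int[area]_x dot (V x) (X x))).

Definition L2_gradient u V : Prop :=
  (forall i, (fun x => V x 0 i) \in Lfun area 2%:E) /\ weak_gradient u V.

Definition H1 u : Prop :=
  u \in Lfun area 2%:E /\ exists V, L2_gradient u V.

(* -Delta u = f in the weak sense. *)
Definition weak_poisson u f : Prop :=
  exists2 V, L2_gradient u V &
    forall phi : 'rV[R]_3 -> R, smooth phi ->
      \int[area]_x dot (V x) (sgrad phi x) = \int[area]_x (f x * phi x).

(* -Delta G = delta_p - 1/(4 pi) in the sense of distributions, with zero
   mean; this determines G almost everywhere. *)
Definition green (p : sphere R) G : Prop :=
  [/\ G \in Lfun area 1%:E,
      \int[area]_x G x = 0 &
      forall phi : 'rV[R]_3 -> R, smooth phi ->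
        - (\int[area]_x (G x * laplace_beltrami phi x)) =
        phi p - (4 * pi)^-1 * (\int[area]_x phi x)].

Definition singular_weight (a1 a2 : R) (G1 G2 : sphere R -> R) :
    sphere R -> R :=
  fun x => expR (- (4 * pi) * (a1 * G1 x + a2 * G2 x)).

(* rho (h e^u / \int h e^u - 1/(4 pi)); for u in H1 and the weights above with
   exponents > -1, the integral is finite by the Moser-Trudinger inequality. *)
Definition mean_field (rho : R) (h u : sphere R -> R) : sphere R -> R :=
  fun x => rho * (h x * expR (u x) / (\int[area]_y (h y * expR (u y)))
                  - (4 * pi)^-1).

Definition toda_solution (rho1 rho2 : R) (h1 h2 u1 u2 : sphere R -> R) :
    Prop :=
  weak_poisson u1
    (fun x => 2 * mean_field rho1 h1 u1 x - mean_field rho2 h2 u2 x) /\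
  weak_poisson u2
    (fun x => 2 * mean_field rho2 h2 u2 x - mean_field rho1 h1 u1 x).

End weak_notions.

(* Main.v *)
Require Import Defs.
From HB Require Import structures.
From mathcomp Require Import all_boot all_order all_algebra.
From mathcomp Require Import all_classical all_reals all_analysis.
From mathcomp Require Import measurable_realfun.
From mathcomp Require Import ring lra.
Import Order.TTheory GRing.Theory Num.Theory.
Import numFieldNormedType.Exports.

Set Implicit Arguments.
Unset Strict Implicit.
Unset Printing Implicit Defensive.

Local Open Scope classical_set_scope.
Local Open Scope ring_scope.

(** The obstruction is a Kazdan-Warner type identity for the conformal field X
   that flows from p2 to p1. Let z x = x . p1 be the height and
   X x = p1 - (z x) x, the gradient of z; its divergence is -2 z. Let
   f_k = rho_k (mu_k - 1 / (4 pi)) be the mean fields of a solution, mu_k being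
   the normalised densities, F_1 = 2 f_1 - f_2 and F_2 = 2 f_2 - f_1 the
   right-hand sides, a_k and b_k the weights of the k-th density at p1 and p2,
   and m_k the integral of z mu_k. Since the equations determine the masses,
   every mu_k is a probability density, positive almost everywhere, so
   (m_1, m_2) lies in the open square ]-1, 1[^2. Differentiating the densities
   along X and summing over k gives
     4 pi sum_k rho_k ((1 + a_k) (1 + m_k) - (1 + b_k) (1 - m_k)) =
       rho_1 m_1 (2 rho_1 - rho_2) + rho_2 m_2 (2 rho_2 - rho_1).
   The right-hand side minus the left-hand side is affine in (m_1, m_2), and
   at the corners (1, 1), (-1, -1), (1, -1), (-1, 1) of the square it equals
   2 E1, -2 E2, 2 E3, -2 E4. At an interior point it is an average of these
   values with positive weights; under the sign conditions the corner values
   have one sign and are not all zero, so the average cannot vanish.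

   The identity has to be proved for weak solutions whose densities are
   singular or degenerate at the poles. Instead of regularity theory the proof
   uses explicit potentials. With s = (1 + x . y) / 2, the kernel -ln (1 - s)
   inverts the Laplacian up to the factor 4 pi and constants. The partial sums
   of its power series are polynomials in x . y, hence admissible test
   functions with explicit Laplacians; testing with them represents solutions
   and Green functions as logarithmic potentials almost everywhere
   (weak_poisson_potential, green_neg_log). Thus mu_k is a constant times
   e^W, with W a combination of the logarithms at the poles and of the
   potential of F_k (log_density). When every logarithm is replaced by a partial
   sum, all derivatives along X are bounded, and the divergence theorem is the
   fundamental theorem of calculus on meridians (meridian_ibp).

   Two facts allow the passage to the limit. First, X vanishes at both poles, so
   that the derivative of the logarithmic kernel along X gains half a power of
   the singularity at each of them (slope_kernel); together with the exponential
   integrability of potentials (L1_exp_potential) this dominates the truncated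
   integrals as soon as the weights exceed -1 (transport_limit). Second, the
   derivative of the logarithmic kernel along X in both variables is bounded:
   it is z x + z y, which integrates to 0 against mean zero densities. As the
   coupling matrix of the system is symmetric, the interaction terms cancel in
   the limit (transport_symm, coupled_transport_limit), and only the terms in the
   displayed identity remain (component_balance).

   The area is defined by cylindrical coordinates around a fixed axis, which a
   reflection moves to the axis through p1. The invariance of the area under
   reflections is read off from the moments of linear forms (dot_moment), because
   these moments determine a finite measure (moment_determinacy). *)

(** * Integrable real functions *)

Section real_integrals.
Context d (T : measurableType d) (R : realType).
Variable mu : {finite_measure set T -> \bar R}.
Implicit Types f g b : T -> R.

(** Integrability of the real function itself; the calculus below stays in R,
   where subtraction and integration commute without finiteness side goals. *)
Definition L1 f : Prop := mu.-integrable [set: T] (EFin \o f).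

Lemma L1_measurable f : L1 f -> measurable_fun [set: T] f.
Proof. by move=> /measurable_int /measurable_EFinP. Qed.

Lemma L1_bounded f (M : R) :
  measurable_fun [set: T] f -> (forall x, `|f x| <= M) -> L1 f.
Proof.
move=> mf fM; apply: measurable_bounded_integrable => //.
  by rewrite -ge0_fin_numE// fin_num_measure.
exists M; split; first exact: num_real.
by move=> y My x _; exact: le_trans (fM x) (ltW My).
Qed.

Lemma L1_cst (c : R) : L1 (fun=> c).
Proof. by apply: (@L1_bounded _ `|c|). Qed.

Lemma L1_dom f g : measurable_fun [set: T] f -> L1 g ->
  (forall x, `|f x| <= g x) -> L1 f.
Proof.
move=> mf ig fg; apply: le_integrable ig => //; first exact/measurable_EFinP.
by move=> x _ /=; rewrite lee_fin (le_trans (fg x))// ler_norm.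
Qed.

Lemma L1D f g : L1 f -> L1 g -> L1 (fun x => f x + g x).
Proof. by move=> lf lg; exact: (integrableD measurableT lf lg). Qed.

Lemma L1B f g : L1 f -> L1 g -> L1 (fun x => f x - g x).
Proof. by move=> lf lg; exact: (integrableB measurableT lf lg). Qed.

Lemma L1Z (c : R) f : L1 f -> L1 (fun x => c * f x).
Proof. by move=> lf; exact: (integrableZl measurableT c lf). Qed.

Lemma L1_norm f : L1 f -> L1 (fun x => `|f x|).
Proof. by move=> lf; exact: integrable_norm. Qed.

Lemma L1M f b (M : R) : L1 f -> measurable_fun [set: T] b ->
  (forall x, `|b x| <= M) -> L1 (fun x => f x * b x).
Proof.
move=> lf mb bM; apply: (@L1_dom _ (fun x => M * `|f x|)).
- by apply: measurable_funM => //; exact: L1_measurable.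
- exact/L1Z/L1_norm.
- by move=> x; rewrite normrM mulrC ler_wpM2r.
Qed.

Lemma L1_sum (I : Type) (r : seq I) (P : pred I) (h : I -> T -> R) :
  (forall i, L1 (h i)) -> L1 (fun x => \sum_(i <- r | P i) h i x).
Proof.
move=> lh; elim: r => [|i r ih].
  by under [X in L1 X]eq_fun do rewrite big_nil; exact: L1_cst.
under [X in L1 X]eq_fun do rewrite big_cons.
by case: (P i) => //; exact: L1D.
Qed.

Lemma integralD1 f g : L1 f -> L1 g ->
  \int[mu]_x (f x + g x) = \int[mu]_x f x + \int[mu]_x g x.
Proof. by move=> lf lg; exact: RintegralD. Qed.

Lemma integralB1 f g : L1 f -> L1 g ->
  \int[mu]_x (f x - g x) = \int[mu]_x f x - \int[mu]_x g x.
Proof. by move=> lf lg; exact: RintegralB. Qed.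

Lemma integralZ1 (c : R) f : L1 f ->
  \int[mu]_x (c * f x) = c * \int[mu]_x f x.
Proof. by move=> lf; exact: RintegralZl. Qed.

Lemma integral_sum1 (I : Type) (r : seq I) (P : pred I) (h : I -> T -> R) :
  (forall i, L1 (h i)) ->
  \int[mu]_x (\sum_(i <- r | P i) h i x) =
  \sum_(i <- r | P i) \int[mu]_x h i x.
Proof.
move=> lh; elim: r => [|i r ih].
  by rewrite big_nil; under eq_Rintegral do rewrite big_nil;
     rewrite Rintegral_cst// mul0r.
under eq_Rintegral do rewrite big_cons.
rewrite big_cons; case: (P i) => //; rewrite integralD1 ?ih//.
exact: L1_sum.
Qed.

Lemma le_integral1 f g : L1 f -> L1 g -> (forall x, f x <= g x) ->
  \int[mu]_x f x <= \int[mu]_x g x.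
Proof. by move=> lf lg fg; apply: le_Rintegral => // x _. Qed.

Lemma EFin_integral1 f : L1 f -> (\int[mu]_x f x)%:E = (\int[mu]_x (f x)%:E)%E.
Proof. by move=> lf; rewrite /Rintegral fineK//; exact: integrable_fin_num. Qed.

Lemma L1_lty f : measurable_fun [set: T] f -> (forall x, 0 <= f x) ->
  L1 f <-> (\int[mu]_x (f x)%:E < +oo)%E.
Proof.
move=> mf f0; split => [/integrableP[_]|h].
  by under eq_integral do rewrite /= ger0_norm//.
apply/integrableP; split; first exact/measurable_EFinP.
by under eq_integral do rewrite /= ger0_norm//.
Qed.

Lemma integral1_gt0 f : (0 < mu [set: T])%E -> L1 f -> (forall x, 0 <= f x) ->
  {ae mu, forall x, 0 < f x} -> 0 < \int[mu]_x f x.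
Proof.
move=> mu0 lf f0 aef; rewrite lt_neqAle Rintegral_ge0 ?andbT//.
apply/negP => /eqP int0.
have : (\int[mu]_x (f x)%:E = 0)%E by rewrite -EFin_integral1// -int0.
move=> intf0.
have h2 : ae_eq mu [set: T] (EFin \o f) (cst 0%E).
  apply/(ae_eq_integral_abs mu measurableT (measurable_int _ lf)).
  by under eq_integral do rewrite /= ger0_norm//.
have : {ae mu, forall x : T, False}.
  near=> x; have : 0 < f x by near: x.
  have : [set: T] x -> (f x)%:E = 0%E by near: x.
  by move=> /(_ I) [->]; rewrite ltxx.
case=> N [mN N0 sN].
have : N = [set: T] by apply/seteqP; split => // x _; apply: sN.
by move=> NT; move: mu0; rewrite -NT N0 ltxx.
Unshelve. all: end_near. Qed.

Lemma ae_eq_integral1 f g : L1 f -> L1 g -> {ae mu, forall x, f x = g x} ->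
  \int[mu]_x f x = \int[mu]_x g x.
Proof.
move=> lf lg fg; congr fine; apply: ae_eq_integral => //.
- exact: measurable_int lf.
- exact: measurable_int lg.
- by apply: filterS fg => x -> _.
Qed.

Lemma ae_L1 f g : measurable_fun [set: T] g -> {ae mu, forall x, f x = g x} ->
  L1 f -> L1 g.
Proof.
move=> mg fg lf; apply/integrableP; split; first exact/measurable_EFinP.
have /integrableP[mf] := lf; rewrite (@ae_eq_integral _ _ _ mu setT
  (fun x => `|(g x)%:E|%E) (fun x => `|(f x)%:E|%E))//.
- exact: measurableT_comp.
- by apply: measurableT_comp => //; exact/measurable_EFinP.
- by apply: filterS fg => x -> _.
Qed.

(** The minimum of f and g agrees with f almost everywhere and is below g
   everywhere. *)
Lemma le_integral_ae1 f g : L1 f -> L1 g -> {ae mu, forall x, f x <= g x} ->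
  \int[mu]_x f x <= \int[mu]_x g x.
Proof.
move=> lf lg fg.
have mm : measurable_fun [set: T] (fun x => Num.min (f x) (g x)).
  by apply: measurable_minr; [exact: L1_measurable lf|exact: L1_measurable lg].
have e : {ae mu, forall x, f x = Num.min (f x) (g x)}.
  by apply: filterS fg => x h; rewrite min_l.
have lm := ae_L1 mm e lf.
rewrite (ae_eq_integral1 lf lm e).
by apply: le_integral1 => // x; rewrite ge_min lexx orbT.
Qed.

Lemma dominated_convergence1 (f_ : nat -> T -> R) f g :
  (forall n, measurable_fun [set: T] (f_ n)) -> measurable_fun [set: T] f ->
  {ae mu, forall x, f_ ^~ x @ \oo --> f x} -> L1 g ->
  {ae mu, forall x, forall n, `|f_ n x| <= g x} ->
  L1 f /\ (fun n => \int[mu]_x f_ n x) @ \oo --> \int[mu]_x f x.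
Proof.
move=> mf_ mf ff lg fg.
have lf_ n : L1 (f_ n).
  apply: (@ae_L1 (fun x => Num.max (- `|g x|) (Num.min `|g x| (f_ n x)))) => //.
    apply: filterS fg => x /(_ n) h.
    have := le_trans h (ler_norm (g x)); rewrite ler_norml => /andP[h1 h2].
    by rewrite min_r// max_r.
  apply: (@L1_dom _ (fun x => `|g x|)).
  - have mg := L1_measurable lg.
    have mng : measurable_fun [set: T] (fun x => `|g x|).
      exact: measurableT_comp.
    apply: measurable_maxr; first exact: measurableT_comp.
    by apply: measurable_minr.
  - exact: L1_norm.
  - move=> x; rewrite ler_norml le_max lexx/= ge_max ge_min lexx /= andbT.
    by rewrite (@le_trans _ _ 0)// oppr_le0.
have [|||||if_ _ cvg] := @dominated_convergence _ T R mu setT measurableT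
  (fun n => EFin \o f_ n) (EFin \o f) (EFin \o g).
- by move=> n; exact/measurable_EFinP.
- exact/measurable_EFinP.
- apply: filterS ff => x fx _.
  by apply/cvg_EFin => //; exact: nearW.
- by [].
- by apply: filterS fg => x h n _; rewrite /= lee_fin.
split=> //.
have := fine_cvg; rewrite /Rintegral.
move=> H; apply: H.
rewrite fineK; last exact: integrable_fin_num.
exact: cvg.
Qed.

End real_integrals.

(** * Integration on products *)

Section real_fubini.
Context d1 d2 (T1 : measurableType d1) (T2 : measurableType d2) (R : realType).
Variables (m1 : {finite_measure set T1 -> \bar R})
          (m2 : {finite_measure set T2 -> \bar R}).
Implicit Types h k : T1 * T2 -> R.

Definition L1prod h : Prop :=
  (m1 \x m2)%E.-integrable [set: T1 * T2] (EFin \o h).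

Lemma L1prod_measurable h : L1prod h -> measurable_fun [set: T1 * T2] h.
Proof. by move=> /measurable_int /measurable_EFinP. Qed.

Lemma L1prod_ae1 h : L1prod h -> {ae m1, forall x, L1 m2 (fun y => h (x, y))}.
Proof. by move=> lh; exact: (ae_integrable1 lh). Qed.

Lemma L1prod_ae2 h : L1prod h -> {ae m2, forall y, L1 m1 (fun x => h (x, y))}.
Proof. by move=> lh; exact: (ae_integrable2 lh). Qed.

Lemma measurable_integral_snd h : L1prod h ->
  measurable_fun [set: T1] (fun x => \int[m2]_y h (x, y)).
Proof.
move=> lh; apply: measurableT_comp => //.
exact: (measurable_fubini_F lh).
Qed.

Lemma measurable_integral_fst h : L1prod h ->
  measurable_fun [set: T2] (fun y => \int[m1]_x h (x, y)).
Proof.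
move=> lh; apply: measurableT_comp => //.
exact: (measurable_fubini_G lh).
Qed.

Lemma L1_integral_snd h : L1prod h -> L1 m1 (fun x => \int[m2]_y h (x, y)).
Proof.
move=> lh; have mF := measurable_integral_snd lh.
have := integrable_fubini_F lh.
move=> /integrableP[mf fi]; apply/integrableP; split; first exact/measurable_EFinP.
apply: le_lt_trans fi; apply: ge0_le_integral => //.
- by apply: measurableT_comp => //; exact/measurable_EFinP.
- exact: measurableT_comp.
- move=> x _ /=; rewrite /fubini_F /Rintegral /=.
  by case: (\int[m2]_y _)%E => [r| |] /=; rewrite ?normr0 ?leey.
Qed.

Lemma L1_integral_fst h : L1prod h -> L1 m2 (fun y => \int[m1]_x h (x, y)).
Proof.
move=> lh; have mF := measurable_integral_fst lh.
have mh := measurable_int _ lh.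
apply/integrableP; split; first exact/measurable_EFinP.
apply: le_lt_trans ((integrable21ltyP m1 m2 mh).1 lh).
apply: ge0_le_integral => //.
- by apply: measurableT_comp => //; exact/measurable_EFinP.
- apply: (measurable_fun_fubini_tonelli_G (abse \o (EFin \o h))).
    exact: measurableT_comp.
  by move=> z; exact: abse_ge0.
- move=> y _; apply: (@le_trans _ _ `|\int[m1]_x (h (x, y))%:E|%E).
    rewrite /Rintegral /=.
    by case: (\int[m1]_x _)%E => [r| |] /=; rewrite ?normr0 ?leey.
  apply: le_abse_integral => //.
  exact: (measurableT_comp mh).
Qed.

Lemma Fubini1 h : L1prod h ->
  \int[m1]_x \int[m2]_y h (x, y) = \int[m2]_y \int[m1]_x h (x, y).
Proof.
move=> lh; have F := Fubini lh; rewrite {1 3}/Rintegral; congr fine.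
have a1 := L1prod_ae1 lh; have a2 := L1prod_ae2 lh.
have e1 : (\int[m1]_x (\int[m2]_y h (x, y))%:E =
           \int[m1]_x \int[m2]_y (EFin \o h) (x, y))%E.
  apply: ae_eq_integral => //.
  - by apply/measurable_EFinP; exact: measurable_integral_snd.
  - exact: (measurable_fubini_F lh).
  - by apply: filterS a1 => x lx _; rewrite EFin_integral1.
have e2 : (\int[m2]_y (\int[m1]_x h (x, y))%:E =
           \int[m2]_y \int[m1]_x (EFin \o h) (x, y))%E.
  apply: ae_eq_integral => //.
  - by apply/measurable_EFinP; exact: measurable_integral_fst.
  - exact: (measurable_fubini_G lh).
  - by apply: filterS a2 => y ly _; rewrite EFin_integral1.
by rewrite e1 e2.
Qed.

(** Tonelli: the inner integral of the absolute value is at most C |g y|. *)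
Lemma L1prod_kernel k (g : T2 -> R) (C : R) :
  measurable_fun [set: T1 * T2] k -> (forall z, 0 <= k z) ->
  (forall y, (\int[m1]_x (k (x, y))%:E <= C%:E)%E) -> L1 m2 g ->
  L1prod (fun z => k z * g z.2).
Proof.
move=> mk k0 kC lg; have mg := L1_measurable lg.
have mh : measurable_fun [set: T1 * T2] (EFin \o (fun z => k z * g z.2)).
  apply/measurable_EFinP; apply: measurable_funM => //.
  exact: measurableT_comp.
apply/(integrable21ltyP _ _ mh).
apply: (@le_lt_trans _ _ (\int[m2]_y (C * `|g y|)%:E)%E).
  apply: ge0_le_integral => //.
  - by move=> y _; exact: integral_ge0.
  - apply: (measurable_fun_fubini_tonelli_G
      (abse \o (EFin \o (fun z => k z * g z.2)))).
      exact: measurableT_comp.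
    by move=> z; exact: abse_ge0.
  - apply/measurable_EFinP; apply: measurable_funM => //.
    exact: measurableT_comp.
  - move=> y _; rewrite (_ : (fun x => _) =
        (fun x => `|g y|%:E * (k (x, y))%:E)%E); last first.
      apply/funext => x /=; rewrite normrM EFinM muleC.
      by rewrite (ger0_norm (k0 _)).
    rewrite ge0_integralZl//.
    + by rewrite EFinM [leRHS]muleC lee_wpmul2l// lee_fin.
    + by apply/measurable_EFinP; exact: measurableT_comp.
    + by move=> x _; rewrite lee_fin.
have /L1_lty h : L1 m2 (fun y => `|C| * `|g y|) by exact/L1Z/L1_norm.
apply: le_lt_trans (h _ _); last 2 first.
- by apply: measurable_funM => //; exact: measurableT_comp.
- by move=> y; rewrite mulr_ge0.
apply: ge0_le_integral => //.
- move=> y _; have : (0 <= C%:E)%E.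
    by apply: le_trans (kC y); apply: integral_ge0 => x _; rewrite lee_fin.
  by rewrite !lee_fin => C0; rewrite mulr_ge0.
- by apply/measurable_EFinP; apply: measurable_funM => //; exact: measurableT_comp.
- by apply/measurable_EFinP; apply: measurable_funM => //; exact: measurableT_comp.
- by move=> y _; rewrite lee_fin ler_wpM2r// ler_norm.
Qed.

Lemma L1prod_dom h k : measurable_fun [set: T1 * T2] h -> L1prod k ->
  (forall z, `|h z| <= k z) -> L1prod h.
Proof.
move=> mf ig fg; apply: le_integrable ig => //; first exact/measurable_EFinP.
by move=> x _ /=; rewrite lee_fin (le_trans (fg x))// ler_norm.
Qed.

Lemma L1prod_bounded k (M : R) (g : T2 -> R) :
  measurable_fun [set: T1 * T2] k -> (forall z, `|k z| <= M) -> L1 m2 g ->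
  L1prod (fun z => k z * g z.2).
Proof.
move=> mk kM lg.
have lh : L1prod (fun z => `|k z| * `|g z.2|).
  apply: (@L1prod_kernel (fun z => `|k z|) (fun y => `|g y|)
           (M * fine (m1 [set: T1]))).
  - exact: measurableT_comp.
  - by [].
  - move=> y; apply: (@le_trans _ _ (\int[m1]_x M%:E)%E).
      apply: ge0_le_integral => //.
      + apply/measurable_EFinP/measurableT_comp => //.
        exact: measurableT_comp.
      + by move=> x _; rewrite lee_fin (le_trans _ (kM (x, y))).
    by rewrite integral_cst// EFinM fineK// fin_num_measure.
  - exact: L1_norm.
apply: L1prod_dom lh _.
- apply: measurable_funM => //; apply: measurableT_comp => //.
  exact: L1_measurable lg.
- by move=> z; rewrite normrM.
Qed.

End real_fubini.

(** * The area in cylindrical coordinates *)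

Section coordinates.
Context {R : realType}.
Local Notation leb := (@lebesgue_measure R).

Lemma leb_fin (a b : R) : (leb `[a, b]%classic < +oo)%E.
Proof. by rewrite lebesgue_measure_itv/=; case: ifP => _; rewrite ltry. Qed.

Lemma mitv (a b : R) :
  @measurable _ (measurableTypeR R) (`[a, b]%classic : set (measurableTypeR R)).
Proof. exact: measurable_itv. Qed.

Definition itv_measure (a b : R) :
    {finite_measure set (measurableTypeR R) -> \bar R} :=
  mfrestr (mitv a b) (leb_fin a b).

Definition longitude_measure := itv_measure 0 (2 * pi).

Definition height_measure := itv_measure (-1) 1.

Lemma itv_measureE (a b : R) (A : set R) :
  itv_measure a b A = leb (A `&` `[a, b]%classic).
Proof. by []. Qed.

Lemma integral_itv_measure (a b : R) (f : R -> R) : L1 (itv_measure a b) f ->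
  \int[itv_measure a b]_x f x = \int[leb]_(x in `[a, b]) f x.
Proof.
move=> lf; congr fine.
have mC : @measurable _ (measurableTypeR R) (~` `[a, b]%classic).
  by apply: measurableC; exact: mitv.
have m0 : itv_measure a b (~` `[a, b]%classic) = 0%E.
  by rewrite itv_measureE setICl measure0.
have -> := negligible_integral mC measurableT lf m0.
rewrite setTD setCK; apply: eq_measure_integral => A mA AD /=.
by rewrite itv_measureE setIidl.
Qed.

(** A product measure is determined by its values on rectangles. *)
Lemma mrestr_product (A : set (R * R)) :
  @measurable _ (measurableTypeR R * measurableTypeR R)%type A ->
  mrestr (leb \x leb)%E measurable_cylinder A =
  (longitude_measure \x height_measure)%E A.
Proof.
move=> mA; apply/esym/product_measure_unique => // B C mB mC.
rewrite /= /mrestr /mfrestr /= /mrestr.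
rewrite -setXI -product_measure1E//; exact: measurableI.
Qed.

Lemma measurable_cyl (f : sphere R -> R) : measurable_fun [set: sphere R] f ->
  measurable_fun [set: measurableTypeR R * measurableTypeR R]
    (fun q => f (cylindrical q)).
Proof. by move=> mf; exact: (measurableT_comp mf measurable_cylindrical). Qed.

Lemma L1prod_cyl (f : sphere R -> R) (M : R) :
  measurable_fun [set: sphere R] f -> (forall x, `|f x| <= M) ->
  L1prod longitude_measure height_measure (fun q => f (cylindrical q)).
Proof.
move=> mf fM; have mfc := measurable_cyl mf.
have := @L1prod_bounded _ _ _ _ _ longitude_measure height_measure _ M
  (fun=> 1) mfc (fun z => fM (cylindrical z)) (L1_cst _ 1).
by under [X in L1prod _ _ X]eq_fun do rewrite mulr1.
Qed.

Lemma area_fubini (f : sphere R -> R) (M : R) :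
  measurable_fun [set: sphere R] f -> (forall x, `|f x| <= M) ->
  \int[area]_x f x =
  \int[longitude_measure]_t \int[height_measure]_z f (cylindrical (t, z)).
Proof.
move=> mf fM; have lf := L1prod_cyl mf fM.
have mfE : measurable_fun [set: sphere R] (EFin \o f) by exact/measurable_EFinP.
have lr : (mrestr (leb \x leb)%E measurable_cylinder).-integrable
    (@cylindrical R @^-1` [set: sphere R]) ((EFin \o f) \o @cylindrical R).
  rewrite preimage_setT; have /integrableP[mlf lfy] := lf.
  apply/integrableP; split; first by [].
  apply: le_lt_trans lfy; rewrite le_eqVlt; apply/orP; left; apply/eqP.
  by apply: eq_measure_integral => A mA _; exact: mrestr_product.
have e1 : (\int[area]_x (f x)%:E = \int[mrestr (leb \x leb)%E
    measurable_cylinder]_q (f (cylindrical q))%:E)%E.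
  have := @integral_pushforward _ _ (measurableTypeR R *
    measurableTypeR R)%type (sphere R) R (@cylindrical R) measurable_cylindrical
    (mrestr (leb \x leb)%E measurable_cylinder) setT (EFin \o f) mfE lr
    measurableT.
  by [].
have e2 : (\int[mrestr (leb \x leb)%E
    measurable_cylinder]_q (f (cylindrical q))%:E =
    \int[longitude_measure \x height_measure]_q (f (cylindrical q))%:E)%E.
  by apply: eq_measure_integral => A mA _; exact: mrestr_product.
rewrite /Rintegral e1 e2 -[X in fine X = _](integral12_prod_meas1 lf).
apply: (congr1 (@fine R)); apply: ae_eq_integral => //.
- exact: (measurable_fubini_F lf).
- by apply/measurable_EFinP; exact: measurable_integral_snd lf.
- by apply: filterS (L1prod_ae1 lf) => x lx _; rewrite EFin_integral1.
Qed.

Lemma leb_itv (a b : R) : a <= b -> leb `[a, b]%classic = (b - a)%:E.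
Proof.
move=> ab; rewrite lebesgue_measure_itv/= lte_fin.
by case: ltgtP ab => // -> _; rewrite subrr.
Qed.

Lemma area_setT : area [set: sphere R] = (4 * pi)%:E.
Proof.
rewrite /area /pushforward preimage_setT /mrestr setTI product_measure1E//.
transitivity (leb `[0%R, (2 * pi)%R]%classic * leb `[(-1)%R, 1%R]%classic)%E => //.
have p0 : 0 <= 2 * pi :> R by rewrite mulr_ge0 ?pi_ge0.
have p1 : -1 <= 1 :> R by lra.
rewrite (leb_itv p0) (leb_itv p1).
by rewrite -EFinM; congr EFin; ring.
Qed.

Let area_fin_num : fin_num_fun (@area R).
Proof.
move=> A mA; rewrite ge0_fin_numE//.
by apply: (@le_lt_trans _ _ (area [set: sphere R]));
  [rewrite le_measure ?inE|rewrite area_setT ltry].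
Qed.

HB.instance Definition _ :=
  @Measure_isFinite.Build _ _ _ (@area R) area_fin_num.

End coordinates.

(** * Trigonometric and height moments *)

Section pointwise_derivatives.
Context {R : realType}.
Implicit Types (f g : R -> R) (x : R).

Lemma der_eq f x d d' : is_derive x 1 f d -> d = d' -> is_derive x 1 f d'.
Proof. by move=> h <-. Qed.

Lemma derM f g x df dg : is_derive x 1 f df -> is_derive x 1 g dg ->
  is_derive x 1 (fun y => f y * g y) (f x * dg + g x * df).
Proof. by move=> hf hg; exact: is_deriveM. Qed.

Lemma derD f g x df dg : is_derive x 1 f df -> is_derive x 1 g dg ->
  is_derive x 1 (fun y => f y + g y) (df + dg).
Proof. by move=> hf hg; exact: is_deriveD. Qed.

Lemma derZ (c : R) f x df : is_derive x 1 f df ->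
  is_derive x 1 (fun y => c * f y) (c * df).
Proof. by move=> hf; exact: is_deriveZ. Qed.

Lemma derC (c : R) x : is_derive x 1 (fun=> c) 0.
Proof. exact: is_derive_cst. Qed.

Lemma derId x : is_derive x 1 (fun y : R => y) 1.
Proof. exact: is_derive_id. Qed.

Lemma derX f x df n : is_derive x 1 f df ->
  is_derive x 1 (fun y => f y ^+ n) (n%:R * f x ^+ n.-1 * df).
Proof.
move=> hf; have -> : (fun y => f y ^+ n) = f ^+ n.
  by apply/funext => y; rewrite exprfctE.
exact: is_deriveX.
Qed.

End pointwise_derivatives.

Section moments.
Context {R : realType}.
Local Notation leb := (@lebesgue_measure R).

Lemma L1_itv_cont (a b : R) (f : R -> R) :
  continuous f -> L1 (itv_measure a b) f.
Proof.
move=> cf; have mf : measurable_fun [set: measurableTypeR R] f.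
  exact: continuous_measurable_fun.
have : leb.-integrable `[a, b] (EFin \o f).
  apply: continuous_compact_integrable; first exact: segment_compact.
  exact: continuous_subspaceT.
move=> /integrableP[_ lf].
apply/integrableP; split; first exact/measurable_EFinP.
apply: le_lt_trans lf.
have mC : @measurable _ (measurableTypeR R) (~` `[a, b]%classic).
  by apply: measurableC; exact: mitv.
have m0 : itv_measure a b (~` `[a, b]%classic) = 0%E.
  by rewrite itv_measureE setICl measure0.
rewrite -(setUv (`[a, b]%classic : set R)).
rewrite ge0_integral_setU//=; last 2 first.
- apply: measurable_funTS; apply: measurableT_comp => //.
  exact: measurableT_comp.
- by rewrite disj_set2E setICr.
rewrite [X in (_ + X)%E]null_set_integral//; last first.
  by apply: measurable_funTS; do 2 apply: measurableT_comp => //.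
rewrite adde0 le_eqVlt; apply/orP; left; apply/eqP.
by apply: eq_measure_integral => A mA AD; rewrite /= /mfrestr /mrestr setIidl.
Qed.

(** Differentiability is required on the whole line, so that no one-sided
   condition appears at the ends of an interval. *)
Definition primitive (F f : R -> R) : Prop :=
  forall x : R, is_derive x (1 : R) F (f x).

Lemma integral_derivative (a b : R) (F f : R -> R) : a < b ->
  primitive F f -> continuous f ->
  \int[itv_measure a b]_x f x = F b - F a.
Proof.
move=> ab dF cf; rewrite integral_itv_measure; last exact: L1_itv_cont.
have cF x : {for x, continuous F}.
  by apply: differentiable_continuous; apply/derivable1_diffP; have [] := dF x.
rewrite /Rintegral (@continuous_FTC2 _ f F a b)//.
- exact: continuous_subspaceT.
- split.
  + by move=> x _; have [] := dF x.
  + exact/cvg_at_right_filter/cF.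
  + exact/cvg_at_left_filter/cF.
- by move=> x _; rewrite derive1E; have [_ ->] := dF x.
Qed.


Lemma continuous_trig (a1 a2 : R) :
  continuous (fun t : R => a1 * cos t + a2 * sin t).
Proof.
move=> t; apply: cvgD; apply: cvgM; try exact: cvg_cst.
  exact: continuous_cos.
exact: continuous_sin.
Qed.

Lemma continuous_expf (f : R -> R) n : continuous f ->
  continuous (fun t : R => f t ^+ n).
Proof.
move=> cf; elim: n => [|n ih].
  by under [X in continuous X]eq_fun do rewrite expr0; exact: cst_continuous.
under [X in continuous X]eq_fun do rewrite exprS.
by move=> t; apply: cvgM; [exact: cf|exact: ih].
Qed.

Definition trig_moment (a1 a2 : R) (j : nat) : R :=
  \int[longitude_measure]_t ((a1 * cos t + a2 * sin t) ^+ j).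

Lemma itv_measure_cst (a b c : R) : a <= b ->
  \int[itv_measure a b]__ c = c * (b - a).
Proof.
move=> ab; rewrite Rintegral_cst//.
congr (_ * _); transitivity (fine (leb `[a, b]%classic)).
  by congr fine; rewrite /= /mfrestr /mrestr setTI.
by rewrite leb_itv.
Qed.

Lemma trig_moment0 a1 a2 : trig_moment a1 a2 0 = 2 * pi.
Proof.
rewrite /trig_moment; under eq_Rintegral do rewrite expr0.
by rewrite itv_measure_cst ?subr0 ?mul1r// mulr_ge0// pi_ge0.
Qed.

Lemma sin2pi : sin (2 * pi : R) = 0. Proof. by rewrite mulr_natl sin2pi. Qed.
Lemma cos2pi : cos (2 * pi : R) = 1. Proof. by rewrite mulr_natl cos2pi. Qed.

Lemma twopi_gt0 : 0 < 2 * pi :> R. Proof. by rewrite mulr_gt0 ?pi_gt0. Qed.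

Lemma der_trig (a1 a2 t : R) :
  is_derive t 1 (fun t => a1 * cos t + a2 * sin t) (- a1 * sin t + a2 * cos t).
Proof.
have h := derD (derZ a1 (is_derive_cos t)) (derZ a2 (is_derive_sin t)).
apply: (der_eq h).
by rewrite mulrN mulNr.
Qed.

Lemma trig_moment1 a1 a2 : trig_moment a1 a2 1 = 0.
Proof.
rewrite /trig_moment (integral_derivative (F := fun t => - a2 * cos t + a1 * sin t)).
- by rewrite sin2pi cos2pi sin0 cos0 subrr.
- exact: twopi_gt0.
- move=> t; apply: (der_eq (der_trig _ _ t)).
  by rewrite opprK expr1 addrC.
- exact/continuous_expf/continuous_trig.
Qed.

(** Integrate the derivative of g^(j+1) g' over a period, where
   g = a1 cos + a2 sin satisfies g'' = - g and g'^2 = a1^2 + a2^2 - g^2. *)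
Lemma trig_momentSS a1 a2 j :
  j.+2%:R * trig_moment a1 a2 j.+2 =
  j.+1%:R * (a1 ^+ 2 + a2 ^+ 2) * trig_moment a1 a2 j.
Proof.
set g := fun t : R => a1 * cos t + a2 * sin t.
set g' := fun t : R => - a1 * sin t + a2 * cos t.
have cg : continuous g by exact: continuous_trig.
have lg n : L1 longitude_measure (fun t => g t ^+ n).
  by apply: L1_itv_cont; exact: continuous_expf.
have : \int[longitude_measure]_t
   (j.+1%:R * (a1 ^+ 2 + a2 ^+ 2) * g t ^+ j - j.+2%:R * g t ^+ j.+2) = 0.
  rewrite (integral_derivative (F := fun t => g t ^+ j.+1 * g' t)).
  - by rewrite /g /g' sin2pi cos2pi sin0 cos0 subrr.
  - exact: twopi_gt0.
  - move=> t; have dg' := derD (derZ (- a1) (is_derive_sin t))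
      (derZ a2 (is_derive_cos t)).
    apply: (der_eq (derM (derX j.+1 (der_trig a1 a2 t)) dg')).
    rewrite -/(g t) -/(g' t) /=.
    have e : g' t ^+ 2 = a1 ^+ 2 + a2 ^+ 2 - g t ^+ 2.
      have := cos2Dsin2 t; rewrite /g /g' => h.
      apply/eqP; rewrite -subr_eq0; apply/eqP.
      transitivity ((a1 ^+ 2 + a2 ^+ 2) * (cos t ^+ 2 + sin t ^+ 2 - 1)).
        by ring.
      by rewrite h subrr mulr0.
    have -> : - a1 * cos t + a2 * - sin t = - g t by rewrite /g; ring.
    transitivity (j.+1%:R * g t ^+ j * g' t ^+ 2 - g t ^+ j.+2).
      by rewrite !exprS; ring.
    by rewrite e !exprS -natr1; ring.
  - move=> t; apply: cvgB; apply: cvgM; try exact: cvg_cst.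
      exact: continuous_expf.
    exact: continuous_expf.
rewrite integralB1; [|exact: L1Z|exact: L1Z].
by rewrite !integralZ1// => /eqP; rewrite subr_eq0 => /eqP ->.
Qed.

Lemma trig_moment_odd a1 a2 j : odd j -> trig_moment a1 a2 j = 0.
Proof.
have [n] := ubnP j; elim: n j => // n ih [|[|j]] //= jn; rewrite ?trig_moment1//.
rewrite negbK => oj; have := trig_momentSS a1 a2 j.
rewrite (ih j)//; last by rewrite -ltnS ltnW.
by rewrite mulr0 => /eqP; rewrite mulf_eq0 pnatr_eq0 => /eqP.
Qed.

Definition height_moment (i k : nat) : R :=
  \int[height_measure]_z ((1 - z ^+ 2) ^+ i * z ^+ k).

Lemma continuous_height i k : continuous (fun z : R => (1 - z ^+ 2) ^+ i * z ^+ k).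
Proof.
have cX n : continuous (fun z : R => z ^+ n).
  by apply: (@continuous_expf id) => x; exact: cvg_id.
move=> z; apply: cvgM; last exact: cX.
apply: (@continuous_expf (fun z => 1 - z ^+ 2)) => {}z.
by apply: cvgB; [exact: cvg_cst|exact: cX].
Qed.

Lemma ltrN11 : -1 < 1 :> R. Proof. lra. Qed.

Lemma der_height (z : R) i :
  is_derive z 1 (fun z => (1 - z ^+ 2) ^+ i.+1)
    (- (2 * i.+1%:R) * z * (1 - z ^+ 2) ^+ i).
Proof.
have h := derX i.+1 (derD (derC 1 z) (derZ (-1) (derX 2 (derId z)))).
have -> : (fun z : R => (1 - z ^+ 2) ^+ i.+1) = (fun z => (1 + -1 * z ^+ 2) ^+ i.+1).
  by apply/funext => y; rewrite mulN1r.
apply: (der_eq h).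
by rewrite /= mulN1r; ring.
Qed.

(** Integrate the derivative of (1 - z^2)^(i+1) z^(k+1), which vanishes at both
   ends. *)
Lemma height_momentS i k :
  k.+1%:R * height_moment i.+1 k = 2 * i.+1%:R * height_moment i k.+2.
Proof.
have lg m n : L1 height_measure (fun z : R => (1 - z ^+ 2) ^+ m * z ^+ n).
  by apply: L1_itv_cont; exact: continuous_height.
have : \int[height_measure]_z (k.+1%:R * ((1 - z ^+ 2) ^+ i.+1 * z ^+ k) -
     2 * i.+1%:R * ((1 - z ^+ 2) ^+ i * z ^+ k.+2)) = 0 :> R.
  apply: etrans; first apply: (integral_derivative
      (F := fun z => (1 - z ^+ 2) ^+ i.+1 * z ^+ k.+1)).
  - exact: ltrN11.
  - move=> z; apply: (der_eq (derM (der_height z i) (derX k.+1 (derId z)))).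
    by rewrite /= !exprS; ring.
  - move=> z; apply: cvgB; apply: cvgM; try exact: cvg_cst.
      exact: continuous_height.
    exact: continuous_height.
  - by rewrite /= sqrrN expr1n subrr exprS !mul0r subrr.
rewrite integralB1; [|exact: L1Z|exact: L1Z].
by rewrite !integralZ1// => /eqP; rewrite subr_eq0 => /eqP ->.
Qed.

Lemma height_moment_odd i k : odd k -> height_moment i k = 0.
Proof.
have [n] := ubnP k; elim: n k i => // n ih [|[|k]] //= i kn.
  move=> _; rewrite /height_moment.
  apply: etrans; first apply: (integral_derivative
    (F := fun z => - (2 * i.+1%:R)^-1 * (1 - z ^+ 2) ^+ i.+1)).
  - exact: ltrN11.
  - move=> z; apply: (der_eq (derZ _ (der_height z i))).
    by rewrite expr1; field; rewrite nat1r pnatr_eq0.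
  - exact: (@continuous_height i 1).
  - by rewrite /= sqrrN subrr.
rewrite negbK => ok; have := height_momentS i k.
rewrite (ih k)//; last by rewrite -ltnS ltnW.
rewrite mulr0 => /esym/eqP; rewrite !mulf_eq0 !pnatr_eq0 => /eqP ->//.
Qed.

Lemma height_moment0 k : ~~ odd k -> height_moment 0 k = 2 / k.+1%:R.
Proof.
move=> ek; rewrite /height_moment.
apply: etrans; first apply: (integral_derivative
  (F := fun z => k.+1%:R^-1 * z ^+ k.+1)).
- exact: ltrN11.
- move=> z; apply: (der_eq (derZ _ (derX k.+1 (derId z)))).
  by rewrite /= expr0 mul1r mulr1 mulKf// pnatr_eq0.
- exact: continuous_height.
- rewrite /= expr1n -signr_odd /= ek expr1; field.
  by rewrite nat1r pnatr_eq0.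
Qed.

End moments.

(** * Moments of linear forms *)

Section euclidean.
Context {R : realType}.
Implicit Types a b c : 'rV[R]_3.

Definition i0 : 'I_3 := ord0.
Definition i1 : 'I_3 := lift ord0 ord0.
Definition i2 : 'I_3 := ord_max.

Lemma dotE a b : dot a b = a 0 i0 * b 0 i0 + a 0 i1 * b 0 i1 + a 0 i2 * b 0 i2.
Proof.
rewrite /dot !big_ord_recr big_ord0 /= add0r.
by congr (_ + _ + _); congr (a 0 _ * b 0 _); apply/val_inj.
Qed.

Lemma dotC a b : dot a b = dot b a.
Proof. by rewrite !dotE; ring. Qed.

Lemma dotDl a b c : dot (a + b) c = dot a c + dot b c.
Proof. by rewrite !dotE !mxE; ring. Qed.

Lemma dotNl a b : dot (- a) b = - dot a b.
Proof. by rewrite !dotE !mxE; ring. Qed.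

Lemma dotBl a b c : dot (a - b) c = dot a c - dot b c.
Proof. by rewrite dotDl dotNl. Qed.

Lemma dotZl (k : R) a b : dot (k *: a) b = k * dot a b.
Proof. by rewrite !dotE !mxE; ring. Qed.

Lemma dotNr a b : dot b (- a) = - dot b a.
Proof. by rewrite dotC dotNl dotC. Qed.

Lemma dotBr a b c : dot c (a - b) = dot c a - dot c b.
Proof. by rewrite dotC dotBl !(dotC c). Qed.

Lemma dotZr (k : R) a b : dot b (k *: a) = k * dot b a.
Proof. by rewrite dotC dotZl dotC. Qed.

Lemma dot_ge0 a : 0 <= dot a a.
Proof. by rewrite dotE -!expr2 !addr_ge0 ?sqr_ge0. Qed.

Lemma dot_sphere (x : sphere R) : dot x x = 1.
Proof. by case: x => v /= /eqP. Qed.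

Lemma dist2_sphere (x y : sphere R) :
  dot (sphere_val x - sphere_val y) (sphere_val x - sphere_val y) = 2 - 2 * dot x y.
Proof. by rewrite dotBl !dotBr !dot_sphere (dotC y); ring. Qed.

Lemma dot_sphere_le1 (x y : sphere R) : dot x y <= 1.
Proof. by have := dot_ge0 (sphere_val x - sphere_val y); rewrite dist2_sphere; lra. Qed.

Lemma dot_sphere_geN1 (x y : sphere R) : -1 <= dot x y.
Proof.
have := dot_ge0 (sphere_val x + sphere_val y).
rewrite dotDl !(dotC _ (_ + _)) !dotDl !dot_sphere (dotC y); lra.
Qed.

Lemma coord_sphere_le1 (x : sphere R) i : `|sphere_val x 0 i| <= 1.
Proof.
rewrite -(@expr_le1 _ 2)// real_normK ?num_real//.
have := dot_sphere x; rewrite /dot (bigD1 i)//= -expr2 => <-.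
by rewrite lerDl sumr_ge0// => j _; rewrite -expr2 sqr_ge0.
Qed.

Lemma cauchy_schwarz a b : dot a b ^+ 2 <= dot a a * dot b b.
Proof.
rewrite -subr_ge0 !dotE.
set x := a 0 i0; set y := a 0 i1; set z := a 0 i2.
set u := b 0 i0; set v := b 0 i1; set w := b 0 i2.
have -> : (x * x + y * y + z * z) * (u * u + v * v + w * w) -
   (x * u + y * v + z * w) ^+ 2 =
   (x * v - y * u) ^+ 2 + (x * w - z * u) ^+ 2 + (y * w - z * v) ^+ 2 by ring.
by rewrite !addr_ge0 ?sqr_ge0.
Qed.

Lemma dot_bound a (x : sphere R) : `|dot a x| <= 1 + dot a a.
Proof.
have := cauchy_schwarz a x; rewrite dot_sphere mulr1 => h.
have [//|lt] := leP `|dot a x| (1 + dot a a).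
have : dot a x ^+ 2 = `|dot a x| ^+ 2 by rewrite real_normK ?num_real.
move: lt h; set u := `|dot a x|; set v := dot a a => lt h e.
have v0 : 0 <= v by exact: dot_ge0.
rewrite e in h; nra.
Qed.

Lemma measurable_sphere_coord (i : 'I_3) :
  measurable_fun [set: sphere R] (fun x : sphere R => sphere_val x 0 i).
Proof.
move=> _ B mB; apply: sub_sigma_algebra.
rewrite -bigcup_seq; exists i; first by rewrite /= mem_index_enum.
by exists B.
Qed.

Lemma measurable_dot a :
  measurable_fun [set: sphere R] (fun x : sphere R => dot a x).
Proof.
under [X in measurable_fun _ X]eq_fun do rewrite dotE.
have m := measurable_sphere_coord.
by apply: measurable_funD; [apply: measurable_funD|];
  apply: measurable_funM => //; exact: m.
Qed.

Lemma measurable_dot2 : measurable_fun [set: sphere R * sphere R]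
  (fun z : sphere R * sphere R => dot z.1 z.2).
Proof.
under [X in measurable_fun _ X]eq_fun do rewrite dotE.
have m1 i : measurable_fun [set: sphere R * sphere R]
    (fun z : sphere R * sphere R => sphere_val z.1 0 i).
  exact: (measurableT_comp (measurable_sphere_coord i)).
have m2 i : measurable_fun [set: sphere R * sphere R]
    (fun z : sphere R * sphere R => sphere_val z.2 0 i).
  exact: (measurableT_comp (measurable_sphere_coord i)).
by apply: measurable_funD; [apply: measurable_funD|]; exact: measurable_funM.
Qed.

End euclidean.

Section dot_moments.
Context {R : realType}.
Local Notation leb := (@lebesgue_measure R).

(** Distance of the parallel at height z from the axis. *)
Definition cyl_radius (z : R) : R := Num.sqrt (1 - height z ^+ 2).

Lemma dot_cylindrical (a : 'rV[R]_3) (t z : R) :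
  dot a (cylindrical (t, z)) =
  cyl_radius z * (a 0 i0 * cos t + a 0 i1 * sin t) + a 0 i2 * height z.
Proof. by rewrite dotE /= !mxE /= /cyl_radius; ring. Qed.

Lemma heightE (z : R) : z \in `[-1, 1] -> height z = z.
Proof.
rewrite in_itv/= => /andP[h1 h2].
by rewrite /height min_r// max_r.
Qed.

Lemma measurable_height : measurable_fun [set: R] (@height R).
Proof.
rewrite /height; apply: measurable_maxr; first exact: measurable_cst.
by apply: measurable_minr.
Qed.

Lemma measurable_radius : measurable_fun [set: R] cyl_radius.
Proof.
apply: (measurableT_comp (continuous_measurable_fun (@sqrt_continuous R))).
apply: measurable_funB => //; apply: measurable_funX; exact: measurable_height.
Qed.

Lemma height_bound (z : R) : `|height z| <= 1.
Proof.
rewrite -(@expr_le1 _ 2)// real_normK ?num_real//.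
by have := height_sqr z; lra.
Qed.

Lemma radius_bound (z : R) : `|cyl_radius z| <= 1.
Proof.
rewrite -(@expr_le1 _ 2)// real_normK ?num_real// sqr_sqrtr ?height_sqr//.
by rewrite gerBl sqr_ge0.
Qed.

Definition radius_moment (j i : nat) : R :=
  \int[height_measure]_z (cyl_radius z ^+ j * height z ^+ i).

Lemma measurable_radius_height (j i : nat) : measurable_fun [set: measurableTypeR R]
    (fun z => cyl_radius z ^+ j * height z ^+ i).
Proof.
apply: measurable_funM; apply: measurable_funX.
  exact: measurable_radius.
exact: measurable_height.
Qed.

Lemma L1_radius_height (j i : nat) :
  L1 height_measure (fun z => cyl_radius z ^+ j * height z ^+ i).
Proof.
apply: (@L1_bounded _ _ _ _ _ 1); first exact: measurable_radius_height.
move=> z; rewrite normrM !normrX mulr_ile1 ?exprn_ge0//.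
  by rewrite exprn_ile1// radius_bound.
by rewrite exprn_ile1// height_bound.
Qed.

Lemma radius_moment_even (j i : nat) : radius_moment j.*2 i = height_moment j i.
Proof.
rewrite /radius_moment /height_moment integral_itv_measure; last first.
  exact: L1_radius_height.
rewrite integral_itv_measure; last first.
  by apply: L1_itv_cont; exact: (@continuous_height _ j i).
apply: eq_Rintegral => z; rewrite inE/= => zI.
by rewrite -mul2n exprM /cyl_radius sqr_sqrtr ?height_sqr// heightE.
Qed.

Lemma moment_expansion (a : 'rV[R]_3) n :
  \int[area]_x (dot a x ^+ n) =
  \sum_(i < n.+1) ('C(n, i)%:R * a 0 i2 ^+ i * radius_moment (n - i) i *
                   trig_moment (a 0 i0) (a 0 i1) (n - i)).
Proof.
rewrite (@area_fubini _ _ ((1 + dot a a) ^+ n)); last 2 first.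
- by apply: measurable_funX; exact: measurable_dot.
- move=> x; rewrite normrX lerXn2r ?nnegrE//; last exact: dot_bound.
  by rewrite addr_ge0// dot_ge0.
pose g (t : R) := a 0 i0 * cos t + a 0 i1 * sin t.
have lg k : L1 longitude_measure (fun t => g t ^+ k).
  by apply: L1_itv_cont; apply: continuous_expf; exact: continuous_trig.
transitivity (\int[longitude_measure]_t \sum_(i < n.+1)
   (('C(n, i)%:R * a 0 i2 ^+ i * radius_moment (n - i) i) * g t ^+ (n - i))).
  apply: eq_Rintegral => t _.
  transitivity (\int[height_measure]_z \sum_(i < n.+1)
   (('C(n, i)%:R * a 0 i2 ^+ i * g t ^+ (n - i)) *
     (cyl_radius z ^+ (n - i) * height z ^+ i))).
    apply: eq_Rintegral => z _; rewrite dot_cylindrical exprDn.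
    by apply: eq_bigr => i _; rewrite !exprMn -mulr_natl /g; ring.
  rewrite integral_sum1; last by move=> i; apply: L1Z; exact: L1_radius_height.
  apply: eq_bigr => i _; rewrite integralZ1; last exact: L1_radius_height.
  by rewrite /radius_moment; ring.
rewrite integral_sum1; last by move=> i; exact: L1Z.
by apply: eq_bigr => i _; rewrite integralZ1.
Qed.

Lemma sum_even_terms (f : nat -> R) m : (forall i, odd i -> f i = 0) ->
  \sum_(i < m.*2.+1) f i = \sum_(i < m.+1) f i.*2.
Proof.
move=> f0; elim: m => [|m ih]; first by rewrite !big_ord_recr !big_ord0.
rewrite doubleS 2!big_ord_recr /= ih [RHS]big_ord_recr /=.
by rewrite (f0 (m.*2.+1)) ?addr0//= odd_double.
Qed.

(** The recursions of the two families of moments cancel against those of the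
   binomial coefficients: what remains is a term of the binomial expansion of
   (a0^2 + a1^2 + a2^2)^(k+l), up to the power of a2. *)
Lemma moment_terms (a0 a1 : R) k l :
  'C((k + l).*2, l.*2)%:R * trig_moment a0 a1 k.*2 * height_moment k l.*2 *
  (k + l).*2.+1%:R =
  'C(k + l, l)%:R * (a0 ^+ 2 + a1 ^+ 2) ^+ k * (4 * pi).
Proof.
elim: k l => [|k ih] l.
  rewrite !add0n !binn trig_moment0 height_moment0 ?odd_double// expr0.
  by field; rewrite nat1r pnatr_eq0.
have h1 := trig_momentSS a0 a1 k.*2.
have h2 := height_momentS k (l.*2) : _ = _ :> R.
have := ih l.+1; rewrite [l.+1.*2]doubleS addnS -addSn => ih'.
set N := (k.+1 + l)%N in ih' *.
have h3 : (l.*2.+2)%:R * (l.*2.+1)%:R * ('C(N.*2, l.*2.+2))%:R =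
   (k.*2.+2)%:R * (k.*2.+1)%:R * ('C(N.*2, l.*2))%:R :> R.
  have e1 : (N.*2 - l.*2 = k.*2.+2)%N by rewrite /N -doubleB addnK doubleS.
  have e2 : (N.*2 - l.*2.+1 = k.*2.+1)%N by rewrite subnS e1.
  rewrite -!natrM; congr (_%:R).
  rewrite -mulnA mulnC -mulnA.
  rewrite [(_ * l.*2.+2)%N]mulnC mul_bin_left e2 mulnCA mul_bin_left e1.
  by rewrite mulnA [(k.*2.+2 * _)%N]mulnC.
have h4 : l.+1%:R * 'C(N, l.+1)%:R = k.+1%:R * 'C(N, l)%:R :> R.
  by rewrite -!natrM mul_bin_left /N addnK.
have e2 : (k.*2.+2)%:R = 2 * k.+1%:R :> R by rewrite -doubleS -mul2n natrM.
have e3 : (l.*2.+2)%:R = 2 * l.+1%:R :> R by rewrite -doubleS -mul2n natrM.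
move: ih' h1 h2 h3 h4; rewrite !doubleS e2 e3 -/N.
set T := trig_moment _ _ k.*2; set T' := trig_moment _ _ _.
set H := height_moment k _; set H' := height_moment _ _.
set B := a0 ^+ 2 + _ => ih' h1 h2 h3 h4.
have nz : 2 * k.+1%:R * l.*2.+1%:R != 0 :> R by rewrite !mulf_neq0 ?pnatr_eq0.
apply: (mulfI nz).
set n1 := N.*2.+1%:R in ih' *.
transitivity ('C(N.*2, l.*2)%:R * (2 * k.+1%:R * T') * (l.*2.+1%:R * H') * n1).
  by ring.
rewrite h1 h2.
transitivity ((2 * k.+1%:R * (k.*2.+1)%:R * 'C(N.*2, l.*2)%:R) * B * T * H * n1).
  by ring.
rewrite -h3.
transitivity (2 * l.+1%:R * l.*2.+1%:R * B * ('C(N.*2, l.*2.+2)%:R * T * H * n1)).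
  by ring.
rewrite ih' exprS.
transitivity (2 * l.*2.+1%:R * B * B ^+ k * (4 * pi) * (l.+1%:R * 'C(N, l.+1)%:R)).
  by ring.
by rewrite h4; ring.
Qed.

(** Cylindrical coordinates single out an axis, but the moments of a linear form
   do not see it: expanding the power, odd terms vanish and the even ones
   recombine, by the binomial theorem, into a power of dot a a. *)
Lemma dot_moment (a : 'rV[R]_3) n :
  \int[area]_x (dot a x ^+ n) =
  if odd n then 0 else dot a a ^+ n./2 * (4 * pi / n.+1%:R).
Proof.
rewrite moment_expansion; case: ifPn => on.
  apply: big1 => i _; have [oi|ei] := boolP (odd (n - i)).
    by rewrite trig_moment_odd// mulr0.
  have oi : odd i by move: ei; rewrite oddB ?on//= -1?ltnS// negbK.
  rewrite -(odd_double_half (n - i)) (negbTE ei) add0n radius_moment_even.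
  by rewrite height_moment_odd// mulr0 mul0r.
have := odd_double_half n; rewrite (negbTE on) add0n; move: (n./2) => m.
move=> {on}<-.
rewrite (sum_even_terms (f := fun i => ('C(m.*2, i)%:R * a 0 i2 ^+ i *
  radius_moment (m.*2 - i) i * trig_moment (a 0 i0) (a 0 i1) (m.*2 - i)))).
  transitivity (\sum_(i < m.+1) ('C(m, i)%:R * (a 0 i0 ^+ 2 + a 0 i1 ^+ 2) ^+ (m - i) *
     (a 0 i2 ^+ 2) ^+ i * (4 * pi / m.*2.+1%:R))).
    apply: eq_bigr => i _; have := moment_terms (a 0 i0) (a 0 i1) (m - i) i.
    have im : (i <= m)%N by rewrite -ltnS.
    rewrite subnK// -doubleB radius_moment_even => e.
    have nz : m.*2.+1%:R != 0 :> R by rewrite pnatr_eq0.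
    apply: (mulIf nz); rewrite -[RHS]mulrA divfK//.
    transitivity (('C(m.*2, i.*2)%:R * trig_moment (a 0 i0) (a 0 i1) (m - i).*2 *
      height_moment (m - i) i.*2 * m.*2.+1%:R) * a 0 i2 ^+ i.*2); first by ring.
    by rewrite e -mul2n exprM; ring.
  rewrite -big_distrl/=; congr (_ * _).
  have -> : dot a a = (a 0 i0 ^+ 2 + a 0 i1 ^+ 2) + a 0 i2 ^+ 2.
    by rewrite dotE; ring.
  by rewrite exprDn; apply: eq_bigr => i _; rewrite -mulr_natl; ring.
move=> i oi; have [im|im] := leqP i m.*2; last by rewrite bin_small// !mul0r.
by rewrite (@trig_moment_odd _ _ _ (m.*2 - i)) ?mulr0// oddB// odd_double.
Qed.

End dot_moments.

(** * Polynomial cutoffs *)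

Section cutoff.
Context {R : realType}.

Lemma bernoulli_ge (x : R) n : -1 <= x -> 1 + n%:R * x <= (1 + x) ^+ n.
Proof.
move=> x1; elim: n => [|n ih]; first by rewrite mul0r addr0 expr0.
rewrite exprS -natr1; have n0 : 0 <= n%:R :> R by [].
have h : (1 + x) * (1 + n%:R * x) <= (1 + x) * (1 + x) ^+ n.
  by rewrite ler_wpM2l//; lra.
apply: le_trans h; nra.
Qed.

(** The polynomial (1 - v^N)^(2^N) approximates the step at v = 1/2: its
   logarithm is about - (2 v)^N. Bernoulli's inequality, used twice, gives an
   explicit rate. *)
Lemma step_low (v e : R) N : 0 <= v -> 0 <= e <= 1 -> 2 * v <= 1 - e ->
  `|(1 - v ^+ N) ^+ (2 ^ N) - 1| <= (1 + N%:R * e)^-1.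
Proof.
move=> v0 /andP[e0 e1] ve.
have v1 : v <= 1 by lra.
have vN0 : 0 <= v ^+ N <= 1 by rewrite exprn_ge0//= exprn_ile1.
have /andP[q0 q1] := vN0.
have hq : (1 - v ^+ N) ^+ (2 ^ N) <= 1 by rewrite exprn_ile1//; lra.
rewrite ler0_norm ?subr_le0// opprB lerBlDr.
have hb := @bernoulli_ge (- v ^+ N) (2 ^ N) ltac:(lra).
have e2 : (2 ^ N)%:R * v ^+ N = (2 * v) ^+ N :> R by rewrite exprMn natrX.
apply: (@le_trans _ _ ((1 + N%:R * e)^-1 + (1 - (2 * v) ^+ N))); last first.
  by rewrite lerD2l; move: hb; rewrite mulrN e2.
suff : (2 * v) ^+ N <= (1 + N%:R * e)^-1 by lra.
have h1 : (2 * v) ^+ N <= (1 - e) ^+ N by rewrite lerXn2r ?nnegrE//; lra.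
apply: le_trans h1 _.
have p0 : 0 < 1 + N%:R * e by rewrite ltr_pwDl// mulr_ge0.
rewrite -[leRHS]mul1r ler_pdivlMr//.
have h2 := @bernoulli_ge e N ltac:(lra).
apply: (@le_trans _ _ ((1 - e) ^+ N * (1 + e) ^+ N)).
  by rewrite ler_wpM2l// exprn_ge0//; lra.
by rewrite -exprMn exprn_ile1//; nra.
Qed.

Lemma step_high (v e : R) N : v <= 1 -> 0 <= e -> 1 + e <= 2 * v ->
  `|(1 - v ^+ N) ^+ (2 ^ N)| <= (1 + N%:R * e)^-1.
Proof.
move=> v1 e0 ve; have v0 : 0 <= v by lra.
have vN1 : v ^+ N <= 1 by rewrite exprn_ile1.
have vN0 : 0 <= v ^+ N by rewrite exprn_ge0.
rewrite ger0_norm ?exprn_ge0//; last by lra.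
have p0 : 0 < 1 + N%:R * e by rewrite ltr_pwDl// mulr_ge0.
rewrite -[leRHS]mul1r ler_pdivlMr//.
have hb := @bernoulli_ge (v ^+ N) (2 ^ N) ltac:(lra).
have he := @bernoulli_ge e N ltac:(lra).
have e2 : (2 ^ N)%:R * v ^+ N = (2 * v) ^+ N :> R by rewrite exprMn natrX.
have h1 : (1 + e) ^+ N <= (2 * v) ^+ N by rewrite lerXn2r ?nnegrE//; lra.
apply: (@le_trans _ _ ((1 - v ^+ N) ^+ (2 ^ N) * (1 + v ^+ N) ^+ (2 ^ N))).
  rewrite ler_wpM2l ?exprn_ge0//; first by lra.
  by apply: le_trans hb; rewrite e2; lra.
by rewrite -exprMn exprn_ile1//; nra.
Qed.

(** An affine function of u that maps [0, 4] into [0, 1]. The shift by 1 / (n+1)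
   puts u = B on the side where the step takes the value 1, and the exponent
   (n+1)^2 outweighs this shift. *)
Definition cutoff_arg (B : R) (n : nat) (u : R) : R :=
  2^-1 + (u - B - n.+1%:R^-1) / (2 * (B + 4)).

Definition cutoff_poly (B : R) (n : nat) : {poly R} :=
  let w := (2^-1 - (B + n.+1%:R^-1) / (2 * (B + 4)))%:P +
           (2 * (B + 4))^-1 *: 'X in
  (1 - w ^+ (n.+1 ^ 2)) ^+ (2 ^ (n.+1 ^ 2)).

Lemma cutoff_polyE (B : R) n u : 0 < B -> (cutoff_poly B n).[u] =
  (1 - cutoff_arg B n u ^+ (n.+1 ^ 2)) ^+ (2 ^ (n.+1 ^ 2)).
Proof.
move=> B0; rewrite /cutoff_poly /cutoff_arg.
have K0 : 2 * (B + 4) != 0 by rewrite gt_eqF//; lra.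
move: (2 * (B + 4)) K0 => K K0; rewrite !(hornerE, horner_exp).
congr (_ ^+ _); congr (_ - _ ^+ _).
by move: (n.+1%:R^-1) => d; field.
Qed.

Lemma cutoff_arg_itv (B : R) n u : 0 < B -> 0 <= u <= 4 ->
  0 <= cutoff_arg B n u <= 1.
Proof.
move=> B0 /andP[u0 u3]; rewrite /cutoff_arg.
have d0 : 0 <= n.+1%:R^-1 :> R by rewrite invr_ge0.
have d1 : n.+1%:R^-1 <= 1 :> R by rewrite invf_le1 ?ler1n// ltr0n.
set d := n.+1%:R^-1 in d0 d1 *.
have K0 : 0 < 2 * (B + 4) by lra.
have : `|(u - B - d) / (2 * (B + 4))| <= 2^-1.
  rewrite normrM [X in _ * X]ger0_norm; last by rewrite invr_ge0; lra.
  rewrite ler_pdivrMr// ler_norml; lra.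
rewrite ler_norml; lra.
Qed.

Lemma cutoff_bounds (B : R) n u : 0 < B -> 0 <= u <= 4 ->
  0 <= (cutoff_poly B n).[u] <= 1.
Proof.
move=> B0 u03; rewrite cutoff_polyE//.
have /andP[v0 v1] := cutoff_arg_itv n B0 u03.
have h0 : 0 <= cutoff_arg B n u ^+ (n.+1 ^ 2) by rewrite exprn_ge0.
have h1 : cutoff_arg B n u ^+ (n.+1 ^ 2) <= 1 by rewrite exprn_ile1.
by rewrite exprn_ge0 ?exprn_ile1//; lra.
Qed.

Lemma cvg_harmonicZ (c : R) : (fun n => c * n.+1%:R^-1 : R) @ \oo --> (0 : R).
Proof.
by rewrite -[X in _ --> X](mulr0 c); apply: cvgM; [exact: cvg_cst|exact: cvg_harmonic].
Qed.

Lemma cvg_dist_bound (w b : nat -> R) (l : R) :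
  (\forall n \near \oo, `|w n - l| <= b n) -> b @ \oo --> (0 : R) ->
  w @ \oo --> l.
Proof.
move=> h b0; apply: (@squeeze_cvgr _ _ _ _ (fun n => l - b n) (fun n => l + b n)).
- by apply: filterS h => n; rewrite ler_norml => /andP[? ?]; apply/andP; split; lra.
- by rewrite -[X in _ --> X]subr0; apply: cvgB => //; exact: cvg_cst.
- by rewrite -[X in _ --> X]addr0; apply: cvgD => //; exact: cvg_cst.
Qed.

Lemma cvg_harmonic_bound (w : nat -> R) (l c : R) :
  (\forall n \near \oo, `|w n - l| <= c * n.+1%:R^-1) -> w @ \oo --> l.
Proof. by move=> h; apply: (cvg_dist_bound h); exact: cvg_harmonicZ. Qed.

Lemma cvg_cutoff (B : R) u : 0 < B -> 0 <= u <= 4 ->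
  (fun n => (cutoff_poly B n).[u]) @ \oo --> ((u <= B)%R%:R : R).
Proof.
move=> B0 u03; have K0 : 0 < 2 * (B + 4) by lra.
have [uB|Bu] := leP u B.
  apply: (@cvg_harmonic_bound _ _ (B + 4)); apply: nearW => n.
  rewrite cutoff_polyE// (_ : true%:R = 1 :> R)//.
  have /andP[v0 v1] := cutoff_arg_itv n B0 u03.
  pose e : R := 2 * (n.+1%:R^-1 / (2 * (B + 4))).
  have d0 : 0 <= n.+1%:R^-1 :> R by rewrite invr_ge0.
  have d1 : n.+1%:R^-1 <= 1 :> R by rewrite invf_le1 ?ler1n// ltr0n.
  have e0 : 0 <= e by rewrite /e !mulr_ge0// invr_ge0; lra.
  have e1 : e <= 1.
    by rewrite /e mulrA ler_pdivrMr//; move: (n.+1%:R^-1) d1 => d d1; lra.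
  have ve : 2 * cutoff_arg B n u <= 1 - e.
    have h : (u - B - n.+1%:R^-1) / (2 * (B + 4)) <= - (n.+1%:R^-1 / (2 * (B + 4))).
      rewrite -mulNr ler_wpM2r// ?invr_ge0 ?(ltW K0)//.
      by move: (n.+1%:R^-1) => d; lra.
    by rewrite /cutoff_arg /e; move: h; move: (n.+1%:R^-1) => d h; lra.
  apply: le_trans (step_low _ v0 _ ve) _; first by rewrite e0.
  rewrite -[leLHS]mul1r ler_pdivrMr; last by rewrite ltr_pwDl// mulr_ge0.
  have -> : (n.+1 ^ 2)%:R * e = n.+1%:R / (B + 4).
    rewrite /e natrX; field; rewrite nat1r pnatr_eq0 /= gt_eqF//; lra.
  rewrite mulrDr mulr1.
  have -> : (B + 4) / n.+1%:R * (n.+1%:R / (B + 4)) = 1.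
    by field; rewrite nat1r pnatr_eq0 /= gt_eqF//; lra.
  by rewrite lerDr mulr_ge0//; lra.
pose d := u - B; have d0 : 0 < d by rewrite /d; lra.
pose e := d / (2 * (B + 4)).
have e0 : 0 < e by rewrite /e divr_gt0.
apply: (@cvg_harmonic_bound _ _ e^-1).
have := @cvgr_lt _ _ _ _ _ _ (cvg_harmonicZ 1) (d / 2) ltac:(lra).
apply: filterS => n; rewrite mul1r => hn.
rewrite cutoff_polyE// (_ : false%:R = 0 :> R)// subr0.
have /andP[v0 v1] := cutoff_arg_itv n B0 u03.
have ve : 1 + e <= 2 * cutoff_arg B n u.
  have h : d / 2 / (2 * (B + 4)) <= (u - B - n.+1%:R^-1) / (2 * (B + 4)).
    rewrite ler_wpM2r// ?invr_ge0 ?(ltW K0)// -/d.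
    by move: (n.+1%:R^-1) hn => d' hn; lra.
  have h2 : d / 2 / (2 * (B + 4)) = d / (2 * (B + 4)) / 2 by rewrite mulrAC.
  by move: h h2; rewrite /cutoff_arg /e; move: (n.+1%:R^-1) => d' h h2; lra.
apply: le_trans (step_high _ v1 (ltW e0) ve) _.
rewrite -invfM lef_pV2 ?posrE; last 2 first.
- by rewrite ltr_pwDl// mulr_ge0// ltW.
- by rewrite mulr_gt0.
rewrite natrX mulrC; have n1 : 1 <= n.+1%:R :> R by rewrite ler1n.
nra.
Qed.

End cutoff.

(** * Measures determined by their moments *)

Lemma ord3P (j : 'I_3) : j = i0 \/ j = i1 \/ j = i2.
Proof.
case: j => -[|[|[|//]]] j3; [left|right; left|right; right]; exact/val_inj.
Qed.

Section octants.
Context {R : realType}.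

(** Octants form a pi-system that generates the measurable sets, and their
   indicators are products of functions of one coordinate. *)
Definition octant (b : R * R * R) : set (sphere R) :=
  [set x | [/\ sphere_val x 0 i0 <= b.1.1, sphere_val x 0 i1 <= b.1.2 &
               sphere_val x 0 i2 <= b.2]].

Lemma octantE b : octant b =
  (fun x : sphere R => sphere_val x 0 i0) @^-1` `]-oo, b.1.1] `&`
  (fun x : sphere R => sphere_val x 0 i1) @^-1` `]-oo, b.1.2] `&`
  (fun x : sphere R => sphere_val x 0 i2) @^-1` `]-oo, b.2].
Proof.
apply/seteqP; split => x /=; rewrite !in_itv/=.
  by case.
by case=> -[].
Qed.

Lemma measurable_octant b : measurable (octant b).
Proof.
rewrite octantE; have m i c : measurable
    ((fun x : sphere R => sphere_val x 0 i) @^-1` `]-oo, c]).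
  rewrite -[X in measurable X]setTI.
  by apply: (measurable_sphere_coord i) => //; exact: measurable_itv.
by apply: measurableI; [apply: measurableI|].
Qed.

Lemma measurable_octantE :
  @measurable _ (sphere R) = <<s [set octant b | b in [set: R * R * R]] >>.
Proof.
rewrite eqEsubset; split => [A|]; last first.
  apply: smallest_sub; first exact: (@sigma_algebra_measurable _ (sphere R)).
  by move=> _ [b _ <-]; exact: measurable_octant.
set G := [set octant b | b in _].
move: A; apply: smallest_sub; first exact: smallest_sigma_algebra.
rewrite -bigcup_seq => A [i _].
have m : measurable_fun [set: g_sigma_algebraType G]
    (fun x : sphere R => sphere_val x 0 i).
  apply: (measurability _ (RGenOInfty.measurableE R)) => _ [_ [c ->] <-].
  rewrite setTI -[X in measurable X]setCK; apply: measurableC.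
  apply: sub_sigma_algebra.
  pose u j : R := if j == i then c else 1.
  exists (u i0, u i1, u i2) => //; apply/seteqP; split => x; rewrite /octant /=.
    case=> h0 h1 h2; rewrite in_itv/= andbT; apply/negP; rewrite -leNgt.
    have h j : sphere_val x 0 j <= u j by have [->|[->|->]] := ord3P j.
    by have := h i; rewrite /u eqxx.
  rewrite in_itv/= andbT => /negP; rewrite -leNgt => h.
  have h1 j : sphere_val x 0 j <= 1 by rewrite (le_trans (ler_norm _))// coord_sphere_le1.
  by rewrite /u; split; case: eqP => // ->.
by move=> [B mB <-]; exact: (m measurableT B mB).
Qed.

End octants.

(** Dynkin's pi-lambda argument for a class of functions that contains all the
   powers of linear forms and is closed under linear combinations and bounded
   pointwise limits. *)
Section moment_class.
Context {R : realType}.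
Variable same : (sphere R -> R) -> Prop.
Hypothesis same_sum : forall I (r : seq I) (h : I -> sphere R -> R),
  (forall i, same (h i)) -> same (fun x => \sum_(i <- r) h i x).
Hypothesis sameZ : forall c (h : sphere R -> R), same h -> same (fun x => c * h x).
Hypothesis same_cvg : forall (f_ : nat -> sphere R -> R) (f : sphere R -> R) (M : R),
  (forall n, same (f_ n)) -> measurable_fun [set: sphere R] f ->
  (forall x, f_ ^~ x @ \oo --> f x) -> (forall n x, `|f_ n x| <= M) -> same f.
Hypothesis same_pow : forall a n, same (fun x : sphere R => dot a x ^+ n).

Let same_exp a : same (fun x : sphere R => expR (dot a x)).
Proof.
apply: (@same_cvg (fun n x => series (exp_coeff (dot a x)) n) _
  (expR (1 + dot a a))).
- move=> n; rewrite /series/= /exp_coeff/=.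
  under [X in same X]eq_fun do under eq_bigr do rewrite mulrC.
  by apply: same_sum => i; apply: sameZ; exact: same_pow.
- by apply: measurableT_comp => //; exact: measurable_dot.
- by move=> x; exact: is_cvg_series_exp_coeff.
- move=> n x; apply: (@le_trans _ _ (series (exp_coeff `|dot a x|) n)).
    rewrite /series/= (le_trans (ler_norm_sum _ _ _))// ler_sum// => i _.
    by rewrite /exp_coeff/= normrM normrX [X in _ * X]ger0_norm// invr_ge0.
  apply: (@le_trans _ _ (expR `|dot a x|)); last by rewrite ler_expR dot_bound.
  apply: nondecreasing_cvgn_le; last exact: is_cvg_series_exp_coeff.
  apply/nondecreasing_seqP => k; rewrite /series/= big_nat_recr//= lerDl.
  exact: exp_coeff_ge0.
Qed.

(** A product of polynomials in the exponentials of the coordinates is a linear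
   combination of exponentials of linear forms. *)
Let same_poly3 (p q r : {poly R}) : same (fun x : sphere R =>
  p.[expR (sphere_val x 0 i0)] * q.[expR (sphere_val x 0 i1)] *
  r.[expR (sphere_val x 0 i2)]).
Proof.
have -> : (fun x : sphere R => p.[expR (sphere_val x 0 i0)] *
    q.[expR (sphere_val x 0 i1)] * r.[expR (sphere_val x 0 i2)]) =
  (fun x => \sum_(i < size p) \sum_(j < size q) \sum_(k < size r)
     (p`_i * q`_j * r`_k) * expR (dot (vec3 i%:R j%:R k%:R) x)).
  apply/funext => x; rewrite !horner_coef mulr_suml mulr_suml.
  apply: eq_bigr => i _; rewrite -mulrA mulr_suml mulr_sumr.
  apply: eq_bigr => j _; rewrite !mulr_sumr; apply: eq_bigr => k _.
  rewrite dotE !mxE /= !expRD !expRM_natl; ring.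
by apply: same_sum => i; apply: same_sum => j; apply: same_sum => k; exact: sameZ.
Qed.

(** Approximate the three indicators x_i <= t, that is expR x_i <= expR t, by
   polynomial cutoffs in expR x_i, which ranges over a subset of [0, 4]. *)
Let same_octant b : same \1_(octant b).
Proof.
pose p c n := cutoff_poly (expR c : R) n.
have e03 (x : sphere R) i : 0 <= expR (sphere_val x 0 i) <= 4.
  rewrite expR_ge0/=; apply: (@le_trans _ _ (expR 1)).
    by rewrite ler_expR (le_trans (ler_norm _))// coord_sphere_le1.
  have e2 : expR (2^-1 : R) <= 2.
    have := expR_ge1Dx (- 2^-1 : R); rewrite expRN => h.
    rewrite -[leRHS]invrK -[leLHS]invrK lef_pV2 ?posrE ?invr_gt0 ?expR_gt0//; lra.
  have -> : 1 = 2^-1 + 2^-1 :> R by lra.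
  by rewrite expRD; have := expR_gt0 (2^-1 : R); nra.
apply: (@same_cvg (fun n x => (p b.1.1 n).[expR (sphere_val x 0 i0)] *
  (p b.1.2 n).[expR (sphere_val x 0 i1)] *
  (p b.2 n).[expR (sphere_val x 0 i2)]) _ 1).
- by move=> n; exact: same_poly3.
- by apply: measurable_indic; exact: measurable_octant.
- move=> x; have c i t : (fun n => (p t n).[expR (sphere_val x 0 i)]) @ \oo -->
      ((sphere_val x 0 i <= t)%R%:R : R).
    have := @cvg_cutoff _ (expR t) (expR (sphere_val x 0 i)) (expR_gt0 _) (e03 x i).
    by rewrite ler_expR.
  have -> : \1_(octant b) x = (sphere_val x 0 i0 <= b.1.1)%R%:R *
    (sphere_val x 0 i1 <= b.1.2)%R%:R * (sphere_val x 0 i2 <= b.2)%R%:R :> R.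
    rewrite indicE -!natrM !mulnb; congr (_%:R); congr nat_of_bool.
    apply/idP/idP; first by rewrite inE => -[/= -> -> ->].
    by move=> /andP[/andP[h0 h1] h2]; rewrite inE.
  by apply: cvgM; [apply: cvgM|]; exact: c.
- move=> n x; have h i t : `|(p t n).[expR (sphere_val x 0 i)]| <= 1.
    have /andP[h0 h1] := cutoff_bounds n (expR_gt0 t) (e03 x i).
    by rewrite ger0_norm.
  by rewrite !normrM mulr_ile1// ?mulr_ge0// mulr_ile1.
Qed.

Lemma moment_class_indic (A : set (sphere R)) : measurable A -> same \1_A.
Proof.
pose H := [set A : set (sphere R) | measurable A /\ same \1_A].
suff : <<s [set octant b | b in [set: R * R * R]] >> `<=` H.
  rewrite -measurable_octantE => h mA.
  by have [] : measurable A /\ same \1_A := h _ mA.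
apply: lambda_system_subset => //.
- move=> _ _ [b _ <-] [c _ <-].
  exists (Num.min b.1.1 c.1.1, Num.min b.1.2 c.1.2, Num.min b.2 c.2) => //.
  apply/seteqP; rewrite /octant; split => x /=; rewrite !le_min.
    by move=> [/andP[? ?] /andP[? ?] /andP[? ?]].
  by move=> [[-> -> ->] [-> -> ->]].
- split => //.
  + have -> : [set: sphere R] = octant (1, 1, 1).
      apply/esym/seteqP; split => x //= _.
      by split; rewrite (le_trans (ler_norm _))// coord_sphere_le1.
    by split; [exact: measurable_octant|exact: same_octant].
  + move=> B C CB; rewrite /H /= => -[mB sB] [mC sC]; split; first exact: measurableD.
    pose h (b : bool) : sphere R -> R :=
      if b then \1_B else (fun x => -1 * \1_C x).
    have -> : \1_(B `\` C) = (fun x => \sum_(b <- [:: true; false]) h b x) :> (sphere R -> R).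
      apply/funext => x; rewrite !big_cons big_nil addr0 /h mulN1r !indicE.
      rewrite in_setD; case: (boolP (x \in C)) => [xC|_] /=; last by rewrite subr0 andbT.
      by rewrite andbF (_ : x \in B) ?subrr//; move: xC; rewrite !inE => /CB.
    by apply: same_sum => -[] //=; exact: sameZ.
  + move=> F ndF HF; split; first by apply: bigcupT_measurable => i; have [] : measurable (F i) /\ same \1_(F i) := HF i.
    apply: (@same_cvg (fun n => \1_(F n)) _ 1).
    * by move=> n; have [] : measurable (F n) /\ same \1_(F n) := HF n.
    * by apply: measurable_indic; apply: bigcupT_measurable => i; have [] : measurable (F i) /\ same \1_(F i) := HF i.
    * move=> x; apply: cvg_near_cst.
      have [[n _ Fnx]|nF] := pselect ((\bigcup_k F k) x).
        have bx : (\bigcup_k F k) x by exists n.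
        near=> m; have Fm : F m x.
          have : F n `<=` F m by apply/subsetPset/ndF; near: m; exact: nbhs_infty_ge.
          exact.
        by rewrite !indicE (mem_set Fm) (mem_set bx).
      apply: nearW => m; rewrite !indicE !memNset//.
      by move=> Fm; apply: nF; exists m.
    * by move=> n x; rewrite indicE; case: (_ \in _); rewrite ?normr1 ?normr0.
- by move=> _ [b _ <-]; split; [exact: measurable_octant|exact: same_octant].
Unshelve. all: end_near. Qed.

End moment_class.

Section moment_determinacy.
Context {R : realType}.

Lemma bounded_cvg_integral d (T : measurableType d)
    (mu : {finite_measure set T -> \bar R}) (f_ : nat -> T -> R) (f g : T -> R) (M : R) :
  L1 mu g -> (forall n, measurable_fun [set: T] (f_ n)) ->
  measurable_fun [set: T] f -> (forall x, f_ ^~ x @ \oo --> f x) ->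
  (forall n x, `|f_ n x| <= M) ->
  (fun n => \int[mu]_x (g x * f_ n x)) @ \oo --> \int[mu]_x (g x * f x).
Proof.
move=> lg mf_ mf ff fM.
have [|||||_ //] := @dominated_convergence1 _ _ _ mu (fun n x => g x * f_ n x)
  (fun x => g x * f x) (fun x => M * `|g x|).
- by move=> n; apply: measurable_funM => //; exact: L1_measurable lg.
- by apply: measurable_funM => //; exact: L1_measurable lg.
- by apply: aeW => x; apply: cvgM; [exact: cvg_cst|exact: ff].
- exact/L1Z/L1_norm.
- by apply: aeW => x n; rewrite normrM mulrC ler_wpM2r.
Qed.

Lemma dot_pow_bound (a : 'rV[R]_3) n (x : sphere R) :
  `|dot a x ^+ n| <= (1 + dot a a) ^+ n.
Proof.
rewrite normrX lerXn2r ?nnegrE//; last exact: dot_bound.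
by rewrite addr_ge0// dot_ge0.
Qed.

Lemma measurable_dot_pow (a : 'rV[R]_3) n :
  measurable_fun [set: sphere R] (fun x : sphere R => dot a x ^+ n).
Proof. by apply: measurable_funX; exact: measurable_dot. Qed.

(** The functions with equal integrals for both measures form a class to which
   moment_class_indic applies. *)
Lemma moment_determinacy (m1 m2 : {finite_measure set (sphere R) -> \bar R})
    (A : set (sphere R)) :
  (forall (a : 'rV[R]_3) n,
    \int[m1]_x (dot a x ^+ n) = \int[m2]_x (dot a x ^+ n)) ->
  measurable A -> m1 A = m2 A.
Proof.
move=> same_moments mA.
pose same (f : sphere R -> R) : Prop :=
  [/\ L1 m1 f, L1 m2 f & \int[m1]_x f x = \int[m2]_x f x].
have [_ _ e] : same \1_A.
  apply: (@moment_class_indic _ same) => //.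
  - move=> I r h hs; have h1 i : L1 m1 (h i) by have [] := hs i.
    have h2 i : L1 m2 (h i) by have [] := hs i.
    split; [exact: L1_sum|exact: L1_sum|].
    by rewrite !integral_sum1//; apply: eq_bigr => i _; have [] := hs i.
  - by move=> c h [h1 h2 e]; split; [exact: L1Z|exact: L1Z|rewrite !integralZ1// e].
  - move=> f_ f M sf mf ff fM.
    have mf_ n : measurable_fun [set: sphere R] (f_ n).
      by have [/L1_measurable] := sf n.
    have [|||l1 c1] := @dominated_convergence1 _ _ _ m1 f_ f (fun=> M) mf_ mf.
    + exact: aeW.
    + exact: L1_cst.
    + by apply: aeW => x n; exact: fM.
    have [|||l2 c2] := @dominated_convergence1 _ _ _ m2 f_ f (fun=> M) mf_ mf.
    + exact: aeW.
    + exact: L1_cst.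
    + by apply: aeW => x n; exact: fM.
    split=> //; rewrite -(cvg_lim (@Rhausdorff R) c1) -(cvg_lim (@Rhausdorff R) c2).
    by congr (limn _); apply/funext => n; have [] := sf n.
  - move=> a n; have mp := measurable_dot_pow a n.
    by split; [exact: L1_bounded mp (dot_pow_bound a n)
              |exact: L1_bounded mp (dot_pow_bound a n)|exact: same_moments].
rewrite -[LHS]fineK ?fin_num_measure// -[RHS]fineK ?fin_num_measure//.
congr EFin; move: e; rewrite /Rintegral !integral_indic//.
by rewrite !setIT.
Qed.

(** The bounded functions orthogonal to g include every measurable indicator,
   in particular those of the sets where g > 0 and where g < 0. *)
Lemma moments_eq0 (mu : {finite_measure set (sphere R) -> \bar R})
    (g : sphere R -> R) : L1 mu g ->
  (forall (a : 'rV[R]_3) n, \int[mu]_x (g x * dot a x ^+ n) = 0) ->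
  {ae mu, forall x, g x = 0}.
Proof.
move=> lg g0; have mg := L1_measurable lg.
pose same (f : sphere R -> R) : Prop :=
  [/\ measurable_fun [set: sphere R] f, L1 mu (fun x => g x * f x) &
      \int[mu]_x (g x * f x) = 0].
have s A : measurable A -> same \1_A.
  apply: (@moment_class_indic _ same) => //.
  - move=> I r h hs; have h1 i : measurable_fun setT (h i) by have [] := hs i.
    have h2 i : L1 mu (fun x => g x * h i x) by have [] := hs i.
    have e : (fun x => g x * \sum_(i <- r) h i x) = (fun x => \sum_(i <- r) g x * h i x).
      by apply/funext => x; rewrite mulr_sumr.
    split; first exact: measurable_sum.
      by rewrite e; exact: L1_sum.
    by rewrite e integral_sum1// big1// => i _; have [] := hs i.
  - move=> c h [h1 h2 e].
    have ec : (fun x => g x * (c * h x)) = (fun x => c * (g x * h x)).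
      by apply/funext => x; ring.
    split; first exact: measurable_funM.
      by rewrite ec; exact: L1Z.
    by rewrite ec integralZ1// e mulr0.
  - move=> f_ f M sf mf ff fM.
    have mf_ n : measurable_fun [set: sphere R] (f_ n) by have [] := sf n.
    have fxM x : `|f x| <= M.
      rewrite ler_norml; apply/andP; split.
        apply: (cvgr_to_ge (ff x)); apply: nearW => n.
        by have := fM n x; rewrite ler_norml => /andP[].
      apply: (cvgr_to_le (ff x)); apply: nearW => n.
      by have := fM n x; rewrite ler_norml => /andP[].
    split => //; first exact: (L1M lg mf fxM).
    have c := bounded_cvg_integral lg mf_ mf ff fM.
    rewrite -(cvg_lim (@Rhausdorff R) c).
    have -> : (fun n => \int[mu]_x (g x * f_ n x)) = (fun=> 0).
      by apply/funext => n; have [] := sf n.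
    by rewrite lim_cst.
  - move=> a n; have mp := measurable_dot_pow a n.
    by split => //; exact: (L1M lg mp (dot_pow_bound a n)).
have mpos : measurable [set x | 0 < g x].
  have -> : [set x | 0 < g x] = [set: sphere R] `&` g @^-1` `]0, +oo[.
    by apply/seteqP; split => x /=; rewrite in_itv/= andbT//; case.
  by apply: mg.
have mneg : measurable [set x | g x < 0].
  have -> : [set x | g x < 0] = [set: sphere R] `&` g @^-1` `]-oo, 0[.
    by apply/seteqP; split => x /=; rewrite in_itv/=//; case.
  by apply: mg.
have [_ lp ip] := s _ mpos; have [_ ln in_] := s _ mneg.
have abs0 : \int[mu]_x `|g x| = 0.
  transitivity (\int[mu]_x (g x * \1_[set x | (0 < g x)%R] x - g x * \1_[set x | (g x < 0)%R] x)).
    apply: eq_Rintegral => x _; rewrite !indicE.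
    have [gx|gx|gx] := ltgtP (g x) 0.
    - rewrite memNset/= ?mem_set//=; last by apply/negP; rewrite -leNgt ltW.
      by rewrite mulr0 mulr1 sub0r ltr0_norm.
    - rewrite mem_set//= memNset/=; last by apply/negP; rewrite -leNgt ltW.
      by rewrite mulr0 mulr1 subr0 gtr0_norm.
    - by rewrite gx normr0 !mul0r subrr.
  by rewrite integralB1// ip in_ subrr.
have : ae_eq mu [set: sphere R] (EFin \o g) (cst 0%E).
  apply/(ae_eq_integral_abs mu measurableT (measurable_int _ lg)).
  have := EFin_integral1 (L1_norm lg); rewrite abs0 => e.
  by rewrite [RHS]e; apply: eq_integral.
by apply: filterS => x /(_ I) [].
Qed.

End moment_determinacy.

(** * Reflections and zonal integrals *)

Section reflections.
Context {R : realType}.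
Implicit Types (v a b : 'rV[R]_3) (x y p : sphere R).

(** As division by 0 yields 0, this is the identity at v = 0; hence to_pole needs
   no separate treatment of the north pole. *)
Definition householder v a : 'rV[R]_3 := a - (2 * dot v a / dot v v) *: v.

Lemma dot_householder v a b : dot (householder v a) b = dot a (householder v b).
Proof. by rewrite /householder dotBl dotBr dotZl dotZr (dotC a v); ring. Qed.

Lemma householderK v : involutive (householder v).
Proof.
move=> a; rewrite {1}/householder {2}/householder dotBr dotZr.
have [v0|v0] := eqVneq (dot v v) 0.
  by rewrite /householder v0 invr0 !mulr0 !scale0r !subr0.
have -> : 2 * (dot v a - 2 * dot v a / dot v v * dot v v) / dot v v =
    - (2 * dot v a / dot v v) by field.
by rewrite scaleNr opprK /householder subrK.
Qed.

Lemma householder_isometry v a b :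
  dot (householder v a) (householder v b) = dot a b.
Proof. by rewrite dot_householder householderK. Qed.

Lemma householder_subproof v x :
  dot (householder v x) (householder v x) == 1.
Proof. by rewrite householder_isometry dot_sphere. Qed.

Definition reflection v x : sphere R := Sphere (householder_subproof v x).

Lemma dot_reflection v x a : dot (reflection v x) a = dot x (householder v a).
Proof. exact: dot_householder. Qed.

Lemma measurable_reflection v : measurable_fun [set: sphere R] (reflection v).
Proof.
apply: (measurability (\big[setU/set0]_(i < 3)
  preimage_set_system [set: sphere R] (@sphere_coord R i) measurable)) => //.
move=> _ [B + <-]; rewrite -bigcup_seq => -[i _ [C mC <-]].
rewrite !setTI -[X in measurable X]setTI.
have m : measurable_fun [set: sphere R]
    (fun x => sphere_coord i (reflection v x)).
  have -> : (fun x => sphere_coord i (reflection v x)) =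
      (fun x => dot (householder v (delta_mx 0 i)) x).
    apply/funext => x; rewrite dotC -dot_reflection /sphere_coord dotE !mxE.
    by have [->|[->|->]] := ord3P i; rewrite /= ?eqxx /=; ring.
  exact: measurable_dot.
exact: (m measurableT C mC).
Qed.

Definition reflected_area v : set (sphere R) -> \bar R :=
  pushforward area (reflection v).

Section measure.
Variable v : 'rV[R]_3.

Lemma reflected_area0 : reflected_area v set0 = 0%E.
Proof. by rewrite /reflected_area /pushforward preimage_set0 measure0. Qed.

Lemma reflected_area_ge0 A : (0 <= reflected_area v A)%E.
Proof. by rewrite /reflected_area /pushforward measure_ge0. Qed.

Lemma reflected_area_additive : semi_sigma_additive (reflected_area v).
Proof.
have mC A : measurable A -> measurable (reflection v @^-1` A).
  move=> mA; rewrite -[X in measurable X]setTI.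
  exact: measurable_reflection.
move=> F mF tF mUF; rewrite /reflected_area /pushforward preimage_bigcup.
apply: measure_semi_sigma_additive.
- by move=> n; exact: mC.
- apply/trivIsetP => /= i j _ _ ij; rewrite -preimage_setI.
  by move/trivIsetP : tF => /(_ _ _ _ _ ij) ->//; rewrite preimage_set0.
- by rewrite -preimage_bigcup; exact: mC.
Qed.

HB.instance Definition _ := isMeasure.Build _ _ _ (reflected_area v)
  reflected_area0 reflected_area_ge0 reflected_area_additive.

Let reflected_area_fin_num : fin_num_fun (reflected_area v).
Proof.
move=> A mA; have := measurable_reflection v measurableT mA.
by rewrite setTI => mRA; rewrite /reflected_area /pushforward fin_num_measure.
Qed.

HB.instance Definition _ :=
  @Measure_isFinite.Build _ _ _ (reflected_area v) reflected_area_fin_num.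

End measure.

Lemma L1_pushforward v (f : sphere R -> R) : measurable_fun [set: sphere R] f ->
  L1 area (fun x => f (reflection v x)) ->
  \int[reflected_area v]_x f x = \int[area]_x f (reflection v x).
Proof.
move=> mf lf; rewrite /Rintegral; apply: (congr1 (@fine R)).
have mfE : measurable_fun [set: sphere R] (EFin \o f) by exact/measurable_EFinP.
by have := @integral_pushforward _ _ _ _ R _ (measurable_reflection v) area setT
  (EFin \o f) mfE lf measurableT.
Qed.

(** Both measures have the same moments, since a reflection preserves the norm
   of a linear form. *)
Lemma reflected_areaE v A : measurable A -> reflected_area v A = area A.
Proof.
apply: moment_determinacy => a n.
have l b : L1 area (fun x : sphere R => dot b x ^+ n).
  apply: (@L1_bounded _ _ _ _ _ ((1 + dot b b) ^+ n)).
    by apply: measurable_funX; exact: measurable_dot.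
  move=> x; rewrite normrX lerXn2r ?nnegrE//; last exact: dot_bound.
  by rewrite addr_ge0// dot_ge0.
have e : (fun x : sphere R => dot a (reflection v x) ^+ n) =
         (fun x : sphere R => dot (householder v a) x ^+ n).
  by apply/funext => x; rewrite dotC dot_reflection dotC.
rewrite L1_pushforward; last 2 first.
- by apply: measurable_funX; exact: measurable_dot.
- by rewrite e.
by rewrite e !dot_moment householder_isometry.
Qed.

Lemma area_reflection_ge0 v (f : sphere R -> \bar R) :
  measurable_fun [set: sphere R] f -> (forall x, 0 <= f x)%E ->
  (\int[area]_x f (reflection v x) = \int[area]_x f x)%E.
Proof.
move=> mf f0; transitivity (\int[reflected_area v]_x f x)%E.
  apply/esym.
  have := @ge0_integral_pushforward _ _ _ _ R _ (measurable_reflection v) area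
    setT f measurableT mf.
  by apply=> x _; exact: f0.
by apply: eq_measure_integral => A mA _; exact: reflected_areaE.
Qed.

Lemma L1_reflection v (f : sphere R -> R) : L1 area f ->
  L1 area (fun x => f (reflection v x)).
Proof.
move=> lf; have mf := L1_measurable lf.
have mfr : measurable_fun [set: sphere R] (fun x => f (reflection v x)).
  exact: (measurableT_comp mf (measurable_reflection v)).
apply/integrableP; split; first exact/measurable_EFinP.
have /integrableP[_] := lf.
rewrite -(area_reflection_ge0 v (f := fun x => `|(f x)%:E|%E))//.
by apply: measurableT_comp => //; exact/measurable_EFinP.
Qed.

Lemma area_reflection v (f : sphere R -> R) : L1 area f ->
  \int[area]_x f (reflection v x) = \int[area]_x f x.
Proof.
move=> lf; have lr := L1_reflection v lf.
rewrite -(L1_pushforward (L1_measurable lf) lr) /Rintegral.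
apply: (congr1 (@fine R)); apply: eq_measure_integral => A mA _.
exact: reflected_areaE.
Qed.

Definition north : sphere R := cylindrical (0, 1).

Lemma height1 : height 1 = 1 :> R.
Proof. by rewrite heightE// in_itv/= lexx andbT; lra. Qed.

Lemma radius1 : cyl_radius 1 = 0 :> R.
Proof. by rewrite /cyl_radius height1 expr1n subrr sqrtr0. Qed.

Lemma dot_north a : dot a north = a 0 i2.
Proof. by rewrite dot_cylindrical radius1 height1 mul0r add0r mulr1. Qed.

Lemma dot_north_cyl (t z : R) : dot (cylindrical (t, z)) north = height z.
Proof. by rewrite dot_north mxE. Qed.

(** The reflection in this direction exchanges p and the north pole. *)
Definition to_pole p := sphere_val p - sphere_val north.

Lemma sphere_dot1 x y : dot x y = 1 -> sphere_val x = sphere_val y.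
Proof.
move=> xy; apply/eqP; rewrite -subr_eq0; apply/eqP.
have := dist2_sphere x y; rewrite xy mulr1 subrr dotE => /eqP.
rewrite -!expr2 !paddr_eq0 ?addr_ge0 ?sqr_ge0// !sqrf_eq0 => /andP[/andP[h0 h1] h2].
apply/rowP => i; rewrite [RHS]mxE.
by have [->|[->|->]] := ord3P i; apply/eqP.
Qed.

Lemma householder_to_pole p : householder (to_pole p) p = north.
Proof.
rewrite /householder; have := dist2_sphere p north; rewrite -/(to_pole p) => d.
have [e|ne] := eqVneq (dot p north) 1.
  by rewrite /to_pole (sphere_dot1 e) subrr scaler0 subr0.
have -> : 2 * dot (to_pole p) p / dot (to_pole p) (to_pole p) = 1.
  rewrite d /to_pole dotBl dot_sphere (dotC _ p); field.
  by apply: contra ne => /eqP h; apply/eqP; lra.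
by rewrite scale1r /to_pole opprB addrC subrK.
Qed.

Lemma dot_to_pole p x : dot (reflection (to_pole p) x) p = dot x north.
Proof. by rewrite dot_reflection householder_to_pole. Qed.

(** Archimedes: after a reflection taking p to the pole, the variable dot x p is
   the height, whose distribution is uniform. *)
Lemma area_zonal (phi : R -> R) p : continuous phi ->
  \int[area]_x phi (dot x p) = 2 * pi * \int[height_measure]_z phi z.
Proof.
move=> cphi.
have lphi : L1 height_measure phi by exact: L1_itv_cont.
have [M phiM] : exists M, forall z : R, `|phi (height z)| <= M.
  have : compact (phi @` `[-1, 1]%classic).
    apply: continuous_compact; last exact: segment_compact.
    exact: continuous_subspaceT.
  move=> /compact_bounded [M [_ hM]]; exists (M + 1) => z.
  apply: (hM (M + 1)); first by rewrite ltrDl.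
  exists (height z) => //=; rewrite in_itv/=.
  by have := height_bound z; rewrite ler_norml.
have hd x p' : height (dot (sphere_val x) (sphere_val p')) = dot x p'.
  by rewrite heightE// in_itv/= dot_sphere_le1 dot_sphere_geN1.
have mphi : measurable_fun [set: sphere R] (fun x => phi (dot x north)).
  apply: (measurableT_comp (continuous_measurable_fun cphi)).
  under [X in measurable_fun _ X]eq_fun do rewrite dotC.
  exact: measurable_dot.
have mphip : measurable_fun [set: sphere R] (fun x => phi (dot x p)).
  apply: (measurableT_comp (continuous_measurable_fun cphi)).
  under [X in measurable_fun _ X]eq_fun do rewrite dotC.
  exact: measurable_dot.
have bM x y : `|phi (dot x y)| <= M by rewrite -hd.
rewrite -(area_reflection (to_pole p)); last exact: L1_bounded mphip (bM ^~ p).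
under eq_Rintegral do rewrite dot_to_pole.
rewrite (area_fubini mphi (bM ^~ north)).
under eq_Rintegral do under eq_Rintegral do rewrite dot_north_cyl.
rewrite itv_measure_cst; last by rewrite mulr_ge0// pi_ge0.
rewrite subr0 mulrC; congr (_ * _).
rewrite integral_itv_measure; last first.
  apply: (@L1_bounded _ _ _ _ _ M); last by [].
  exact: (measurableT_comp (continuous_measurable_fun cphi) measurable_height).
rewrite [RHS]integral_itv_measure//.
by apply: eq_Rintegral => z; rewrite inE /= => zI; rewrite heightE.
Qed.

End reflections.

(** * The logarithmic kernel *)

Section fatou_bound.
Context d (T : measurableType d) (R : realType).
Variable mu : {finite_measure set T -> \bar R}.

(** Uniform bounds on truncations give a bound for the limit, not yet known to be
   integrable. *)
Lemma fatou_bound (f_ : nat -> T -> R) (f : T -> R) (C : R) :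
  (forall n, L1 mu (f_ n)) -> (forall n x, 0 <= f_ n x) ->
  measurable_fun [set: T] f -> (forall x, 0 <= f x) ->
  {ae mu, forall x, f_ ^~ x @ \oo --> f x} ->
  (forall n, \int[mu]_x f_ n x <= C) -> (\int[mu]_x (f x)%:E <= C%:E)%E.
Proof.
move=> lf f_0 mf f0 ff fC.
pose g (k : nat) x := Num.min (f x) k%:R.
have mg k : measurable_fun [set: T] (g k) by exact: measurable_minr.
have g0 k x : 0 <= g k x by rewrite le_min f0 ler0n.
have gC k : \int[mu]_x g k x <= C.
  have mfk n : measurable_fun [set: T] (fun x => Num.min (f_ n x) k%:R).
    by apply: measurable_minr => //; exact: L1_measurable (lf n).
  have b n x : `|Num.min (f_ n x) k%:R| <= k%:R.
    by rewrite ger0_norm ?le_min ?f_0 ?ler0n// ge_min lexx orbT.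
  have [|||_ c] := @dominated_convergence1 _ _ _ mu
      (fun n x => Num.min (f_ n x) k%:R) (g k) (fun=> k%:R) mfk (mg k).
  - apply: filterS ff => x fx.
    apply: (@cvg_dist_bound _ _ (fun n => `|f_ n x - f x|)).
      apply: nearW => n; rewrite /g.
      have : f_ n x - f x <= `|f_ n x - f x| by exact: ler_norm.
      have : f x - f_ n x <= `|f_ n x - f x| by rewrite distrC ler_norm.
      by rewrite ler_norml; case: (leP (f_ n x) k%:R); case: (leP (f x) k%:R); lra.
    apply/norm_cvg0P; rewrite -(subrr (f x)).
    by apply: cvgB => //; exact: cvg_cst.
  - exact: L1_cst.
  - exact: aeW.
  apply: (cvgr_to_le c); apply: nearW => n; apply: le_trans (fC n).
  apply: le_integral1 => //; last by move=> x; rewrite ge_min lexx.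
  by apply: (@L1_bounded _ _ _ _ _ k%:R) => // x; exact: b.
have lg k : L1 mu (g k).
  apply: (@L1_bounded _ _ _ _ _ k%:R) => // x.
  by rewrite ger0_norm// ge_min lexx orbT.
have c : (\int[mu]_x (g k x)%:E)%E @[k --> \oo] --> (\int[mu]_x (f x)%:E)%E.
  have -> : (\int[mu]_x (f x)%:E)%E =
      (\int[mu]_x (limn (fun k => (g k x)%:E)))%E.
    apply: eq_integral => x _; apply/esym/cvg_lim => //.
    apply: cvg_near_cst; near=> k; rewrite /g min_l//.
    by near: k; exact: nbhs_infty_ger.
  apply: cvg_monotone_convergence => //.
  - by move=> n; exact/measurable_EFinP.
  - by move=> n x _; rewrite lee_fin.
  - move=> x _ a b ab; rewrite lee_fin /g le_min ge_min lexx/=.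
    by rewrite ge_min ler_nat ab orbT.
apply: (cvge_to_le c); apply: nearW => k.
by rewrite -EFin_integral1// lee_fin.
Unshelve. all: end_near. Qed.

End fatou_bound.

Section truncated_log.
Context {R : realType}.
Implicit Types (s : R) (n : nat).

(** Truncating the power series of - ln (1 - s), instead of smoothing the
   logarithm, produces polynomials below it with an explicit derivative. *)
Definition log_sum n s : R := \sum_(k < n) (k.+1%:R)^-1 * s ^+ k.+1.
Definition geom_sum n s : R := \sum_(k < n) s ^+ k.
(** As ln 0 = 0, the value at s = 1 is 0; only the values at s < 1 matter, since
   s = 1 will occur on a negligible set. *)
Definition neg_log s : R := - ln (1 - s).

Lemma geom_sumE n s : (1 - s) * geom_sum n s = 1 - s ^+ n.
Proof. by rewrite /geom_sum -opprB mulNr -subrX1 opprB. Qed.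

Lemma geom_sum_ge0 n s : 0 <= s -> 0 <= geom_sum n s.
Proof. by move=> s0; apply: sumr_ge0 => i _; rewrite exprn_ge0. Qed.

Lemma log_sum_ge0 n s : 0 <= s -> 0 <= log_sum n s.
Proof. by move=> s0; apply: sumr_ge0 => i _; rewrite mulr_ge0// ?invr_ge0// exprn_ge0. Qed.

Lemma log_sumS n s : log_sum n.+1 s = log_sum n s + (n.+1%:R)^-1 * s ^+ n.+1.
Proof. by rewrite /log_sum big_ord_recr. Qed.

Lemma log_sum0 n : log_sum n 0 = 0.
Proof. by rewrite /log_sum big1// => i _; rewrite exprS mul0r mulr0. Qed.

Lemma geom_sumS n s : geom_sum n.+1 s = geom_sum n s + s ^+ n.
Proof. by rewrite /geom_sum big_ord_recr. Qed.

Lemma log_sum_bound n s : 0 <= s <= 1 -> `|log_sum n s| <= n%:R.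
Proof.
move=> /andP[s0 s1]; rewrite ger0_norm ?log_sum_ge0//.
elim: n => [|n ih]; first by rewrite /log_sum big_ord0.
have n1 : (n.+1%:R : R)^-1 <= 1 by rewrite invf_le1 ?ler1n.
rewrite log_sumS -natr1 lerD//.
by apply: mulr_ile1 => //; [exact: exprn_ge0|rewrite natr1|exact: exprn_ile1].
Qed.

Lemma geom_sum_bound n s : 0 <= s <= 1 -> `|geom_sum n s| <= n%:R.
Proof.
move=> /andP[s0 s1]; rewrite ger0_norm ?geom_sum_ge0//.
elim: n => [|n ih]; first by rewrite /geom_sum big_ord0.
by rewrite geom_sumS -natr1 lerD// exprn_ile1.
Qed.

Lemma neg_log_ge0 s : 0 <= s -> 0 <= neg_log s.
Proof. by move=> s0; rewrite oppr_ge0 ln_le0//; lra. Qed.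

Lemma neg_log_exp s : s < 1 -> expR (neg_log s) = (1 - s)^-1.
Proof. by move=> s1; rewrite /neg_log expRN lnK// posrE subr_gt0. Qed.

Lemma der_log_sum n s : is_derive s 1 (log_sum n) (geom_sum n s).
Proof.
elim: n => [|n ih].
  have -> : log_sum 0 = (fun=> 0) by apply/funext => u; rewrite /log_sum big_ord0.
  by rewrite /geom_sum big_ord0; exact: derC.
have -> : log_sum n.+1 = (fun u => log_sum n u + (n.+1%:R)^-1 * u ^+ n.+1).
  by apply/funext => u; rewrite log_sumS.
apply: (der_eq (derD ih (derZ _ (derX n.+1 (derId s))))).
by rewrite geom_sumS mulr1 mulKf// pnatr_eq0.
Qed.

Lemma continuous_log_sum n : continuous (log_sum n).
Proof.
move=> s; apply: differentiable_continuous; apply/derivable1_diffP.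
by have [] := der_log_sum n s.
Qed.

Lemma continuous_geom_sum n : continuous (geom_sum n).
Proof.
elim: n => [|n ih].
  have -> : geom_sum 0 = (fun=> 0) by apply/funext => u; rewrite /geom_sum big_ord0.
  exact: cst_continuous.
have -> : geom_sum n.+1 = (fun u => geom_sum n u + u ^+ n).
  by apply/funext => u; rewrite geom_sumS.
by move=> s; apply: cvgD; [exact: ih|exact: exprn_continuous].
Qed.

Lemma der_neg_log s : s < 1 -> is_derive s 1 neg_log (1 - s)^-1.
Proof.
move=> s1; have h : is_derive s 1 (fun u : R => 1 - u) (-1).
  have -> : (fun u : R => 1 - u) = (fun u => 1 + -1 * u).
    by apply/funext => u; rewrite mulN1r.
  by apply: (der_eq (derD (derC 1 s) (derZ (-1) (derId s)))); rewrite add0r mulr1.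
have hl : is_derive (1 - s) 1 (@ln R) (1 - s)^-1.
  by apply: is_derive1_ln; rewrite subr_gt0.
have := derZ (-1) (@is_derive1_comp R (@ln R) (fun u => 1 - u) s _ _ hl h).
have -> : (fun y => -1 * (@ln R \o (fun u => 1 - u)) y) = neg_log.
  by apply/funext => u; rewrite mulN1r.
by move=> H; apply: (der_eq H); rewrite mulrN1 mulN1r opprK.
Qed.

(** Mean value theorem: the derivative of the remainder is s^n / (1 - s). *)
Lemma neg_log_remainder n s : 0 <= s -> s < 1 ->
  0 <= neg_log s - log_sum n s <= s ^+ n * (s / (1 - s)).
Proof.
rewrite le_eqVlt => /orP[/eqP<- _|s0 s1].
  rewrite /neg_log subr0 ln1 oppr0 mul0r mulr0 sub0r.
  by rewrite log_sum0 oppr0 lexx.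
pose F u := neg_log u + -1 * log_sum n u.
have dF (u : R) : u < 1 -> is_derive u 1 F ((1 - u)^-1 + -1 * geom_sum n u).
  by move=> u1; apply: derD; [exact: der_neg_log|apply: derZ; exact: der_log_sum].
have [||c] := @MVT R F (fun u => (1 - u)^-1 + -1 * geom_sum n u) 0 s s0.
- by move=> u; rewrite in_itv/= => /andP[_ us]; apply: dF; exact: lt_trans s1.
- apply: derivable_within_continuous => u; rewrite in_itv/= => /andP[_ us].
  by have [] := dF u (le_lt_trans us s1).
rewrite in_itv/= => /andP[c0 cs].
have -> : F s - F 0 = neg_log s - log_sum n s.
  rewrite /F /neg_log subr0 ln1 oppr0 add0r mulN1r mulN1r opprK.
  by rewrite log_sum0 addr0.
have c1 : 0 < 1 - c by lra.
have -> : (1 - c)^-1 + -1 * geom_sum n c = c ^+ n / (1 - c).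
  have := geom_sumE n c; set g := geom_sum n c => e.
  have -> : c ^+ n = 1 - (1 - c) * g by rewrite e; ring.
  by field; rewrite gt_eqF.
rewrite subr0 => ->; apply/andP; split.
  by rewrite mulr_ge0 ?(ltW s0)// divr_ge0 ?exprn_ge0// ltW.
rewrite -mulrA ler_pM ?exprn_ge0 ?(ltW c0)//.
- by rewrite mulr_ge0 ?invr_ge0 ?(ltW s0)// ltW.
- by rewrite lerXn2r ?nnegrE ?(ltW c0) ?(ltW s0)// ltW.
- rewrite mulrC ler_pM2l// lef_pV2 ?posrE//; lra.
Qed.

Lemma log_sum_le n s : 0 <= s -> s < 1 -> log_sum n s <= neg_log s.
Proof. by move=> s0 s1; have /andP[] := neg_log_remainder n s0 s1; rewrite subr_ge0. Qed.

Lemma cvg_log_sum s : 0 <= s -> s < 1 -> log_sum n s @[n --> \oo] --> neg_log s.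
Proof.
move=> s0 s1; apply: (@cvg_dist_bound _ _ (fun n => s ^+ n * (s / (1 - s)))).
  apply: nearW => n; have /andP[h1 h2] := neg_log_remainder n s0 s1.
  by rewrite distrC ger0_norm.
rewrite -[X in _ --> X](mul0r (s / (1 - s))); apply: cvgMl.
by apply: cvg_expr; rewrite ger0_norm.
Qed.

End truncated_log.

Section zonal_kernels.
Context {R : realType}.
Implicit Types (x y p : sphere R) (n : nat).

(** 1 - chord x y is a quarter of the squared distance *)
Definition chord x y : R := (1 + dot x y) / 2.

Lemma chordC x y : chord x y = chord y x.
Proof. by rewrite /chord dotC. Qed.

Lemma chord_itv x y : 0 <= chord x y <= 1.
Proof.
have := dot_sphere_le1 x y; have := dot_sphere_geN1 x y; rewrite /chord => h1 h2.
by apply/andP; split; lra.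
Qed.

Lemma chord_ge0 x y : 0 <= chord x y. Proof. by have /andP[] := chord_itv x y. Qed.
Lemma chord_le1 x y : chord x y <= 1. Proof. by have /andP[] := chord_itv x y. Qed.

Lemma measurable_chord2 : measurable_fun [set: sphere R * sphere R]
  (fun z : sphere R * sphere R => chord z.1 z.2).
Proof.
apply: measurable_funM => //; apply: measurable_funD => //.
exact: measurable_dot2.
Qed.

Lemma measurable_chord y : measurable_fun [set: sphere R] (fun x => chord x y).
Proof.
apply: measurable_funM => //; apply: measurable_funD => //.
under [X in measurable_fun _ X]eq_fun do rewrite dotC.
exact: measurable_dot.
Qed.

Lemma measurable_chord_comp y (f : R -> R) : measurable_fun [set: R] f ->
  measurable_fun [set: sphere R] (fun x => f (chord x y)).
Proof. by move=> mf; exact: (measurableT_comp mf (measurable_chord y)). Qed.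

Lemma measurable_chord_comp2 (f : R -> R) : measurable_fun [set: R] f ->
  measurable_fun [set: sphere R * sphere R] (fun z : sphere R * sphere R => f (chord z.1 z.2)).
Proof. by move=> mf; exact: (measurableT_comp mf measurable_chord2). Qed.

Lemma measurable_log_sum n : measurable_fun [set: R] (@log_sum R n).
Proof. exact: continuous_measurable_fun (@continuous_log_sum R n). Qed.

Lemma measurable_geom_sum n : measurable_fun [set: R] (@geom_sum R n).
Proof. exact: continuous_measurable_fun (@continuous_geom_sum R n). Qed.

Lemma measurable_neg_log : measurable_fun [set: R] (@neg_log R).
Proof.
apply: measurableT_comp => //; apply: (measurableT_comp (@measurable_ln R)).
exact: measurable_funB.
Qed.

Lemma area_chord (F f : R -> R) y : primitive F f -> continuous f ->
  \int[area]_x f (chord x y) = 4 * pi * (F 1 - F 0).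
Proof.
move=> dF cf; pose a (z : R) := (1 + z) / 2.
have da (z : R) : is_derive z 1 a 2^-1.
  have -> : a = (fun z => 2^-1 * (1 + z)) by apply/funext => u; rewrite /a mulrC.
  by apply: (der_eq (derZ 2^-1 (derD (derC 1 z) (derId z)))); rewrite add0r mulr1.
have ca : continuous a.
  move=> z; apply: differentiable_continuous; apply/derivable1_diffP.
  by have [] := da z.
have cfa : continuous (fun z => f (a z)).
  by move=> z; apply: (continuous_comp (ca z)); exact: cf.
rewrite (area_zonal (phi := fun z => f (a z)))//.
rewrite (integral_derivative (F := fun z => 2 * F (a z)))//.
- rewrite /a (_ : (1 + 1) / 2 = 1); last by lra.
  by rewrite subrr mul0r; ring.
- move=> z; have := derZ 2 (@is_derive1_comp R F a z _ _ (dF (a z)) (da z)).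
  move=> H; apply: (der_eq H).
  by rewrite mulrCA mulfV ?mulr1.
Qed.

Lemma area_chord_pow n y : \int[area]_x (chord x y ^+ n) = 4 * pi / n.+1%:R.
Proof.
rewrite (area_chord (F := fun s => n.+1%:R^-1 * s ^+ n.+1) (f := fun s => s ^+ n)).
- by rewrite expr1n expr0n /= mulr0 mulr1 subr0.
- move=> s; apply: (der_eq (derZ _ (derX n.+1 (derId s)))).
  by rewrite mulr1 mulKf// pnatr_eq0.
- exact: exprn_continuous.
Qed.

(** The function - (1 - s) e^(c log_sum n s) increases by 1 over [0, 1], and its
   derivative is e^(c log_sum n s) (1 - c + c s^n). *)
Lemma area_exp_log_sum (c : R) n y : 0 <= c -> c < 1 ->
  \int[area]_x expR (c * log_sum n (chord x y)) <= 4 * pi / (1 - c).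
Proof.
move=> c0 c1.
have cE : continuous (fun s : R => expR (c * log_sum n s)).
  move=> s; apply: (@continuous_comp _ _ _ (fun s => c * log_sum n s) expR).
    by apply: cvgM; [exact: cvg_cst|exact: continuous_log_sum].
  exact: continuous_expR.
pose f (s : R) := expR (c * log_sum n s) * (1 - c + c * s ^+ n).
have cf : continuous f.
  move=> s; apply: cvgM; first exact: cE.
  by apply: cvgD; [exact: cvg_cst|apply: cvgM; [exact: cvg_cst|exact: exprn_continuous]].
pose F s := - ((1 + -1 * s) * expR (c * log_sum n s)).
have dF : primitive F f.
  move=> s; have d1 := derD (derC 1 s) (derZ (-1) (derId s)).
  have d2 := derZ c (der_log_sum n s).
  have d3 := @is_derive1_comp R expR (fun s => c * log_sum n s) s _ _
     (is_derive_expR _) d2.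
  have := derZ (-1) (derM d1 d3).
  have -> : (fun y0 : R => -1 * ((1 + -1 * y0) *
      (expR \o (fun s => c * log_sum n s)) y0)) = F.
    by apply/funext => u; rewrite mulN1r.
  move=> H; apply: (der_eq H); rewrite /f /=.
  have := geom_sumE n s; set g := geom_sum n s => e.
  have -> : s ^+ n = 1 - (1 - s) * g by rewrite e; ring.
  by ring.
have I0 : F 1 - F 0 = 1.
  by rewrite /F log_sum0 !mulr0 expR0; ring.
have := area_chord y dF cf; rewrite I0 mulr1 => e.
have lE : L1 area (fun x => expR (c * log_sum n (chord x y))).
  apply: (@L1_bounded _ _ _ _ _ (expR (c * n%:R))).
    apply: (measurable_chord_comp y (f := fun s => expR (c * log_sum n s)));
      exact: continuous_measurable_fun cE.
  move=> x; rewrite ger0_norm ?expR_ge0// ler_expR ler_wpM2l//.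
  by rewrite (le_trans (ler_norm _))// log_sum_bound// chord_itv.
have c10 : 0 < 1 - c by lra.
rewrite ler_pdivlMr// -e mulrC -integralZ1//.
apply: le_integral1; first exact: L1Z.
  apply: (@L1M _ _ _ _ (fun x => expR (c * log_sum n (chord x y))) _ 1) => //.
    apply: (measurable_chord_comp y (f := fun s => 1 - c + c * s ^+ n)).
    apply: measurable_funD => //; apply: measurable_funM => //.
  move=> x; have /andP[s0 s1] := chord_itv x y.
  have p0 := exprn_ge0 n s0; have p1 := exprn_ile1 n s0 s1.
  by rewrite ger0_norm; nra.
move=> x; rewrite mulrC ler_wpM2l ?expR_ge0// lerDl mulr_ge0// exprn_ge0//.
exact: chord_ge0.
Qed.

(** The integral of chord^n bounds the area of the set where chord = 1. *)
Lemma chord_lt1_ae y : {ae area, forall x, chord x y < 1}.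
Proof.
pose D : set (sphere R) := [set x | chord x y = 1].
have mD : measurable D.
  have -> : D = (fun x => chord x y) @^-1` [set 1] by [].
  by rewrite -[X in measurable X]setTI; exact: (measurable_chord y).
exists D; split => //; last first.
  move=> x /= /negP; rewrite -leNgt => h; apply/eqP.
  by rewrite eq_le chord_le1.
suff h n : (area D <= (4 * pi / n.+1%:R)%:E)%E.
  apply/eqP; rewrite eq_le measure_ge0 andbT.
  apply/lee_addgt0Pr => e e0; rewrite add0e.
  have [n hn] : exists n : nat, 4 * pi / n.+1%:R <= e.
    exists (Num.Def.trunc (4 * pi / e)); rewrite ler_pdivrMr// [leRHS]mulrC.
    by rewrite -ler_pdivrMr// ltW// truncnS_gt.
  by rewrite (le_trans (h n))// lee_fin.
have l : L1 area (fun x => chord x y ^+ n).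
  apply: (@L1_bounded _ _ _ _ _ 1).
    by apply: measurable_funX; exact: measurable_chord.
  by move=> x; rewrite normrX exprn_ile1// ger0_norm ?chord_ge0 ?chord_le1.
rewrite -(area_chord_pow n y) EFin_integral1// -(setIT D) -integral_indic//.
apply: ge0_le_integral => //.
- by apply/measurable_EFinP; exact: measurable_indic.
- by apply/measurable_EFinP; exact: L1_measurable l.
- move=> x _; rewrite lee_fin indicE; case: (boolP (x \in D)).
    by rewrite inE /D /= => ->; rewrite expr1n.
  by rewrite exprn_ge0// chord_ge0.
Qed.

Lemma integral_exp_neg_log (c : R) y : 0 <= c -> c < 1 ->
  (\int[area]_x (expR (c * neg_log (chord x y)))%:E <= (4 * pi / (1 - c))%:E)%E.
Proof.
move=> c0 c1; apply: (@fatou_bound _ _ _ _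
  (fun n x => expR (c * log_sum n (chord x y)))).
- move=> n; apply: (@L1_bounded _ _ _ _ _ (expR (c * n%:R))).
    apply: (measurableT_comp (@measurable_expR R)).
    by apply: measurable_funM => //; apply: measurable_chord_comp; exact: measurable_log_sum.
  move=> x; rewrite ger0_norm ?expR_ge0// ler_expR ler_wpM2l//.
  by rewrite (le_trans (ler_norm _))// log_sum_bound// chord_itv.
- by move=> n x; exact: expR_ge0.
- apply: (measurableT_comp (@measurable_expR R)).
  by apply: measurable_funM => //; apply: measurable_chord_comp; exact: measurable_neg_log.
- by move=> x; exact: expR_ge0.
- apply: filterS (chord_lt1_ae y) => x x1.
  apply: continuous_cvg; first exact: continuous_expR.
  by apply: cvgM; [exact: cvg_cst|apply: cvg_log_sum => //; exact: chord_ge0].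
- by move=> n; exact: area_exp_log_sum.
Qed.

Lemma integral_neg_log y :
  (\int[area]_x (neg_log (chord x y))%:E <= (16 * pi)%:E)%E.
Proof.
have h : (\int[area]_x (neg_log (chord x y))%:E <=
  \int[area]_x (2 * expR (2^-1 * neg_log (chord x y)))%:E)%E.
  apply: ge0_le_integral => //.
  - by move=> x _; rewrite lee_fin neg_log_ge0// chord_ge0.
  - by apply/measurable_EFinP; apply: measurable_chord_comp; exact: measurable_neg_log.
  - apply/measurable_EFinP; apply: measurable_funM => //.
    apply: (measurableT_comp (@measurable_expR R)).
    by apply: measurable_funM => //; apply: measurable_chord_comp; exact: measurable_neg_log.
  - move=> x _; rewrite lee_fin.
    by have := expR_ge1Dx (2^-1 * neg_log (chord x y)); lra.
apply: le_trans h _.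
under eq_integral do rewrite EFinM.
rewrite ge0_integralZl//.
- have := @integral_exp_neg_log 2^-1 y ltac:(lra) ltac:(lra).
  move=> /(@lee_wpmul2l _ 2%:E) => /(_ ltac:(by [])) h; apply: le_trans h _.
  by rewrite -EFinM lee_fin le_eqVlt; apply/orP; left; apply/eqP; field.
- apply/measurable_EFinP; apply: (measurableT_comp (@measurable_expR R)).
  by apply: measurable_funM => //; apply: measurable_chord_comp; exact: measurable_neg_log.
Qed.

End zonal_kernels.

(** * Logarithmic potentials *)

Section potentials.
Context {R : realType}.
Implicit Types (x y p : sphere R) (n : nat) (f g : sphere R -> R).

Definition trunc_potential n f x : R :=
  \int[area]_y (log_sum n (chord x y) * f y).

Definition potential f x : R := \int[area]_y (neg_log (chord x y) * f y).

Lemma measurable_chord_snd x : measurable_fun [set: sphere R] (chord x).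
Proof.
have -> : chord x = (fun y => chord y x) by apply/funext => y; rewrite chordC.
exact: measurable_chord.
Qed.

Lemma L1_trunc_kernel n f x : L1 area f ->
  L1 area (fun y => log_sum n (chord x y) * f y).
Proof.
move=> lf; under [X in L1 _ X]eq_fun do rewrite mulrC.
apply: (@L1M _ _ _ _ _ _ n%:R) => //.
  exact: (measurableT_comp (measurable_log_sum n) (measurable_chord_snd x)).
by move=> y; exact: log_sum_bound (chord_itv x y).
Qed.

Lemma L1prod_trunc n f : L1 area f ->
  L1prod area area (fun z => log_sum n (chord z.1 z.2) * f z.2).
Proof.
move=> lf; apply: (L1prod_bounded _ (M := n%:R)) => //.
  by apply: measurable_chord_comp2; exact: measurable_log_sum.
by move=> z; exact: log_sum_bound (chord_itv _ _).
Qed.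

Lemma L1prod_neg_log f : L1 area f ->
  L1prod area area (fun z => neg_log (chord z.1 z.2) * f z.2).
Proof.
move=> lf; apply: (L1prod_kernel (C := 16 * pi)
  (k := fun z => neg_log (chord z.1 z.2))) => //.
- by apply: measurable_chord_comp2; exact: measurable_neg_log.
- by move=> z; rewrite neg_log_ge0// chord_ge0.
- by move=> y; exact: integral_neg_log.
Qed.

Lemma measurable_trunc_potential n f : L1 area f ->
  measurable_fun [set: sphere R] (trunc_potential n f).
Proof. by move=> lf; exact: (measurable_integral_snd (L1prod_trunc n lf)). Qed.

Lemma measurable_potential f : L1 area f ->
  measurable_fun [set: sphere R] (potential f).
Proof. by move=> lf; exact: (measurable_integral_snd (L1prod_neg_log lf)). Qed.

Lemma L1_potential f : L1 area f -> L1 area (potential f).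
Proof. by move=> lf; exact: (L1_integral_snd (L1prod_neg_log lf)). Qed.

Lemma trunc_potential_bound n f x : L1 area f ->
  `|trunc_potential n f x| <= n%:R * \int[area]_y `|f y|.
Proof.
move=> lf; have l := L1_trunc_kernel n x lf.
rewrite (le_trans (le_normr_Rintegral _ _))// -integralZ1; last exact: L1_norm.
apply: le_integral1; [exact: L1_norm|exact/L1Z/L1_norm|move=> y].
by rewrite normrM ler_wpM2r// log_sum_bound// chord_itv.
Qed.

(** For almost every x the kernel neg_log (chord x y) |f y| is integrable in y, by
   Fubini, and dominates all truncations. *)
Lemma trunc_potential_cvg f : L1 area f ->
  {ae area, forall x, (forall n, `|trunc_potential n f x| <=
      potential (fun y => `|f y|) x) /\
    (fun n => trunc_potential n f x) @ \oo --> potential f x}.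
Proof.
move=> lf; have := L1prod_ae1 (L1prod_neg_log (L1_norm lf)).
apply: filterS => x /= lx.
have ae1 : {ae area, forall y, chord x y < 1}.
  by apply: filterS (chord_lt1_ae x) => y; rewrite chordC.
have mn : measurable_fun [set: sphere R] (fun y => neg_log (chord x y)).
  exact: (measurableT_comp measurable_neg_log (measurable_chord_snd x)).
split=> [n|].
  have l := L1_trunc_kernel n x lf.
  have lt := L1_trunc_kernel n x (L1_norm lf).
  rewrite (le_trans (le_normr_Rintegral _ _))//.
  apply: le_integral_ae1 => //; first exact: L1_norm.
  apply: filterS ae1 => y y1; rewrite normrM ler_wpM2r//.
  rewrite ger0_norm ?log_sum_ge0 ?chord_ge0//.
  by rewrite log_sum_le ?chord_ge0.
have [|||||_ c] := @dominated_convergence1 _ _ _ area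
  (fun n y => log_sum n (chord x y) * f y)
  (fun y => neg_log (chord x y) * f y)
  (fun y => neg_log (chord x y) * `|f y|).
- by move=> n; exact: L1_measurable (L1_trunc_kernel n x lf).
- by apply: measurable_funM => //; exact: L1_measurable lf.
- apply: filterS ae1 => y y1; apply: cvgMl.
  by apply: cvg_log_sum => //; exact: chord_ge0.
- by [].
- apply: filterS ae1 => y y1 n; rewrite normrM ler_wpM2r//.
  rewrite ger0_norm ?log_sum_ge0 ?chord_ge0//.
  by rewrite log_sum_le ?chord_ge0.
exact: c.
Qed.

Lemma integral_log_sum n x : \int[area]_y log_sum n (chord x y) <= 16 * pi.
Proof.
have h := @area_exp_log_sum R 2^-1 n x ltac:(lra) ltac:(lra).
have l1 : L1 area (fun y => log_sum n (chord x y)).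
  have := L1_trunc_kernel n x (L1_cst area 1).
  by under [X in L1 _ X]eq_fun do rewrite mulr1.
have l2 : L1 area (fun y => expR (2^-1 * log_sum n (chord y x))).
  apply: (@L1_bounded _ _ _ _ _ (expR (2^-1 * n%:R))).
    apply: (measurableT_comp (@measurable_expR R)).
    apply: measurable_funM => //; try exact: measurable_cst.
    exact: (measurable_chord_comp _ (measurable_log_sum n)).
  move=> y; rewrite ger0_norm ?expR_ge0// ler_expR ler_wpM2l//.
  by rewrite (le_trans (ler_norm _))// log_sum_bound// chord_itv.
apply: (@le_trans _ _ (\int[area]_y (2 * expR (2^-1 * log_sum n (chord y x))))).
  apply: le_integral1 => //; first exact: L1Z.
  by move=> y; have := expR_ge1Dx (2^-1 * log_sum n (chord y x)); rewrite chordC; lra.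
rewrite integralZ1//.
have e : 4 * pi / (1 - 2^-1) = 8 * pi :> R by field.
by move: h; rewrite e; lra.
Qed.

(** The last summand is the mean of the tangent line of the exponential at m over
   a measure of mass t and first moment m. The inequality itself says that
   expR m (1 - m) (1 - t) <= 1. *)
Lemma exp_mean_le (m t : R) : 0 <= t <= 1 ->
  expR m <= 1 + expR m * ((1 - m) * t + m).
Proof.
move=> /andP[t0 t1].
have h : expR m * (1 - m) <= 1.
  have := expR_ge1Dx (- m); rewrite expRN => h.
  by rewrite mulrC -ler_pdivlMr ?expR_gt0// mul1r.
have e : 0 < expR m := expR_gt0 m.
suff : expR m * (1 - m) * (1 - t) <= 1 by lra.
case: (leP 0 (expR m * (1 - m))) => h0; nra.
Qed.

(** Jensen's inequality for the measure g / e, of mass at most 1. *)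
Lemma exp_trunc_potential_le (c e : R) n g x : 0 <= c -> 0 < e ->
  L1 area g -> (forall y, 0 <= g y) -> \int[area]_y g y <= e ->
  expR (c * trunc_potential n g x) <=
  1 + e^-1 * \int[area]_y (expR (c * e * log_sum n (chord x y)) * g y).
Proof.
move=> c0 e0 lg g0 ge.
set m := c * trunc_potential n g x.
pose t := e^-1 * \int[area]_y g y.
have t01 : 0 <= t <= 1.
  rewrite /t mulr_ge0 ?invr_ge0 ?(ltW e0) ?Rintegral_ge0//=.
  by rewrite mulrC ler_pdivrMr// mul1r.
apply: le_trans (exp_mean_le m t01) _; rewrite lerD2l.
have l := L1_trunc_kernel n x lg.
have -> : expR m * ((1 - m) * t + m) =
  e^-1 * \int[area]_y (expR m * ((1 - m) * g y + c * e * (log_sum n (chord x y) * g y))).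
  rewrite integralZ1; last by apply: L1D; exact: L1Z.
  rewrite integralD1; [|exact: L1Z|exact: L1Z].
  rewrite !integralZ1// /t -/(trunc_potential n g x) /m; field.
  by rewrite gt_eqF.
rewrite ler_wpM2l ?invr_ge0 ?(ltW e0)//.
have mexp : measurable_fun [set: sphere R]
    (fun y => expR (c * e * log_sum n (chord x y))).
  apply: (measurableT_comp (@measurable_expR R)); apply: measurable_funM => //.
  exact: (measurableT_comp (measurable_log_sum n) (measurable_chord_snd x)).
apply: le_integral1.
- by apply: L1Z; apply: L1D; exact: L1Z.
- under [X in L1 _ X]eq_fun do rewrite mulrC.
  apply: (@L1M _ _ _ _ _ _ (expR (c * e * n%:R))) => //.
  move=> y; rewrite ger0_norm ?expR_ge0// ler_expR ler_wpM2l ?mulr_ge0 ?(ltW e0)//.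
  by rewrite (le_trans (ler_norm _))// log_sum_bound// chord_itv.
- move=> y; set k := log_sum n _.
  have h : expR m * (1 + (c * e * k - m)) <= expR (c * e * k).
    have -> : expR (c * e * k) = expR m * expR (c * e * k - m).
      by rewrite -expRD; congr expR; ring.
    by rewrite ler_wpM2l ?expR_ge0// expR_ge1Dx.
  have := ler_wpM2r (g0 y) h; lra.
Qed.

Lemma small_tail g (e : R) : 0 < e -> L1 area g -> (forall y, 0 <= g y) ->
  exists M : nat, \int[area]_y (g y - Num.min (g y) M%:R) <= e.
Proof.
move=> e0 lg g0; have mg := L1_measurable lg.
have mm (k : nat) : measurable_fun [set: sphere R] (fun y => Num.min (g y) k%:R).
  exact: measurable_minr.
have [|||||_ c] := @dominated_convergence1 _ _ _ area
  (fun (k : nat) y => g y - Num.min (g y) k%:R) (fun=> 0) g.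
- by move=> k; exact: measurable_funB.
- exact: measurable_cst.
- apply: aeW => y; apply: cvg_near_cst; near=> k.
  by rewrite min_l ?subrr//; near: k; exact: nbhs_infty_ger.
- by [].
- apply: aeW => y k; have := g0 y; case: (leP (g y) k%:R) => h gy.
    by rewrite subrr normr0.
  by rewrite ger0_norm; have : 0 <= k%:R :> R by []; lra.
move: c; rewrite Rintegral_cst// mul0r => /cvgr_le /(_ e e0) [M _ hM].
by exists M; apply: hM => /=.
Unshelve. all: end_near. Qed.

(** A bounded part of f has a bounded potential. The remaining part can be given
   so small a mass that, by Jensen's inequality, the exponent is reduced below
   the critical value 1 of area_exp_log_sum. *)
Lemma L1_exp_potential f (c : R) : 0 <= c -> L1 area f ->
  L1 area (fun x => expR (c * potential (fun y => `|f y|) x)).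
Proof.
move=> c0 lf0; have lf := L1_norm lf0; set g := fun y => `|f y| in lf *.
have g0 y : 0 <= g y by rewrite /g normr_ge0.
pose e := (2 * (c + 1))^-1.
have e0 : 0 < e by rewrite invr_gt0; lra.
have ce : c * e <= 2^-1.
  by rewrite /e ler_pdivrMr; lra.
have [M hM] := small_tail e0 lf g0.
pose g2 y := Num.min (g y) M%:R; pose g1 y := g y - g2 y.
have mg2 : measurable_fun [set: sphere R] g2.
  by apply: measurable_minr => //; exact: L1_measurable lf.
have g20 y : 0 <= g2 y by rewrite le_min g0 ler0n.
have g2M y : g2 y <= M%:R by rewrite ge_min lexx orbT.
have g10 y : 0 <= g1 y by rewrite subr_ge0 ge_min lexx.
have lg2 : L1 area g2.
  by apply: (@L1_bounded _ _ _ _ _ M%:R) => // y; rewrite ger0_norm.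
have lg1 : L1 area g1 by exact: L1B.
have mE : measurable_fun [set: sphere R] (fun x => expR (c * potential g x)).
  apply: (measurableT_comp (@measurable_expR R)); apply: measurable_funM => //.
  exact: measurable_potential.
apply/L1_lty => //.
apply: (@le_lt_trans _ _ (expR (c * (M%:R * (16 * pi))) * (12 * pi))%:E); last exact: ltry.
apply: (@fatou_bound _ _ _ _ (fun n x => expR (c * trunc_potential n g x))) => //.
- move=> n; apply: (@L1_bounded _ _ _ _ _ (expR (c * (n%:R * \int[area]_y `|g y|)))).
    apply: (measurableT_comp (@measurable_expR R)); apply: measurable_funM => //.
    exact: measurable_trunc_potential.
  move=> x; rewrite ger0_norm ?expR_ge0// ler_expR ler_wpM2l//.
  by rewrite (le_trans (ler_norm _))// trunc_potential_bound.
- apply: filterS (trunc_potential_cvg lf) => x [_ h].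
  apply: continuous_cvg; first exact: continuous_expR.
  by apply: cvgM; [exact: cvg_cst|exact: h].
move=> n.
pose k (z : sphere R * sphere R) := expR (c * e * log_sum n (chord z.1 z.2)).
have lk : L1prod area area (fun z => k z * g1 z.2).
  apply: (L1prod_bounded _ (M := expR (c * e * n%:R))) => //.
    apply: (measurableT_comp (@measurable_expR R)); apply: measurable_funM => //.
    by apply: measurable_chord_comp2; exact: measurable_log_sum.
  move=> z; rewrite ger0_norm ?expR_ge0// ler_expR ler_wpM2l ?mulr_ge0 ?(ltW e0)//.
  by rewrite (le_trans (ler_norm _))// log_sum_bound// chord_itv.
have lK : L1 area (fun x => 1 + e^-1 * \int[area]_y (k (x, y) * g1 y)).
  by apply: L1D; [exact: L1_cst|apply: L1Z; exact: (L1_integral_snd lk)].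
apply: (@le_trans _ _ (\int[area]_x (expR (c * (M%:R * (16 * pi))) *
   (1 + e^-1 * \int[area]_y (k (x, y) * g1 y))))).
  apply: le_integral1; last first.
  - move=> x.
    have -> : trunc_potential n g x = trunc_potential n g2 x + trunc_potential n g1 x.
      rewrite -integralD1; [|exact: L1_trunc_kernel|exact: L1_trunc_kernel].
      by apply: eq_Rintegral => y _; rewrite /g1; ring.
    rewrite mulrDr expRD ler_pM ?expR_ge0//; last first.
      by apply: exp_trunc_potential_le.
    rewrite ler_expR ler_wpM2l//.
    apply: (@le_trans _ _ (\int[area]_y (M%:R * log_sum n (chord x y)))).
      have lt1 : L1 area (fun y => log_sum n (chord x y)).
        have := L1_trunc_kernel n x (L1_cst area 1).
        by under [X in L1 _ X]eq_fun do rewrite mulr1.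
      apply: le_integral1; [exact: L1_trunc_kernel|exact: L1Z|].
      by move=> y; rewrite mulrC ler_wpM2r// log_sum_ge0// chord_ge0.
    have lt1 : L1 area (fun y => log_sum n (chord x y)).
      have := L1_trunc_kernel n x (L1_cst area 1).
      by under [X in L1 _ X]eq_fun do rewrite mulr1.
    by rewrite integralZ1// ler_wpM2l// integral_log_sum.
  - exact: L1Z.
  - apply: (@L1_bounded _ _ _ _ _ (expR (c * (n%:R * \int[area]_y `|g y|)))).
      apply: (measurableT_comp (@measurable_expR R)); apply: measurable_funM => //.
      exact: measurable_trunc_potential.
    move=> x; rewrite ger0_norm ?expR_ge0// ler_expR ler_wpM2l//.
    by rewrite (le_trans (ler_norm _))// trunc_potential_bound.
rewrite integralZ1// ler_wpM2l ?expR_ge0//.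
rewrite integralD1; [|exact: L1_cst|by apply: L1Z; exact: (L1_integral_snd lk)].
rewrite integralZ1; last exact: (L1_integral_snd lk).
rewrite Rintegral_cst//.
have -> : fine (area [set: sphere R]) = 4 * pi by rewrite area_setT.
rewrite (Fubini1 lk).
suff h : \int[area]_y \int[area]_x (k (x, y) * g1 y) <= 8 * pi * e.
  have h2 : e^-1 * \int[area]_y \int[area]_x (k (x, y) * g1 y) <= 8 * pi.
    by rewrite mulrC ler_pdivrMr.
  by move: h2; lra.
have lkx y : L1 area (fun x => k (x, y)).
  apply: (@L1_bounded _ _ _ _ _ (expR (c * e * n%:R))).
    apply: (measurableT_comp (@measurable_expR R)); apply: measurable_funM => //.
    by apply: measurable_chord_comp; exact: measurable_log_sum.
  move=> x; rewrite ger0_norm ?expR_ge0// ler_expR ler_wpM2l ?mulr_ge0 ?(ltW e0)//.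
  by rewrite (le_trans (ler_norm _))// log_sum_bound// chord_itv.
apply: (@le_trans _ _ (\int[area]_y (8 * pi * g1 y))).
  apply: le_integral1; [|exact: L1Z|].
  - exact: (L1_integral_fst lk).
  - move=> y; rewrite (_ : (fun x => k (x, y) * g1 y) = (fun x => g1 y * k (x, y))); last first.
      by apply/funext => x; rewrite mulrC.
    rewrite integralZ1// mulrC ler_wpM2r//.
    have := @area_exp_log_sum R (c * e) n y ltac:(by rewrite mulr_ge0// ltW) ltac:(lra).
    move=> h; apply: le_trans h _; rewrite ler_pdivrMr; last by lra.
    have := pi_gt0 R; nra.
by rewrite integralZ1// ler_wpM2l// mulr_ge0// pi_ge0.
Qed.

End potentials.

(** * Laplacians of zonal polynomials *)

Section smooth_functions.
Context {R : realType}.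
Implicit Types (F G : 'rV[R]_3 -> R) (x a b y : 'rV[R]_3) (k : nat).

Lemma is_derive_linear (f : 'rV[R]_3 -> R) x v :
  (forall a b, f (a + b) = f a + f b) -> (forall c a, f (c *: a) = c * f a) ->
  is_derive x v f (f v).
Proof.
move=> fD fZ.
have c : (fun h : R => h^-1 *: ((f \o shift x) (h *: v) - f x)) @ 0^' --> f v.
  apply: cvg_near_cst; near=> h.
  rewrite /= fD fZ addrK /GRing.scale /= mulrA mulVf ?mul1r//.
  by near: h; exact: nbhs_dnbhs_neq.
by split; [apply/cvg_ex; exists (f v)|exact: cvg_lim].
Unshelve. all: end_near. Qed.

Lemma is_derive_coord x v i : is_derive x v (fun z : 'rV[R]_3 => z 0 i) (v 0 i).
Proof.
by apply: (is_derive_linear (f := fun z => z 0 i)) => [a b|c a]; rewrite mxE.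
Qed.

Lemma is_derive_dot x v y : is_derive x v (fun z => dot z y) (dot v y).
Proof.
by apply: (is_derive_linear (f := fun z => dot z y)) => [a b|c a]; rewrite ?dotDl ?dotZl.
Qed.

Lemma dot_delta i y : dot (delta_mx 0 i) y = y 0 i.
Proof.
by rewrite dotE !mxE; have [->|[->|->]] := ord3P i; rewrite /=; ring.
Qed.

Lemma vderM F G x v df dg : is_derive x v F df -> is_derive x v G dg ->
  is_derive x v (fun y => F y * G y) (F x * dg + G x * df).
Proof. by move=> hf hg; exact: is_deriveM. Qed.

Lemma vderD F G x v df dg : is_derive x v F df -> is_derive x v G dg ->
  is_derive x v (fun y => F y + G y) (df + dg).
Proof. by move=> hf hg; exact: is_deriveD. Qed.

Lemma vderC (c : R) x v : is_derive x v (fun=> c) (0 : R).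
Proof. exact: is_derive_cst. Qed.

Lemma vderX F x v df n : is_derive x v F df ->
  is_derive x v (fun y => F y ^+ n) (n%:R * F x ^+ n.-1 * df).
Proof.
move=> hf; have -> : (fun y => F y ^+ n) = F ^+ n.
  by apply/funext => y; rewrite exprfctE.
exact: is_deriveX.
Qed.

Lemma vder_eq F x v (d d' : R) : is_derive x v F d -> d = d' -> is_derive x v F d'.
Proof. by move=> h <-. Qed.

Lemma Ck_add k F G : Ck k F -> Ck k G -> Ck k (fun x => F x + G x).
Proof.
elim: k F G => [|k ih] F G /=.
  by move=> cF cG x; have := cvgD (cF x) (cG x); exact.
move=> cF cG i; have [dF pF] := cF i; have [dG pG] := cG i; split.
  by move=> x; exact: derivableD.
have -> : partial i (fun x => F x + G x) = (fun x => partial i F x + partial i G x).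
  by apply/funext => x; rewrite /partial -deriveD.
exact: ih.
Qed.

Lemma smooth_add F G : smooth F -> smooth G -> smooth (fun x => F x + G x).
Proof. by move=> sF sG k; exact: Ck_add. Qed.

Lemma smooth_partial F i : smooth F -> smooth (partial i F).
Proof. by move=> sF k; have [] := sF k.+1 i. Qed.

Lemma smooth_derivable F i x : smooth F -> derivable F x (delta_mx 0 i).
Proof. by move=> sF; have [+ _] := sF 1%N i; exact. Qed.

(** Induction on the order of differentiation, for all pairs of smooth functions
   at once: a partial derivative of F G is a sum of two such products. *)
Lemma smooth_mul F G : smooth F -> smooth G -> smooth (fun x => F x * G x).
Proof.
move=> sF sG k; elim: k F G sF sG => [|k ih] F G sF sG /=.
  by move=> x; have := cvgM (sF 0%N x) (sG 0%N x); exact.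
move=> i; split.
  by move=> x; apply: derivableM; exact: smooth_derivable.
have -> : partial i (fun x => F x * G x) =
    (fun x => F x * partial i G x + G x * partial i F x).
  apply/funext => x; rewrite /partial.
  by rewrite -[LHS]/('D_(delta_mx 0 i) (F * G) x) deriveM//; exact: smooth_derivable.
by apply: Ck_add; apply: ih => //; exact: smooth_partial.
Qed.

Lemma smooth_cst (c : R) : smooth (fun=> c).
Proof.
move=> k; elim: k c => [|k ih] c /=; first exact: cst_continuous.
move=> i; split; first by move=> x; exact: derivable_cst.
have -> : partial i (fun=> c) = (fun=> 0); last exact: ih.
by apply/funext => x; rewrite /partial derive_cst.
Qed.

Lemma smooth_coord i : smooth (fun x : 'rV[R]_3 => x 0 i).
Proof.
move=> [|k] /=; first exact: coord_continuous.
move=> j; split; first by move=> x; have [] := is_derive_coord x (delta_mx 0 j) i.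
have -> : partial j (fun x : 'rV[R]_3 => x 0 i) = (fun=> (delta_mx 0 j : 'rV[R]_3) 0 i).
  by apply/funext => x; rewrite /partial; have [_ ->] := is_derive_coord x (delta_mx 0 j) i.
exact: smooth_cst.
Qed.

Lemma smooth_dot y : smooth (fun x => dot x y).
Proof.
have -> : (fun x => dot x y) =
    (fun x => x 0 i0 * y 0 i0 + x 0 i1 * y 0 i1 + x 0 i2 * y 0 i2).
  by apply/funext => x; rewrite dotE.
by do 2?apply: smooth_add; apply: smooth_mul; (exact: smooth_coord || exact: smooth_cst).
Qed.

Lemma smooth_pow F n : smooth F -> smooth (fun x => F x ^+ n).
Proof.
move=> sF; elim: n => [|n ih].
  have -> : (fun x => F x ^+ 0) = (fun=> 1) by apply/funext => x; rewrite expr0.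
  exact: smooth_cst.
have -> : (fun x => F x ^+ n.+1) = (fun x => F x * F x ^+ n).
  by apply/funext => x; rewrite exprS.
exact: smooth_mul.
Qed.

End smooth_functions.

Section chord_powers.
Context {R : realType}.
Variable y : sphere R.
Implicit Types (x : 'rV[R]_3) (m : nat).

(** The polynomial on R^3 that extends chord . y. *)
Definition chord_ext x : R := (1 + dot x y) / 2.
Definition chord_power m x : R := chord_ext x ^+ m.

Lemma smooth_chord_power m : smooth (chord_power m).
Proof.
apply: smooth_pow; apply: smooth_mul; last exact: smooth_cst.
by apply: smooth_add; [exact: smooth_cst|exact: smooth_dot].
Qed.

Lemma der_chord_power m x i : is_derive x (delta_mx 0 i) (chord_power m)
  (m%:R / 2 * chord_power m.-1 x * sphere_val y 0 i).
Proof.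
have h : is_derive x (delta_mx 0 i) chord_ext (sphere_val y 0 i / 2).
  apply: (vder_eq (vderM (vderD (vderC 1 x (delta_mx 0 i))
    (is_derive_dot x (delta_mx 0 i) y)) (vderC 2^-1 x (delta_mx 0 i)))).
  by rewrite dot_delta; ring.
by apply: (vder_eq (vderX m h)); rewrite /chord_power; ring.
Qed.

Lemma partial_chord_power m i x :
  partial i (chord_power m) x = m%:R / 2 * chord_power m.-1 x * sphere_val y 0 i.
Proof. by have [_] := der_chord_power m x i. Qed.

Definition grad_coef m x : R := m%:R / 2 * chord_power m.-1 x.

Lemma sgrad_chord_power m x i : sgrad (chord_power m) x 0 i =
  grad_coef m x * sphere_val y 0 i - grad_coef m x * dot x y * x 0 i.
Proof.
rewrite /sgrad !mxE partial_chord_power; congr (_ - _ * _).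
by rewrite dotE !mxE !partial_chord_power dotE /grad_coef; ring.
Qed.

Lemma smooth_grad_coef m : smooth (grad_coef m).
Proof. by apply: smooth_mul; [exact: smooth_cst|exact: smooth_chord_power]. Qed.

Lemma sgrad_compE m i : (fun x => sgrad (chord_power m) x 0 i) =
  (fun x => grad_coef m x * sphere_val y 0 i + -1 * (grad_coef m x * dot x y * x 0 i)).
Proof. by apply/funext => x; rewrite sgrad_chord_power mulN1r. Qed.

Lemma smooth_field_sgrad m : smooth_field (sgrad (chord_power m)).
Proof.
move=> i; rewrite sgrad_compE.
have sg := smooth_grad_coef m; have sd := smooth_dot y.
apply: smooth_add; first by apply: smooth_mul => //; exact: smooth_cst.
apply: smooth_mul; first exact: smooth_cst.
by apply: smooth_mul; [exact: smooth_mul|exact: smooth_coord].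
Qed.

Lemma sgrad_tangent m (x : sphere R) : dot (sgrad (chord_power m) x) x = 0.
Proof.
rewrite dotE !sgrad_chord_power; have := dot_sphere x; have := dotE x y.
rewrite (dotE x x) => e h.
transitivity (grad_coef m x * (sphere_val x 0 i0 * sphere_val y 0 i0 +
  sphere_val x 0 i1 * sphere_val y 0 i1 + sphere_val x 0 i2 * sphere_val y 0 i2)
  - grad_coef m x * dot x y * (sphere_val x 0 i0 * sphere_val x 0 i0 +
  sphere_val x 0 i1 * sphere_val x 0 i1 + sphere_val x 0 i2 * sphere_val x 0 i2)).
  by ring.
by rewrite h -e; ring.
Qed.

Lemma partial_sgrad m i j x : partial j (fun x => sgrad (chord_power m) x 0 i) x =
  m%:R / 2 * (m.-1%:R / 2 * chord_power m.-2 x * sphere_val y 0 j) * sphere_val y 0 i -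
  (m%:R / 2 * (m.-1%:R / 2 * chord_power m.-2 x * sphere_val y 0 j) * dot x y +
   grad_coef m x * sphere_val y 0 j) * x 0 i -
  grad_coef m x * dot x y * (i == j)%:R.
Proof.
rewrite sgrad_compE.
have dg : is_derive x (delta_mx 0 j) (grad_coef m)
   (m%:R / 2 * (m.-1%:R / 2 * chord_power m.-2 x * sphere_val y 0 j)).
  apply: (vder_eq (vderM (vderC (m%:R / 2) x _) (der_chord_power m.-1 x j))).
  by rewrite mulr0 addr0.
have dd := is_derive_dot x (delta_mx 0 j) y.
have dc := is_derive_coord x (delta_mx 0 j) i.
have := vderD (vderM dg (vderC (sphere_val y 0 i) x _))
  (vderM (vderC (-1) x _) (vderM (vderM dg dd) dc)).
move=> [_ h]; rewrite /partial h dot_delta mxE eqxx /=; ring.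
Qed.

(** The Laplacian of the m-th power only involves the powers m - 1 and m; divided
   by m, these expressions telescope in log_sum_telescope. *)
Lemma laplace_chord_power m (x : sphere R) :
  laplace_beltrami (chord_power m) x =
  m%:R ^+ 2 * chord x y ^+ m.-1 - m%:R * m.+1%:R * chord x y ^+ m.
Proof.
rewrite /laplace_beltrami /sdiv.
have e : forall F, sgrad F x = \row_i (partial i F x - dot (\row_j partial j F x) x * sphere_val x 0 i).
  by move=> F; apply/rowP => i; rewrite !mxE.
rewrite (_ : \sum_(i < 3) _ = \sum_(i < 3) (partial i (fun z => sgrad (chord_power m) z 0 i) x -
   dot (\row_j partial j (fun z => sgrad (chord_power m) z 0 i) x) x * sphere_val x 0 i)); last first.
  by apply: eq_bigr => i _; rewrite e mxE.
have sum3 (f : 'I_3 -> R) : \sum_(i < 3) f i = f i0 + f i1 + f i2.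
  rewrite !big_ord_recr big_ord0 /= add0r.
  by congr (f _ + f _ + f _); exact/val_inj.
rewrite sum3 !dotE !mxE !partial_sgrad.
rewrite (_ : i0 == i1 = false)// (_ : i0 == i2 = false)// (_ : i1 == i0 = false)//.
rewrite (_ : i1 == i2 = false)// (_ : i2 == i0 = false)// (_ : i2 == i1 = false)// !eqxx /=.
set g := grad_coef m x; set c := chord_power m.-2 x; set t := dot x y.
have hx := dot_sphere x; have hy := dot_sphere y; have ht : t = _ := dotE x y.
rewrite dotE in hx; rewrite dotE in hy.
have cs : chord_ext x = chord x y by [].
have ct : t = 2 * chord x y - 1 by rewrite /chord /t; field.
set d := m%:R / 2 * (m.-1%:R / 2 * c).
transitivity (d * (sphere_val y 0 i0 * sphere_val y 0 i0 +
  sphere_val y 0 i1 * sphere_val y 0 i1 + sphere_val y 0 i2 * sphere_val y 0 i2 - t ^+ 2)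
  - 2 * g * t).
  set xx := sphere_val x 0 i0 * sphere_val x 0 i0 + _ + _ in hx.
  set yy := sphere_val y 0 i0 * sphere_val y 0 i0 + _ + _.
  set xy := sphere_val x 0 i0 * sphere_val y 0 i0 + _ + _ in ht.
  transitivity (d * yy - (d * t + g) * xy - 3 * g * t
    - (d * xy ^+ 2 - (d * t + g) * xy * xx - g * t * xx)).
    by rewrite /xx /yy /xy /d; ring.
  by rewrite hx -ht; ring.
rewrite hy ct.
rewrite /d /g /c /grad_coef /chord_power cs.
case: m {g c d} => [|[|m]] /=.
- by ring.
- by rewrite !expr0; field.
- by rewrite !exprS; field.
Qed.

End chord_powers.

(** * An approximate identity *)

Section approximate_identity.
Context {R : realType}.
Implicit Types (x y p : sphere R) (n m : nat) (u f w : sphere R -> R).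

Lemma chord_pow_bound n x y : `|chord x y ^+ n| <= 1.
Proof.
by rewrite normrX exprn_ile1// ger0_norm ?chord_ge0 ?chord_le1.
Qed.

Lemma measurable_chord_pow n y :
  measurable_fun [set: sphere R] (fun x => chord x y ^+ n).
Proof. by apply: measurable_funX; exact: measurable_chord. Qed.

Lemma L1_chord_pow n y : L1 area (fun x => chord x y ^+ n).
Proof. exact: L1_bounded (measurable_chord_pow n y) (fun x => chord_pow_bound n x y). Qed.

Lemma L1M_chord_pow u n y : L1 area u -> L1 area (fun x => u x * chord x y ^+ n).
Proof.
by move=> lu; apply: (L1M lu (measurable_chord_pow n y)) => x; exact: chord_pow_bound.
Qed.

(** A normalised power of the chord is a probability density that concentrates at
   the diagonal, and 1 - 4 pi smear is the Laplacian of log_sum n. *)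
Definition smear n x y : R := n.+1%:R / (4 * pi) * chord x y ^+ n.

Lemma fourpi_gt0 : 0 < 4 * pi :> R. Proof. by rewrite mulr_gt0// pi_gt0. Qed.

Lemma smear_ge0 n x y : 0 <= smear n x y.
Proof.
by rewrite /smear mulr_ge0 ?exprn_ge0 ?chord_ge0// divr_ge0// ltW// fourpi_gt0.
Qed.

Lemma integral_smear n y : \int[area]_x smear n x y = 1.
Proof.
rewrite /smear integralZ1; last exact: L1_chord_pow.
rewrite area_chord_pow; have := ltr0Sn R n; move: (n.+1%:R) => b b0.
have := pi_gt0 R; move: pi => q q0; field.
by rewrite !gt_eqF.
Qed.

Lemma integral_smear_chord n y :
  \int[area]_x (smear n x y * (1 - chord x y)) = (n.+2%:R)^-1.
Proof.
have l k : L1 area (fun x => n.+1%:R / (4 * pi) * chord x y ^+ k).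
  by apply: L1Z; exact: L1_chord_pow.
transitivity (\int[area]_x (n.+1%:R / (4 * pi) * chord x y ^+ n -
   n.+1%:R / (4 * pi) * chord x y ^+ n.+1)).
  by apply: eq_Rintegral => x _; rewrite /smear exprS; ring.
rewrite integralB1// !integralZ1 ?area_chord_pow; try exact: L1_chord_pow.
rewrite -[n.+2%:R]natr1; have := ltr0Sn R n; move: (n.+1%:R) => a a0.
have := pi_gt0 R; move: pi => q q0; field.
by rewrite !gt_eqF//; lra.
Qed.

(** The squared distance of x and y is 4 (1 - chord x y). *)
Lemma dot_pow_lipschitz (a : 'rV[R]_3) m : exists2 K : R, 0 <= K &
  forall x y, (dot a x ^+ m - dot a y ^+ m) ^+ 2 <= K * (1 - chord x y).
Proof.
pose B := 1 + dot a a; have B0 : 0 <= B by rewrite /B addr_ge0// dot_ge0.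
exists ((m%:R * B ^+ m.-1) ^+ 2 * dot a a * 4).
  by rewrite mulr_ge0// mulr_ge0 ?sqr_ge0 ?dot_ge0.
move=> x y; rewrite subrXX exprMn.
have d : (dot a x - dot a y) ^+ 2 <= dot a a * (4 * (1 - chord x y)).
  rewrite -dotBr; apply: le_trans (cauchy_schwarz _ _) _.
  rewrite ler_wpM2l ?dot_ge0// dist2_sphere /chord.
  by rewrite le_eqVlt; apply/orP; left; apply/eqP; field.
have s : (\sum_(i < m) dot a x ^+ (m.-1 - i) * dot a y ^+ i) ^+ 2 <=
    (m%:R * B ^+ m.-1) ^+ 2.
  rewrite -[leLHS]real_normK ?num_real// lerXn2r ?nnegrE ?mulr_ge0 ?exprn_ge0//.
  apply: le_trans (ler_norm_sum _ _ _) _.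
  apply: (@le_trans _ _ (\sum_(i < m) B ^+ m.-1)); last first.
    by rewrite sumr_const card_ord mulr_natl.
  apply: ler_sum => i _; rewrite normrM !normrX.
  have -> : B ^+ m.-1 = B ^+ (m.-1 - i) * B ^+ i.
    by rewrite -exprD subnK//; case: m i => [[]//|m] i /=; rewrite -ltnS.
  by apply: ler_pM; rewrite ?exprn_ge0// lerXn2r ?nnegrE// dot_bound.
have c0 : 0 <= 1 - chord x y by rewrite subr_ge0 chord_le1.
apply: le_trans (ler_pM (sqr_ge0 _) (sqr_ge0 _) d s) _.
by rewrite le_eqVlt; apply/orP; left; apply/eqP; ring.
Qed.

(** |d| <= e + d^2 / (4 e), and d^2 is controlled by 1 - chord, whose mean is
   1 / (n + 2). *)
Lemma smear_cvg (a : 'rV[R]_3) m x :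
  (fun n => \int[area]_y (smear n y x * dot a y ^+ m)) @ \oo --> dot a x ^+ m.
Proof.
have [K K0 hK] := dot_pow_lipschitz a m.
have ls n : L1 area (fun y => smear n y x) by apply: L1Z; exact: L1_chord_pow.
have lsp n : L1 area (fun y => smear n y x * dot a y ^+ m).
  exact: (L1M (ls n) (measurable_dot_pow a m) (dot_pow_bound a m)).
have lc n : L1 area (fun y => smear n y x * (1 - chord y x)).
  apply: (@L1M _ _ _ _ _ _ 1 (ls n)).
    by apply: measurable_funB => //; exact: measurable_chord.
  by move=> y; rewrite ger0_norm ?subr_ge0 ?chord_le1// gerBl chord_ge0.
have step n e : 0 < e ->
   `|\int[area]_y (smear n y x * dot a y ^+ m) - dot a x ^+ m| <=
   e + K / (4 * e) * (n.+2%:R)^-1.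
  move=> e0.
  have -> : \int[area]_y (smear n y x * dot a y ^+ m) - dot a x ^+ m =
    \int[area]_y (smear n y x * dot a y ^+ m - dot a x ^+ m * smear n y x).
    by rewrite integralB1//; [rewrite integralZ1// integral_smear mulr1|exact: L1Z].
  have lB : L1 area (fun y => smear n y x * dot a y ^+ m - dot a x ^+ m * smear n y x).
    by apply: L1B => //; exact: L1Z.
  apply: le_trans (le_normr_Rintegral _ _) _ => //.
  have -> : e + K / (4 * e) * (n.+2%:R)^-1 =
    \int[area]_y (e * smear n y x + K / (4 * e) * (smear n y x * (1 - chord y x))).
    rewrite integralD1; [|exact: L1Z|exact: L1Z].
    by rewrite (integralZ1 e (ls n)) (integralZ1 (K / (4 * e)) (lc n)) integral_smear integral_smear_chord mulr1.
  apply: le_integral1; [exact: L1_norm|by apply: L1D; exact: L1Z|move=> y].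
  have -> : smear n y x * dot a y ^+ m - dot a x ^+ m * smear n y x =
    smear n y x * (dot a y ^+ m - dot a x ^+ m) by ring.
  rewrite normrM (ger0_norm (smear_ge0 _ _ _)).
  have -> : e * smear n y x + K / (4 * e) * (smear n y x * (1 - chord y x)) =
     smear n y x * (e + (K * (1 - chord y x)) / (4 * e)) by ring.
  rewrite ler_wpM2l ?smear_ge0//.
  have h := hK y x; set d := dot a y ^+ m - dot a x ^+ m in h *.
  have h2 : `|d| <= e + d ^+ 2 / (4 * e).
    have e4 : 0 < 4 * e by lra.
    have -> : e + d ^+ 2 / (4 * e) = (4 * e ^+ 2 + `|d| ^+ 2) / (4 * e).
      rewrite real_normK ?num_real//; field; rewrite gt_eqF//; lra.
    by rewrite ler_pdivlMr//; have := sqr_ge0 (2 * e - `|d|); lra.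
  apply: le_trans h2 _; rewrite lerD2l ler_wpM2r// invr_ge0; lra.
apply/cvgrPdist_le => e e0.
have e2 : 0 < e / 2 by lra.
have := @cvg_harmonicZ R (K / (4 * (e / 2))) => /cvgr_le /(_ _ e2).
apply: filterS => n hn; rewrite distrC; apply: le_trans (step n _ e2) _.
have : K / (4 * (e / 2)) * (n.+2%:R)^-1 <= K / (4 * (e / 2)) * (n.+1%:R)^-1.
  rewrite ler_wpM2l//; first by rewrite divr_ge0//; lra.
  by rewrite lef_pV2 ?posrE// ler_nat.
by move=> h; move: (le_trans h hn); move: (_ * _) => X hX; lra.
Qed.

Lemma smear_bound (a : 'rV[R]_3) m x n :
  `|\int[area]_y (smear n y x * dot a y ^+ m)| <= (1 + dot a a) ^+ m.
Proof.
have ls : L1 area (fun y => smear n y x) by apply: L1Z; exact: L1_chord_pow.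
have lsp := L1M ls (measurable_dot_pow a m) (dot_pow_bound a m).
apply: le_trans (le_normr_Rintegral _ lsp) _ => //.
rewrite -[leRHS]mulr1 -[X in _ <= _ * X](integral_smear n x) -integralZ1//.
apply: le_integral1; [exact: L1_norm|exact: L1Z|move=> y].
rewrite normrM (ger0_norm (smear_ge0 _ _ _)) [leLHS]mulrC.
by apply: ler_wpM2r; [exact: smear_ge0|exact: dot_pow_bound].
Qed.

Lemma smearC n x y : smear n x y = smear n y x.
Proof. by rewrite /smear chordC. Qed.

(** By Fubini the moments of the smeared functions are those of w against smeared
   powers of linear forms, and both sides converge. *)
Lemma smear_limit_unique w (k_ : nat -> sphere R -> R) (k K : sphere R -> R) :
  L1 area w -> measurable_fun [set: sphere R] k -> L1 area K ->
  (forall n y, \int[area]_x (smear n x y * w x) = k_ n y) ->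
  {ae area, forall y, k_ ^~ y @ \oo --> k y} ->
  {ae area, forall y, forall n, `|k_ n y| <= K y} ->
  L1 area k /\ {ae area, forall x, w x = k x}.
Proof.
move=> lw mk lK wk kk kK.
have ms n : measurable_fun [set: sphere R * sphere R]
    (fun z : sphere R * sphere R => smear n z.2 z.1).
  apply: measurable_funM => //; apply: measurable_funX.
  by under [X in measurable_fun _ X]eq_fun do rewrite chordC; exact: measurable_chord2.
have sM n (z : sphere R * sphere R) : `|smear n z.2 z.1| <= n.+1%:R / (4 * pi).
  rewrite ger0_norm ?smear_ge0// /smear -[leRHS]mulr1 ler_wpM2l//.
    by rewrite divr_ge0// ltW// fourpi_gt0.
  by rewrite (le_trans (ler_norm _))// chord_pow_bound.
have lsw n : L1prod area area (fun z => smear n z.2 z.1 * w z.2).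
  exact: (L1prod_bounded _ (ms n) (sM n) lw).
have mk_ n : measurable_fun [set: sphere R] (k_ n).
  have -> : k_ n = (fun y => \int[area]_x (smear n x y * w x)).
    by apply/funext => y; rewrite wk.
  exact: (measurable_integral_snd (lsw n)).
have lk : L1 area k.
  by have [] := @dominated_convergence1 _ _ _ area k_ k K mk_ mk kk lK kK.
have lk_ n : L1 area (k_ n).
  have -> : k_ n = (fun y => \int[area]_x (smear n x y * w x)).
    by apply/funext => y; rewrite wk.
  exact: (L1_integral_snd (lsw n)).
split=> //.
have : {ae area, forall x, w x - k x = 0}; last first.
  by apply: filterS => x /eqP; rewrite subr_eq0 => /eqP.
apply: moments_eq0; first exact: L1B.
move=> a m; have mp := measurable_dot_pow a m; have bp := dot_pow_bound a m.
transitivity (\int[area]_x (w x * dot a x ^+ m - k x * dot a x ^+ m)).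
  by apply: eq_Rintegral => x _; ring.
rewrite integralB1; [|exact: (L1M lw mp bp)|exact: (L1M lk mp bp)].
apply/eqP; rewrite subr_eq0; apply/eqP.
have c1 : (fun n => \int[area]_x (w x * \int[area]_y (smear n y x * dot a y ^+ m)))
    @ \oo --> \int[area]_x (w x * dot a x ^+ m).
  apply: (bounded_cvg_integral lw _ mp _ (M := (1 + dot a a) ^+ m)).
  - move=> n; have l := L1_bounded area mp bp.
    exact: (measurable_integral_snd (L1prod_bounded area (ms n) (sM n) l)).
  - by move=> x; exact: smear_cvg.
  - by move=> n x; exact: smear_bound.
have c2 : (fun n => \int[area]_y (k_ n y * dot a y ^+ m))
    @ \oo --> \int[area]_y (k y * dot a y ^+ m).
  have [|||||_ //] := @dominated_convergence1 _ _ _ area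
    (fun n y => k_ n y * dot a y ^+ m) (fun y => k y * dot a y ^+ m)
    (fun y => (1 + dot a a) ^+ m * K y).
  - by move=> n; exact: measurable_funM.
  - exact: measurable_funM.
  - by apply: filterS kk => y h; apply: cvgM => //; exact: cvg_cst.
  - exact: L1Z.
  - apply: filterS kK => y h n; rewrite normrM mulrC.
    by apply: ler_pM => //; exact: bp.
rewrite -(cvg_lim (@Rhausdorff R) c1) -(cvg_lim (@Rhausdorff R) c2).
congr (limn _); apply/funext => n.
pose h (z : sphere R * sphere R) := smear n z.2 z.1 * w z.2 * dot a z.1 ^+ m.
have lh : L1prod area area h.
  have mh : measurable_fun [set: sphere R * sphere R] h.
    apply: measurable_funM; first exact: L1prod_measurable (lsw n).
    apply: measurable_funX.
    exact: (measurableT_comp (measurable_dot a)).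
  have := @L1prod_bounded _ _ _ _ _ area area
    (fun z => smear n z.2 z.1 * dot a z.1 ^+ m)
    (n.+1%:R / (4 * pi) * (1 + dot a a) ^+ m) w.
  rewrite (_ : h = (fun z => smear n z.2 z.1 * dot a z.1 ^+ m * w z.2)); last first.
    by apply/funext => z; rewrite /h; ring.
  apply => //.
    apply: measurable_funM; first exact: ms.
    apply: measurable_funX.
    exact: (measurableT_comp (measurable_dot a)).
  by move=> z; rewrite normrM; apply: ler_pM.
transitivity (\int[area]_x \int[area]_y h (y, x)).
  apply: eq_Rintegral => x _; rewrite /h /= -integralZ1.
    by apply: eq_Rintegral => y _; rewrite smearC; ring.
  apply: (L1M _ mp bp); apply: L1Z; exact: L1_chord_pow.
rewrite -(Fubini1 lh); apply: eq_Rintegral => y _; rewrite -wk /h /=.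
rewrite mulrC -integralZ1.
  by apply: eq_Rintegral => x _; ring.
under [X in L1 _ X]eq_fun do rewrite mulrC.
apply: (L1M lw (M := n.+1%:R / (4 * pi))); last by move=> x; exact: (sM n (y, x)).
by apply: measurable_funM => //; exact: measurable_chord_pow.
Qed.

End approximate_identity.

(** * Representation of weak solutions *)

Section representation.
Context {R : realType}.
Implicit Types (x y p : sphere R) (n m : nat) (u f G : sphere R -> R).

Lemma laplace_integral u y m : L1 area u ->
  \int[area]_x (u x * laplace_beltrami (chord_power y m) x) =
  m%:R ^+ 2 * \int[area]_x (u x * chord x y ^+ m.-1) -
  m%:R * m.+1%:R * \int[area]_x (u x * chord x y ^+ m).
Proof.
move=> lu; rewrite -!integralZ1; try exact: L1M_chord_pow.
rewrite -integralB1; try by apply: L1Z; exact: L1M_chord_pow.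
by apply: eq_Rintegral => x _; rewrite laplace_chord_power; ring.
Qed.

(** The Laplacian of log_sum n (chord . y) is 1 - (n + 1) chord^n. *)
Lemma log_sum_telescope u (La : nat -> R) y n : L1 area u ->
  (forall m, La m = - \int[area]_x (u x * laplace_beltrami (chord_power y m) x)) ->
  \sum_(k < n) (k.+1%:R)^-1 * La k.+1 =
  4 * pi * \int[area]_x (smear n x y * u x) - \int[area]_x u x.
Proof.
move=> lu hL.
have -> : 4 * pi * \int[area]_x (smear n x y * u x) =
    n.+1%:R * \int[area]_x (u x * chord x y ^+ n).
  rewrite -!integralZ1; last 2 first.
  - exact: L1M_chord_pow.
  - have := L1Z (n.+1%:R / (4 * pi)) (L1M_chord_pow n y lu).
    by under [X in L1 _ X -> _]eq_fun do rewrite mulrA [_ * u _]mulrC -mulrA mulrC.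
  apply: eq_Rintegral => x _; rewrite /smear.
  have := pi_gt0 R; move: pi => q q0; field.
  by rewrite gt_eqF.
elim: n => [|n ih].
  rewrite big_ord0 mul1r; apply/esym/eqP; rewrite subr_eq0; apply/eqP.
  by apply: eq_Rintegral => x _; rewrite expr0 mulr1.
rewrite big_ord_recr /= ih hL laplace_integral//= -(natr1 n.+1).
have := ltr0Sn R n; move: (n.+1%:R) => b b0; field.
by rewrite gt_eqF.
Qed.

Lemma chord_power_sphere y m (x : sphere R) : chord_power y m x = chord x y ^+ m.
Proof. by []. Qed.

Lemma weak_poisson_chord_power u f y m : weak_poisson u f ->
  \int[area]_x (f x * chord x y ^+ m) =
  - \int[area]_x (u x * laplace_beltrami (chord_power y m) x).
Proof.
move=> [V [_ [_ hV]] hf].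
rewrite -(hf _ (smooth_chord_power y m)) hV ?opprK//.
- exact: smooth_field_sgrad.
- by move=> x; exact: sgrad_tangent.
Qed.

Lemma trunc_potentialE n f y : L1 area f -> trunc_potential n f y =
  \sum_(k < n) (k.+1%:R)^-1 * \int[area]_x (f x * chord x y ^+ k.+1).
Proof.
move=> lf; rewrite /trunc_potential.
transitivity (\int[area]_x \sum_(k < n) (k.+1%:R)^-1 * (f x * chord x y ^+ k.+1)).
  apply: eq_Rintegral => x _; rewrite /log_sum chordC mulr_suml.
  by apply: eq_bigr => k _; ring.
rewrite integral_sum1; last by move=> k; apply: L1Z; exact: L1M_chord_pow.
by apply: eq_bigr => k _; rewrite integralZ1//; exact: L1M_chord_pow.
Qed.

(** Testing with log_sum n (chord . y) relates the smeared u to the truncated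
   potential of f; then n goes to infinity. *)
Lemma weak_poisson_potential u f : L1 area u -> L1 area f -> weak_poisson u f ->
  {ae area, forall x, u x = (4 * pi)^-1 * (\int[area]_y u y + potential f x)}.
Proof.
move=> lu lf uf; set a := \int[area]_y u y.
have p4 : (4 * pi)^-1 * (4 * pi) = 1 :> R by rewrite mulVf// gt_eqF// fourpi_gt0.
have inv0 : 0 <= (4 * pi)^-1 :> R by rewrite invr_ge0 ltW// fourpi_gt0.
have lf' := L1_norm lf.
have [|||||_ //] := @smear_limit_unique R u
  (fun n x => (4 * pi)^-1 * (a + trunc_potential n f x))
  (fun x => (4 * pi)^-1 * (a + potential f x))
  (fun x => (4 * pi)^-1 * (`|a| + potential (fun y => `|f y|) x)) lu.
- apply: measurable_funM => //; apply: measurable_funD => //.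
  exact: measurable_potential.
- by apply: L1Z; apply: L1D; [exact: L1_cst|exact: L1_potential].
- move=> n y; have e := @log_sum_telescope u _ y n lu
    (fun m => weak_poisson_chord_power y m uf).
  by rewrite (trunc_potentialE n y lf) e addrC subrK mulrA p4 mul1r.
- apply: filterS (trunc_potential_cvg lf) => x [_ h].
  by apply: cvgM; [exact: cvg_cst|apply: cvgD; [exact: cvg_cst|]].
- apply: filterS (trunc_potential_cvg lf) => x [h _] n.
  rewrite normrM (ger0_norm inv0) ler_wpM2l//.
  by rewrite (le_trans (ler_normD _ _))// lerD2l.
Qed.

Lemma L1_neg_log p : L1 area (fun x => neg_log (chord x p)).
Proof.
apply/L1_lty.
- by apply: measurable_chord_comp; exact: measurable_neg_log.
- by move=> x; rewrite neg_log_ge0// chord_ge0.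
- by apply: le_lt_trans (integral_neg_log p) _; exact: ltry.
Qed.

(** The same argument as for weak solutions: a point mass at p has the potential
   neg_log (chord . p), of mean 1. *)
Lemma green_neg_log p G : green p G ->
  {ae area, forall x, G x = (4 * pi)^-1 * (neg_log (chord x p) - 1)}.
Proof.
move=> [LG G0 hG].
have lG : L1 area G by exact/(Lfun1_integrable area).
have p4 : (4 * pi)^-1 * (4 * pi) = 1 :> R by rewrite mulVf// gt_eqF// fourpi_gt0.
have inv0 : 0 <= (4 * pi)^-1 :> R by rewrite invr_ge0 ltW// fourpi_gt0.
have La y m : chord p y ^+ m - m.+1%:R^-1 =
    - \int[area]_x (G x * laplace_beltrami (chord_power y m) x).
  rewrite hG ?chord_power_sphere; last exact: smooth_chord_power.
  congr (_ - _).
  transitivity ((4 * pi)^-1 * (4 * pi / m.+1%:R) : R); first by rewrite mulrA p4 mul1r.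
  by rewrite -(area_chord_pow m y).
have tel n : \sum_(k < n) (k.+1%:R)^-1 * (k.+2%:R)^-1 = 1 - (n.+1%:R)^-1 :> R.
  elim: n => [|n ih]; first by rewrite big_ord0 invr1 subrr.
  rewrite big_ord_recr /= ih -(natr1 n.+1).
  have := ltr0Sn R n; move: (n.+1%:R) => b b0; field.
  by rewrite !gt_eqF//; lra.
have [|||||_ //] := @smear_limit_unique R G
  (fun n x => (4 * pi)^-1 * (log_sum n (chord x p) - (1 - (n.+1%:R)^-1)))
  (fun x => (4 * pi)^-1 * (neg_log (chord x p) - 1))
  (fun x => (4 * pi)^-1 * (neg_log (chord x p) + 1)) lG.
- apply: measurable_funM => //; apply: measurable_funB => //.
  by apply: measurable_chord_comp; exact: measurable_neg_log.
- by apply: L1Z; apply: L1D; [exact: L1_neg_log|exact: L1_cst].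
- move=> n y; have := @log_sum_telescope G _ y n lG (La y).
  rewrite G0 subr0 => e.
  rewrite -[LHS]mul1r -[X in X * _ = _]p4 -mulrA -e; congr (_ * _).
  rewrite -tel /log_sum chordC -sumrB; apply: eq_bigr => k _; ring.
- apply: filterS (chord_lt1_ae p) => x x1.
  apply: cvgM; first exact: cvg_cst.
  apply: cvgB; first by apply: cvg_log_sum => //; exact: chord_ge0.
  rewrite -[X in _ --> X]subr0; apply: cvgB; [exact: cvg_cst|exact: cvg_harmonic].
- apply: filterS (chord_lt1_ae p) => x x1 n.
  rewrite normrM (ger0_norm inv0) ler_wpM2l//.
  have h1 := log_sum_le n (chord_ge0 x p) x1.
  have h0 := log_sum_ge0 n (chord_ge0 x p).
  have d0 : 0 <= (n.+1%:R)^-1 :> R by rewrite invr_ge0.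
  have d1 : (n.+1%:R)^-1 <= 1 :> R by rewrite invf_le1 ?ler1n// ltr0n.
  by move: (n.+1%:R^-1) d0 d1 => d d0 d1; rewrite ler_norml; apply/andP; split; lra.
Qed.

End representation.

(** * Differentiation along meridians *)

Section meridians.
Context {R : realType}.
Implicit Types (x y p : sphere R) (a : 'rV[R]_3) (t z : R) (n m : nat)
  (f g Dg : sphere R -> R).
Local Notation leb := (@lebesgue_measure R).

(** Cylindrical coordinates with the axis through p. *)
Definition meridian p t z : sphere R :=
  reflection (to_pole p) (cylindrical (t, z)).

Lemma continuous_height_fun : continuous (@height R).
Proof.
move=> z; apply: (@continuous_max R R (fun=> -1) (fun z => Num.min 1 z)).
  exact: cst_continuous.
apply: (@continuous_min R R (fun=> 1) (fun z => z)); first exact: cst_continuous.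
exact: cvg_id.
Qed.

Lemma continuous_cyl_radius : continuous (@cyl_radius R).
Proof.
move=> z; apply: (@continuous_comp _ _ _ (fun z => 1 - height z ^+ 2)); last exact: sqrt_continuous.
apply: cvgB; first exact: cvg_cst.
by apply: (continuous_expf (f := @height R)); exact: continuous_height_fun.
Qed.

Lemma near_oo z : -1 < z -> z < 1 -> \forall w \near z, -1 < w < 1.
Proof.
move=> z1 z2; near=> w; apply/andP; split; near: w.
  exact: lt_nbhsr.
exact: lt_nbhsl.
Unshelve. all: end_near. Qed.

Lemma heightoo z : -1 < z < 1 -> height z = z.
Proof. by move=> /andP[a b]; rewrite heightE// in_itv/= !ltW. Qed.

Lemma der_height_fun z : -1 < z -> z < 1 -> is_derive z 1 (@height R) 1.
Proof.
move=> z1 z2; apply: (near_eq_is_derive _ (derId z)).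
by apply: filterS (near_oo z1 z2) => w ww; rewrite heightoo.
Qed.

Lemma der_cyl_radius z : -1 < z -> z < 1 ->
  is_derive z 1 (@cyl_radius R) (- z / cyl_radius z).
Proof.
move=> z1 z2.
have d1 : is_derive z 1 (fun w : R => 1 + -1 * w ^+ 2) (- (2 * z)).
  by apply: (der_eq (derD (derC 1 z) (derZ (-1) (derX 2 (derId z))))); rewrite /=; ring.
have p0 : 0 < 1 + -1 * z ^+ 2 by nra.
have d3 := @is_derive1_comp R Num.sqrt (fun w : R => 1 + -1 * w ^+ 2) z _ _
  (is_derive1_sqrt p0) d1.
have e : forall w : R, -1 < w < 1 -> Num.sqrt (1 + -1 * w ^+ 2) = cyl_radius w.
  by move=> w ww; rewrite /cyl_radius heightoo// mulN1r.
have d4 : is_derive z 1 (@cyl_radius R) ((2 * Num.sqrt (1 + -1 * z ^+ 2))^-1 * - (2 * z)).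
  by apply: (near_eq_is_derive _ d3); apply: filterS (near_oo z1 z2) => w ww; rewrite /= e.
apply: (der_eq d4); rewrite e ?z1//.
have r0 : cyl_radius z != 0 by rewrite -e ?z1// gt_eqF// sqrtr_gt0.
by field.
Qed.

(** Dg is the derivative of g along X x = p - (p . x) x, which on meridians is
   (1 - z^2) d/dz. The meridians are smooth only in the open interval, whereas g
   and Dg are required to be continuous up to the poles. *)
Definition meridian_derivative p g Dg : Prop := forall t,
  [/\ forall z, -1 < z -> z < 1 ->
        is_derive z 1 (fun z => g (meridian p t z)) (Dg (meridian p t z) / (1 - z ^+ 2)),
      continuous (fun z => g (meridian p t z)) &
      continuous (fun z => Dg (meridian p t z))].

Lemma dot_meridian p t z a : dot (meridian p t z) a =
  cyl_radius z * (householder (to_pole p) a 0 i0 * cos t + householder (to_pole p) a 0 i1 * sin t) +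
  dot p a * height z.
Proof.
rewrite /meridian dot_reflection dotC dot_cylindrical; congr (_ + _ * _).
by rewrite -dot_north dot_householder -(householder_to_pole p) householderK dotC.
Qed.

Lemma dot_meridian_pole p t z : dot (meridian p t z) p = height z.
Proof. by rewrite /meridian dot_to_pole dot_north_cyl. Qed.

Lemma meridian_derivative_dot p a : meridian_derivative p (fun x => dot x a)
  (fun x => dot p a - dot x p * dot x a).
Proof.
move=> t; set b := (householder (to_pole p) a 0 i0 * cos t + householder (to_pole p) a 0 i1 * sin t).
have e : (fun z => dot (meridian p t z) a) = (fun z => b * cyl_radius z + dot p a * height z).
  by apply/funext => z; rewrite dot_meridian -/b mulrC.
have c : continuous (fun z => dot (meridian p t z) a).
  rewrite e => z; apply: cvgD; apply: cvgM; try exact: cvg_cst.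
    exact: continuous_cyl_radius.
  exact: continuous_height_fun.
split => //.
- move=> z z1 z2; rewrite e.
  apply: (der_eq (derD (derZ b (der_cyl_radius z1 z2)) (derZ (dot p a) (der_height_fun z1 z2)))).
  have ee : dot (meridian p t z) a = b * cyl_radius z + dot p a * height z by rewrite -[LHS]/((fun z => dot (meridian p t z) a) z) e.
  rewrite dot_meridian_pole ee heightoo ?z1//.
  have r2 : 1 - z ^+ 2 = cyl_radius z ^+ 2.
    by rewrite /cyl_radius sqr_sqrtr ?height_sqr// heightoo ?z1.
  have r0 : cyl_radius z != 0 by rewrite -sqrf_eq0 -r2 gt_eqF//; nra.
  have -> : dot p a - z * (b * cyl_radius z + dot p a * z) =
      - (b * z * cyl_radius z) + dot p a * (1 - z ^+ 2) by ring.
  by rewrite r2; field.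
- have cp : continuous (fun z => dot (meridian p t z) p).
    have -> : (fun z => dot (meridian p t z) p) = @height R.
      by apply/funext => w; rewrite dot_meridian_pole.
    exact: continuous_height_fun.
  move=> z; apply: cvgB; first exact: cvg_cst.
  by apply: cvgM; [exact: cp|exact: c].
Qed.

Lemma meridian_derivativeC p (c : R) : meridian_derivative p (fun=> c) (fun=> 0).
Proof.
move=> t; split; [|exact: cst_continuous|exact: cst_continuous].
by move=> z _ _; rewrite mul0r; exact: derC.
Qed.

Lemma meridian_derivativeD p g1 D1 g2 D2 :
  meridian_derivative p g1 D1 -> meridian_derivative p g2 D2 ->
  meridian_derivative p (fun x => g1 x + g2 x) (fun x => D1 x + D2 x).
Proof.
move=> h1 h2 t; have [d1 c1 e1] := h1 t; have [d2 c2 e2] := h2 t; split.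
- by move=> z z1 z2; apply: (der_eq (derD (d1 z z1 z2) (d2 z z1 z2))); rewrite mulrDl.
- by move=> z; apply: cvgD; [exact: c1|exact: c2].
- by move=> z; apply: cvgD; [exact: e1|exact: e2].
Qed.

Lemma meridian_derivativeM p g1 D1 g2 D2 :
  meridian_derivative p g1 D1 -> meridian_derivative p g2 D2 ->
  meridian_derivative p (fun x => g1 x * g2 x) (fun x => g1 x * D2 x + g2 x * D1 x).
Proof.
move=> h1 h2 t; have [d1 c1 e1] := h1 t; have [d2 c2 e2] := h2 t; split.
- by move=> z z1 z2; apply: (der_eq (derM (d1 z z1 z2) (d2 z z1 z2))); ring.
- by move=> z; apply: cvgM; [exact: c1|exact: c2].
- move=> z; apply: cvgD; apply: cvgM;
    [exact: c1|exact: e2|exact: c2|exact: e1].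
Qed.

Lemma meridian_derivativeZ p (c : R) g D : meridian_derivative p g D ->
  meridian_derivative p (fun x => c * g x) (fun x => c * D x).
Proof.
move=> h t; have [d1 c1 e1] := h t; split.
- by move=> z z1 z2; apply: (der_eq (derZ c (d1 z z1 z2))); rewrite mulrA.
- by move=> z; apply: cvgM; [exact: cvg_cst|exact: c1].
- by move=> z; apply: cvgM; [exact: cvg_cst|exact: e1].
Qed.

Lemma meridian_derivative_exp p g D : meridian_derivative p g D ->
  meridian_derivative p (fun x => expR (g x)) (fun x => expR (g x) * D x).
Proof.
move=> h t; have [d1 c1 e1] := h t.
have ce : continuous (fun z => expR (g (meridian p t z))).
  by move=> z; apply: (continuous_comp (c1 z)); exact: continuous_expR.
split => //.
- move=> z z1 z2; have := @is_derive1_comp R expR _ z _ _ (is_derive_expR _) (d1 z z1 z2).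
  by move=> H; apply: (der_eq H); rewrite mulrA.
- by move=> z; apply: cvgM; [exact: ce|exact: e1].
Qed.

Lemma meridian_derivative_eq p g D g' D' : meridian_derivative p g D ->
  g =1 g' -> D =1 D' -> meridian_derivative p g' D'.
Proof. by move=> h /funext <- /funext <-. Qed.

(** The divergence of X is -2 z. On each meridian Dg - 2 z g is the derivative of
   (1 - z^2) g, which vanishes at both poles. *)
Lemma meridian_ibp p g Dg (M M' : R) : meridian_derivative p g Dg ->
  measurable_fun [set: sphere R] g -> measurable_fun [set: sphere R] Dg ->
  (forall x, `|g x| <= M) -> (forall x, `|Dg x| <= M') ->
  \int[area]_x Dg x = 2 * \int[area]_x (dot x p * g x).
Proof.
move=> h mg mD gM DM.
have mz : measurable_fun [set: sphere R] (fun x => dot x p).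
  by under [X in measurable_fun _ X]eq_fun do rewrite dotC; exact: measurable_dot.
have z1 x : `|dot x p| <= 1.
  by rewrite ler_norml dot_sphere_le1 dot_sphere_geN1.
have lg : L1 area g by exact: L1_bounded mg gM.
have lD : L1 area Dg by exact: L1_bounded mD DM.
have lzg : L1 area (fun x => dot x p * g x).
  by under [X in L1 _ X]eq_fun do rewrite mulrC; exact: L1M lg mz z1.
apply/eqP; rewrite -subr_eq0 -integralZ1// -integralB1//; last exact: L1Z.
pose k x := Dg x - 2 * (dot x p * g x).
have lk : L1 area k by apply: L1B => //; exact: L1Z.
have mk : measurable_fun [set: sphere R] k.
  by apply: measurable_funB => //; do 2 apply: measurable_funM => //.
rewrite -(area_reflection (to_pole p) (f := k))//.
have mkr : measurable_fun [set: sphere R] (fun x => k (reflection (to_pole p) x)).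
  exact: (measurableT_comp mk (measurable_reflection _)).
rewrite (@area_fubini _ _ (M' + 2 * M) mkr); last first.
  move=> x; rewrite /k; set y := reflection _ x.
  rewrite (le_trans (ler_normB _ _))// lerD// normrM ger0_norm// ler_wpM2l//.
  by rewrite normrM -[leRHS]mul1r ler_pM.
apply/eqP; rewrite -[RHS](mul0r (2 * pi - 0)) -itv_measure_cst; last by rewrite ltW ?twopi_gt0.
apply: eq_Rintegral => t _; have [d1 c1 e1] := h t.
have kE z : k (meridian p t z) = Dg (meridian p t z) - 2 * (height z * g (meridian p t z)).
  by rewrite /k dot_meridian_pole.
have ck : continuous (fun z => k (meridian p t z)).
  have -> : (fun z => k (meridian p t z)) =
     (fun z => Dg (meridian p t z) - 2 * (height z * g (meridian p t z))).
    by apply/funext => z; rewrite kE.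
  move=> z; apply: cvgB; first exact: e1.
  apply: cvgM; first exact: cvg_cst.
  by apply: cvgM; [exact: continuous_height_fun|exact: c1].
rewrite integral_itv_measure; last exact: L1_itv_cont ck.
pose F z := (1 + -1 * z ^+ 2) * g (meridian p t z).
have cF : continuous F.
  move=> z; apply: cvgM; last exact: c1.
  apply: cvgD; first exact: cvg_cst.
  by apply: cvgM; [exact: cvg_cst|exact: exprn_continuous].
have dF z : -1 < z -> z < 1 -> is_derive z 1 F (k (meridian p t z)).
  move=> za zb; have d2 := derD (derC 1 z) (derZ (-1) (derX 2 (derId z))).
  apply: (der_eq (derM d2 (d1 z za zb))).
  rewrite kE heightoo ?za//=.
  have r0 : 1 - z ^+ 2 != 0 by rewrite gt_eqF//; nra.
  by field.
rewrite /Rintegral (@continuous_FTC2 _ (fun z => k (meridian p t z)) F)//=.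
- by rewrite /F sqrrN expr1n mulr1 subrr !mul0r subrr.
- exact: continuous_subspaceT.
- split.
  + by move=> z; rewrite in_itv/= => /andP[za zb]; have [] := dF z za zb.
  + exact/cvg_at_right_filter/cF.
  + exact/cvg_at_left_filter/cF.
- by move=> z; rewrite in_itv/= => /andP[za zb]; rewrite derive1E; have [_ ->] := dF z za zb.
Qed.

End meridians.

(** * Transport of potentials along meridians *)

Section transport.
Context {R : realType}.
Variable p : sphere R.
Implicit Types (x y : sphere R) (n m : nat) (f : sphere R -> R).

(** The derivative of chord . y along X. *)
Definition chord_slope x y : R := (dot p y - dot x p * dot x y) / 2.

Lemma chord_slope_bound x y : `|chord_slope x y| <= 1.
Proof.
have h (a b : sphere R) : `|dot (sphere_val a) (sphere_val b)| <= 1.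
  by rewrite ler_norml dot_sphere_le1 dot_sphere_geN1.
rewrite /chord_slope normrM [`|2^-1|]ger0_norm// ler_pdivrMr//.
apply: le_trans (ler_normB _ _) _; rewrite normrM.
have := h p y; have : `|dot x p| * `|dot x y| <= 1 by rewrite mulr_ile1.
lra.
Qed.

Lemma measurable_dot_l (a : 'rV[R]_3) :
  measurable_fun [set: sphere R] (fun x : sphere R => dot x a).
Proof. by under [X in measurable_fun _ X]eq_fun do rewrite dotC; exact: measurable_dot. Qed.

Lemma measurable_chord_slope2 : measurable_fun [set: sphere R * sphere R]
  (fun z : sphere R * sphere R => chord_slope z.1 z.2).
Proof.
apply: measurable_funM => //; apply: measurable_funB.
  exact: (measurableT_comp (measurable_dot p)).
apply: measurable_funM; last exact: measurable_dot2.
exact: (measurableT_comp (measurable_dot_l p)).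
Qed.

Lemma measurable_chord_slope x :
  measurable_fun [set: sphere R] (chord_slope x).
Proof.
apply: measurable_funM => //; apply: measurable_funB; first exact: measurable_dot.
by apply: measurable_funM => //; exact: measurable_dot.
Qed.

Definition chord_moment m f x : R := \int[area]_y (chord x y ^+ m * f y).

Definition chord_moment_slope m f x : R :=
  \int[area]_y (m%:R * chord x y ^+ m.-1 * chord_slope x y * f y).

Let L1_cp m f x : L1 area f -> L1 area (fun y => chord x y ^+ m * f y).
Proof.
move=> lf; have := L1M_chord_pow m x lf.
by under [X in L1 _ X -> _]eq_fun do rewrite mulrC chordC.
Qed.

Let L1_cs m f x : L1 area f ->
  L1 area (fun y => chord x y ^+ m * chord_slope x y * f y).
Proof.
move=> lf; have := L1M (L1_cp m x lf) (measurable_chord_slope x) (chord_slope_bound x).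
by under [X in L1 _ X -> _]eq_fun do rewrite mulrAC.
Qed.

Let e (i : 'I_3) : 'rV[R]_3 := delta_mx 0 i.
Let fc f (i : 'I_3) : sphere R -> R := fun y => f y * sphere_val y 0 i.

Let L1_fc f i : L1 area f -> L1 area (fc f i).
Proof.
by move=> lf; exact: (L1M lf (measurable_sphere_coord i) (fun y => coord_sphere_le1 y i)).
Qed.

Let dot_e (a : 'rV[R]_3) i : dot a (e i) = a 0 i.
Proof. by rewrite dotC dot_delta. Qed.

Let integral_lin (c0 c1 c2 c3 : R) g0 g1 g2 g3 :
  L1 area g0 -> L1 area g1 -> L1 area g2 -> L1 area g3 ->
  L1 area (fun y => c0 * g0 y + (c1 * g1 y + (c2 * g2 y + c3 * g3 y))) /\
  \int[area]_y (c0 * g0 y + (c1 * g1 y + (c2 * g2 y + c3 * g3 y))) =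
  c0 * \int[area]_y g0 y + (c1 * \int[area]_y g1 y +
    (c2 * \int[area]_y g2 y + c3 * \int[area]_y g3 y)) :> R.
Proof.
move=> k0 k1 k2 k3.
have l0 := L1Z c0 k0; have l1 := L1Z c1 k1; have l2 := L1Z c2 k2; have l3 := L1Z c3 k3.
have l23 := L1D l2 l3; have l123 := L1D l1 l23.
split; first exact: (L1D l0 l123).
rewrite (integralD1 l0 l123) (integralD1 l1 l23) (integralD1 l2 l3).
by rewrite (integralZ1 c0 k0) (integralZ1 c1 k1) (integralZ1 c2 k2) (integralZ1 c3 k3).
Qed.

(** The chord is affine in the coordinates of x, with coefficients depending on
   y: a power of it can be lowered at the cost of multiplying f by coordinates,
   and no differentiation under the integral is needed. *)
Let chord_momentS m f x : L1 area f -> chord_moment m.+1 f x =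
  2^-1 * chord_moment m f x + 2^-1 * (dot x (e i0) * chord_moment m (fc f i0) x +
   (dot x (e i1) * chord_moment m (fc f i1) x + dot x (e i2) * chord_moment m (fc f i2) x)).
Proof.
move=> lf; have l i := L1_cp m x (L1_fc i lf); have l0 := L1_cp m x lf.
have [_ h] := integral_lin 2^-1 (2^-1 * dot x (e i0)) (2^-1 * dot x (e i1))
  (2^-1 * dot x (e i2)) l0 (l i0) (l i1) (l i2).
transitivity (2^-1 * chord_moment m f x + (2^-1 * dot x (e i0) * chord_moment m (fc f i0) x +
   (2^-1 * dot x (e i1) * chord_moment m (fc f i1) x +
    2^-1 * dot x (e i2) * chord_moment m (fc f i2) x))); last by ring.
rewrite /chord_moment -h; apply: eq_Rintegral => y _.
rewrite exprS /fc !dot_e {1}/chord (dotE x y); by field.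
Qed.

Let chord_moment_slopeS m f x : L1 area f -> chord_moment_slope m.+1 f x =
  2^-1 * chord_moment_slope m f x +
  2^-1 * ((dot x (e i0) * chord_moment_slope m (fc f i0) x +
           chord_moment m (fc f i0) x * (dot p (e i0) - dot x p * dot x (e i0))) +
   ((dot x (e i1) * chord_moment_slope m (fc f i1) x +
           chord_moment m (fc f i1) x * (dot p (e i1) - dot x p * dot x (e i1))) +
    (dot x (e i2) * chord_moment_slope m (fc f i2) x +
           chord_moment m (fc f i2) x * (dot p (e i2) - dot x p * dot x (e i2))))).
Proof.
move=> lf; have l i := L1_cp m x (L1_fc i lf).
have ls g : L1 area g ->
    L1 area (fun y => m%:R * chord x y ^+ m.-1 * chord_slope x y * g y).
  move=> lg; have := L1Z m%:R (L1_cs m.-1 x lg).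
  by congr L1; apply/funext => y /=; ring.
have lsi i := ls _ (L1_fc i lf); have l0 := ls _ lf; have l00 := L1_cp m x lf.
pose s i : R := 2^-1 * dot x (e i).
pose r i : R := 2^-1 * (dot p (e i) - dot x p * dot x (e i)).
have [k1 h1] := integral_lin 2^-1 (s i0) (s i1) (s i2) l0 (lsi i0) (lsi i1) (lsi i2).
have [k2 h2] := integral_lin 0 (r i0) (r i1) (r i2) l00 (l i0) (l i1) (l i2).
transitivity (\int[area]_y (2^-1 * (m%:R * chord x y ^+ m.-1 * chord_slope x y * f y) +
  (s i0 * (m%:R * chord x y ^+ m.-1 * chord_slope x y * fc f i0 y) +
  (s i1 * (m%:R * chord x y ^+ m.-1 * chord_slope x y * fc f i1 y) +
   s i2 * (m%:R * chord x y ^+ m.-1 * chord_slope x y * fc f i2 y))) +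
  (0 * (chord x y ^+ m * f y) + (r i0 * (chord x y ^+ m * fc f i0 y) +
  (r i1 * (chord x y ^+ m * fc f i1 y) + r i2 * (chord x y ^+ m * fc f i2 y)))))); last first.
  by rewrite integralD1// h1 h2 /s /r /chord_moment_slope /chord_moment; ring.
apply: eq_Rintegral => y _; rewrite /= /fc /s /r !dot_e.
have ec : m%:R * chord x y ^+ m = m%:R * chord x y ^+ m.-1 * chord x y.
  by case: (m) => [|k]; rewrite ?mul0r// exprSr mulrA.
transitivity (m%:R * chord x y ^+ m * chord_slope x y * f y +
   chord x y ^+ m * chord_slope x y * f y).
  by rewrite -natr1; ring.
rewrite ec {2}/chord {2}/chord_slope (dotE p y) (dotE x y); by field.
Qed.

Lemma meridian_chord_moment m f : L1 area f ->
  meridian_derivative p (chord_moment m f) (chord_moment_slope m f).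
Proof.
elim: m f => [|m ih] f lf.
  apply: (meridian_derivative_eq (meridian_derivativeC p (\int[area]_y f y))) => x.
    by apply: eq_Rintegral => y _; rewrite expr0 mul1r.
  rewrite /chord_moment_slope; under eq_Rintegral do rewrite !mul0r.
  by rewrite Rintegral_cst// mul0r.
have d i := meridian_derivativeM (meridian_derivative_dot p (e i)) (ih _ (L1_fc i lf)).
apply: (meridian_derivative_eq (meridian_derivativeD
  (meridian_derivativeZ 2^-1 (ih f lf))
  (meridian_derivativeZ 2^-1 (meridian_derivativeD (d i0)
    (meridian_derivativeD (d i1) (d i2)))))) => x.
  by rewrite chord_momentS.
by rewrite chord_moment_slopeS.
Qed.

(** The derivative along X of the truncated potential of f. *)
Definition transport n f x : R :=
  \int[area]_y (geom_sum n (chord x y) * chord_slope x y * f y).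

Lemma L1_transport_kernel n f x : L1 area f ->
  L1 area (fun y => geom_sum n (chord x y) * chord_slope x y * f y).
Proof.
move=> lf; have := L1_sum (mu := area) (index_enum 'I_n) xpredT (fun k : 'I_n => L1_cs k x lf).
by under [X in L1 _ X -> _]eq_fun do rewrite -mulr_suml -mulr_suml.
Qed.

Lemma meridian_trunc_potential n f : L1 area f ->
  meridian_derivative p (trunc_potential n f) (transport n f).
Proof.
move=> lf; elim: n => [|n ih].
  apply: (meridian_derivative_eq (meridian_derivativeC p 0)) => x.
    rewrite /trunc_potential; under eq_Rintegral do rewrite /log_sum big_ord0 mul0r.
    by rewrite Rintegral_cst// mul0r.
  rewrite /transport; under eq_Rintegral do rewrite /geom_sum big_ord0 !mul0r.
  by rewrite Rintegral_cst// mul0r.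
apply: (meridian_derivative_eq (meridian_derivativeD ih
  (meridian_derivativeZ (n.+1%:R)^-1 (meridian_chord_moment n.+1 lf)))) => x.
  rewrite /trunc_potential /chord_moment -integralZ1; last exact: L1_cp.
  rewrite -integralD1; [|exact: L1_trunc_kernel|by apply: L1Z; exact: L1_cp].
  by apply: eq_Rintegral => y _; rewrite log_sumS; ring.
have es : chord_moment_slope n.+1 f x =
    n.+1%:R * \int[area]_y (chord x y ^+ n * chord_slope x y * f y).
  rewrite /chord_moment_slope -(integralZ1 _ (L1_cs n x lf)).
  by apply: eq_Rintegral => y _ /=; rewrite !mulrA.
rewrite es mulKf ?pnatr_eq0// /transport.
rewrite -(integralD1 (L1_transport_kernel n x lf) (L1_cs n x lf)).
by apply: eq_Rintegral => y _; rewrite geom_sumS /=; ring.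
Qed.

Lemma meridian_log_sum n y : meridian_derivative p (fun x => log_sum n (chord x y))
  (fun x => geom_sum n (chord x y) * chord_slope x y).
Proof.
have dc : meridian_derivative p (chord^~ y) (chord_slope^~ y).
  apply: (meridian_derivative_eq (meridian_derivativeZ 2^-1 (meridian_derivativeD
    (meridian_derivativeC p 1) (meridian_derivative_dot p y)))) => x.
    by rewrite /chord mulrC.
  by rewrite /chord_slope add0r mulrC.
have dp m : meridian_derivative p (fun x => chord x y ^+ m)
    (fun x => m%:R * chord x y ^+ m.-1 * chord_slope x y).
  elim: m => [|m ih].
    by apply: (meridian_derivative_eq (meridian_derivativeC p 1)) => x; rewrite ?expr0 ?mul0r.
  apply: (meridian_derivative_eq (meridian_derivativeM dc ih)) => x.
    by rewrite exprS.
  rewrite /= -natr1; case: m {ih} => [|m]; first by rewrite !mul0r mulr0 !expr0; ring.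
  by rewrite /= exprS; ring.
elim: n => [|n ih].
  by apply: (meridian_derivative_eq (meridian_derivativeC p 0)) => x;
    rewrite /log_sum /geom_sum big_ord0 ?mul0r.
apply: (meridian_derivative_eq (meridian_derivativeD ih
  (meridian_derivativeZ (n.+1%:R)^-1 (dp n.+1)))) => x.
  by rewrite log_sumS.
by rewrite geom_sumS /= -!mulrA mulKf ?pnatr_eq0//; ring.
Qed.

Lemma L1prod_transport n f : L1 area f ->
  L1prod area area (fun z => geom_sum n (chord z.1 z.2) * chord_slope z.1 z.2 * f z.2).
Proof.
move=> lf; apply: (L1prod_bounded _ (M := n%:R)) => //.
  apply: measurable_funM; last exact: measurable_chord_slope2.
  by apply: measurable_chord_comp2; exact: measurable_geom_sum.
move=> z; rewrite normrM -[leRHS]mulr1.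
by rewrite ler_pM// ?geom_sum_bound ?chord_itv// chord_slope_bound.
Qed.

Lemma measurable_transport n f : L1 area f ->
  measurable_fun [set: sphere R] (transport n f).
Proof. by move=> lf; exact: (measurable_integral_snd (L1prod_transport n lf)). Qed.

Lemma transport_bound n f x : L1 area f ->
  `|transport n f x| <= n%:R * \int[area]_y `|f y|.
Proof.
move=> lf; have l := L1_transport_kernel n x lf.
rewrite (le_trans (le_normr_Rintegral _ _))// -integralZ1; last exact: L1_norm.
apply: le_integral1; [exact: L1_norm|exact/L1Z/L1_norm|move=> y].
rewrite normrM ler_wpM2r// normrM -[leRHS]mulr1.
by rewrite ler_pM// ?geom_sum_bound ?chord_itv// chord_slope_bound.
Qed.

End transport.

(** * Exponential bounds with poles *)

Section integral_exp_logs_potential.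
Context {R : realType}.

(** At most one of a and b is large, so the exponent is at most (A + B) M + u up
   to a constant, M being the largest of a, b, l. Either u is small compared to
   M, or M is bounded by a multiple of u. *)
Lemma exp_split (A B a b l u : R) : 0 <= A -> 0 <= B -> A + B < 1 ->
  0 <= a -> 0 <= b -> 0 <= l -> 0 <= u -> a <= 1 \/ b <= 1 ->
  let d := 1 - A - B in
  expR (A * (a + b) + B * l + u) <= expR A *
    (expR ((1 - d / 2) * a) + expR ((1 - d / 2) * b) + expR ((1 - d / 2) * l) +
     expR (2 / d * u)).
Proof.
move=> A0 B0 AB a0 b0 l0 u0 ab /=; set d := 1 - A - B; have d0 : 0 < d by rewrite /d; lra.
pose M := Num.max (Num.max a b) l.
have aM : a <= M by rewrite /M !le_max lexx.
have bM : b <= M by rewrite /M !le_max lexx orbT.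
have lM : l <= M by rewrite /M !le_max lexx !orbT.
have h1 : A * (a + b) + B * l <= A + (1 - d) * M.
  have -> : 1 - d = A + B by rewrite /d; ring.
  have hB : B * l <= B * M by rewrite ler_wpM2l.
  have hA : A * (a + b) <= A * (1 + M) by rewrite ler_wpM2l//; case: ab => ?; lra.
  by rewrite mulrDl; lra.
have [uM|uM] := leP u (d / 2 * M); last first.
  have uM' : M <= 2 / d * u.
    rewrite mulrAC ler_pdivlMr//; lra.
  have h2 : A * (a + b) + B * l + u <= A + 2 / d * u.
    have hd : (1 - d) * M <= (1 - d) * (2 / d * u) by rewrite ler_wpM2l// /d; lra.
    have e : (1 - d) * (2 / d * u) = 2 / d * u - 2 * u by field; rewrite gt_eqF.
    lra.
  apply: (@le_trans _ _ (expR (A + 2 / d * u))); first by rewrite ler_expR.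
  rewrite [expR (A + 2 / d * u)]expRD ler_wpM2l ?expR_ge0//.
  by rewrite lerDr !addr_ge0 ?expR_ge0.
have h2 : A * (a + b) + B * l + u <= A + (1 - d / 2) * M by lra.
apply: (@le_trans _ _ (expR (A + (1 - d / 2) * M))); first by rewrite ler_expR.
rewrite [expR (A + (1 - d / 2) * M)]expRD ler_wpM2l ?expR_ge0//.
have ea := expR_ge0 ((1 - d / 2) * a); have eb := expR_ge0 ((1 - d / 2) * b).
have el := expR_ge0 ((1 - d / 2) * l); have eu := expR_ge0 (2 / d * u).
have : [\/ M = a, M = b | M = l].
  rewrite /M; have [_|_] := leP (Num.max a b) l; first by constructor 3.
  by have [_|_] := leP a b; [constructor 2|constructor 1].
by case=> ->; lra.
Qed.

Variables (p1 p2 : sphere R).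
Hypothesis antipodal : sphere_val p2 = - sphere_val p1.
Implicit Types (x y : sphere R) (F : sphere R -> R).

Lemma chord_antipodal x : chord x p1 + chord x p2 = 1.
Proof. by rewrite /chord antipodal dotNr; field. Qed.

Lemma neg_log_half (s : R) : s <= 2^-1 -> neg_log s <= 1.
Proof.
move=> s2; have s0 : 0 < 1 - s by lra.
have i0 : 0 < (1 - s)^-1 by rewrite invr_gt0.
have i2 : (1 - s)^-1 <= 2 by rewrite -[2]invrK lef_pV2 ?posrE//; lra.
rewrite /neg_log -lnV ?posrE// -[X in ln X](subrKC 1).
by rewrite (le_trans (le_ln1Dx _))//; lra.
Qed.

Definition pole_log x : R := neg_log (chord x p1) + neg_log (chord x p2).

Lemma pole_log_ge0 x : 0 <= pole_log x.
Proof. by rewrite addr_ge0// neg_log_ge0// chord_ge0. Qed.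

Lemma measurable_pole_log : measurable_fun [set: sphere R] pole_log.
Proof.
by apply: measurable_funD; apply: measurable_chord_comp; exact: measurable_neg_log.
Qed.

Lemma potential_norm_ge0 F x : 0 <= potential (fun y => `|F y|) x.
Proof.
by apply: Rintegral_ge0 => y _; rewrite mulr_ge0// neg_log_ge0// chord_ge0.
Qed.

(** The exponents at the two poles and at y may add up, but only if y is close to
   a pole; as A + B < 1 the bound is uniform in y. *)
Lemma integral_exp_logs_potential (A B c : R) F : 0 <= A -> 0 <= B -> A + B < 1 -> 0 <= c ->
  L1 area F -> exists C : R, forall y,
  (\int[area]_x (expR (A * pole_log x + B * neg_log (chord x y) +
     c * potential (fun y => `|F y|) x))%:E <= C%:E)%E.
Proof.
move=> A0 B0 AB c0 lF; pose d := 1 - A - B; have d0 : 0 < d by rewrite /d; lra.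
pose t := 1 - d / 2; have t0 : 0 <= t by rewrite /t /d; lra.
have t1 : t < 1 by rewrite /t; lra.
pose U x := expR (2 / d * (c * potential (fun y => `|F y|) x)).
have dc0 : 0 <= 2 / d * c by rewrite mulr_ge0// divr_ge0// ltW.
have lU : L1 area U.
  have := L1_exp_potential dc0 lF; congr L1; apply/funext => x.
  by rewrite /U mulrA.
pose e q x := expR (t * neg_log (chord x q)).
have me q : measurable_fun [set: sphere R] (e q).
  apply: (measurableT_comp (@measurable_expR R)); apply: measurable_funM => //.
  by apply: measurable_chord_comp; exact: measurable_neg_log.
have le q : L1 area (e q).
  apply/L1_lty => //; first by move=> x; exact: expR_ge0.
  by apply: le_lt_trans (integral_exp_neg_log q t0 t1) _; exact: ltry.
have leI q : \int[area]_x e q x <= 4 * pi / (1 - t).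
  by rewrite -lee_fin EFin_integral1//; exact: integral_exp_neg_log.
exists (expR A * (4 * pi / (1 - t) + 4 * pi / (1 - t) + 4 * pi / (1 - t) +
  \int[area]_x U x)) => y.
have lS : L1 area (fun x => e p1 x + e p2 x + e y x + U x) by do 3 apply: L1D => //.
have mP : measurable_fun [set: sphere R] (potential (fun y => `|F y|)).
  exact: measurable_potential (L1_norm lF).
apply: (@le_trans _ _ (\int[area]_x (expR A * (e p1 x + e p2 x + e y x + U x))%:E)%E).
  apply: ge0_le_integral => //.
  - apply/measurable_EFinP; apply: (measurableT_comp (@measurable_expR R)).
    apply: measurable_funD; last exact: measurable_funM.
    apply: measurable_funD; apply: measurable_funM => //; first exact: measurable_pole_log.
    by apply: measurable_chord_comp; exact: measurable_neg_log.
  - by apply/measurable_EFinP; exact: L1_measurable (L1Z _ lS).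
  - move=> x _; rewrite lee_fin; apply: exp_split => //;
      rewrite ?neg_log_ge0 ?chord_ge0 ?mulr_ge0 ?potential_norm_ge0//.
    have h := chord_antipodal x.
    have [h2|h2] := leP (chord x p1) 2^-1; [left|right]; apply: neg_log_half => //; lra.
rewrite -(EFin_integral1 (L1Z _ lS)) lee_fin (integralZ1 _ lS) ler_wpM2l ?expR_ge0//.
rewrite (integralD1 (L1D (L1D (le p1) (le p2)) (le y)) lU).
rewrite (integralD1 (L1D (le p1) (le p2)) (le y)) (integralD1 (le p1) (le p2)).
by rewrite lerD2r lerD ?lerD.
Qed.

End integral_exp_logs_potential.

(** * The kernel of the transport *)

Section slope_kernel.
Context {R : realType}.
Variables (p1 p2 : sphere R).
Hypothesis antipodal : sphere_val p2 = - sphere_val p1.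
Implicit Types (x y : sphere R) (F : sphere R -> R).

(** A bound for |geom_sum n (chord x y) * chord_slope x y|, for every n. *)
Definition slope_kernel x y : R :=
  2 * Num.sqrt (chord x p1 * chord x p2) * (Num.sqrt (1 - chord x y))^-1.

(** The slope is half the scalar product of the tangential parts of p1 and y. *)
Lemma chord_slope_sqr x y :
  chord_slope p1 x y ^+ 2 <= 4 * (chord x p1 * chord x p2) * (1 - chord x y).
Proof.
have := cauchy_schwarz (sphere_val p1 - dot x p1 *: sphere_val x)
                       (sphere_val y - dot x y *: sphere_val x).
rewrite !dotBl !dotBr !dotZl !dotZr !dot_sphere (dotC p1 x) (dotC y x).
rewrite /chord_slope /chord antipodal dotNr.
have := dot_sphere_le1 x y; have := dot_sphere_geN1 x y.
have := dot_sphere_le1 x p1; have := dot_sphere_geN1 x p1.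
set z := dot x p1; set t := dot x y; set r := dot p1 y => z1 z2 t1 t2 h.
have h2 : (r - z * t) ^+ 2 <= (1 - z ^+ 2) * (1 - t ^+ 2).
  by rewrite -subr_ge0; move: h; rewrite -subr_ge0; congr (is_true (0 <= _)); ring.
have h3 : (1 - z ^+ 2) * (1 - t ^+ 2) <= (1 - z ^+ 2) * (2 * (1 - t)).
  by rewrite ler_wpM2l//; nra.
rewrite [leRHS](_ : _ = ((1 - z ^+ 2) * (2 * (1 - t))) / 4); last by field.
rewrite expr_div_n (_ : 2 ^+ 2 = 4 :> R); last by ring.
by rewrite ler_pM2r ?invr_gt0// (le_trans h2).
Qed.

Lemma slope_kernel_ge0 x y : 0 <= slope_kernel x y.
Proof. by rewrite !mulr_ge0 ?invr_ge0 ?sqrtr_ge0. Qed.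

Lemma geom_slope_bound n x y :
  `|geom_sum n (chord x y) * chord_slope p1 x y| <= slope_kernel x y.
Proof.
have h := chord_slope_sqr x y; have c0 := chord_ge0 x y.
set c := chord x y in h c0 *; have : c <= 1 := chord_le1 x y.
rewrite le_eqVlt => /orP[/eqP c1|c1].
  have -> : chord_slope p1 x y = 0.
    by apply/eqP; rewrite -sqrf_eq0 eq_le sqr_ge0 andbT (le_trans h)// c1 subrr mulr0.
  by rewrite mulr0 normr0 slope_kernel_ge0.
rewrite normrM ger0_norm ?geom_sum_ge0// /slope_kernel -/c.
set q := chord x p1 * chord x p2 in h *.
have q0 : 0 <= q by rewrite mulr_ge0// chord_ge0.
have r0 : 0 < Num.sqrt (1 - c) by rewrite sqrtr_gt0 subr_gt0.
have r2 : Num.sqrt (1 - c) ^+ 2 = 1 - c by rewrite sqr_sqrtr// subr_ge0 ltW.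
have w2 : Num.sqrt q ^+ 2 = q by rewrite sqr_sqrtr.
have hs : `|chord_slope p1 x y| <= 2 * Num.sqrt q * Num.sqrt (1 - c).
  rewrite -ler_sqr ?nnegrE ?mulr_ge0 ?sqrtr_ge0// real_normK ?num_real//.
  by rewrite (le_trans h)// !exprMn r2 w2; lra.
have hg : geom_sum n c <= (Num.sqrt (1 - c) ^+ 2)^-1.
  rewrite r2 -[leRHS]mul1r ler_pdivlMr ?subr_gt0// mulrC geom_sumE.
  by rewrite lerBlDr lerDl exprn_ge0.
apply: le_trans (ler_pM _ _ hg hs) _; rewrite ?geom_sum_ge0//.
by rewrite le_eqVlt; apply/orP; left; apply/eqP; field; rewrite gt_eqF.
Qed.

Lemma measurable_slope_kernel : measurable_fun [set: sphere R * sphere R]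
  (fun z : sphere R * sphere R => slope_kernel z.1 z.2).
Proof.
have ms := continuous_measurable_fun (@sqrt_continuous R).
apply: measurable_funM.
  apply: measurable_funM => //; apply: (measurableT_comp ms).
  apply: measurable_funM.
    exact: (measurableT_comp (measurable_chord p1)).
  exact: (measurableT_comp (measurable_chord p2)).
have mb : measurable_fun [set: R] (fun s : R => 1 - s) by exact: measurable_funB.
have := measurable_chord_comp2 (measurableT_comp (@measurable_powR R (- 2^-1)) mb).
apply: eq_measurable_fun => z _ /=.
by rewrite powRN powR12_sqrt// subr_ge0 chord_le1.
Qed.

Lemma sqrt_expR (h : R) : Num.sqrt (expR h) = expR (2^-1 * h).
Proof.
have -> : expR h = expR (2^-1 * h) ^+ 2 by rewrite -expRM_natl; congr expR; field.
by rewrite sqrtr_sqr ger0_norm ?expR_ge0.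
Qed.

(** In terms of logarithms, the kernel carries the exponent -1/2 at both poles and
   1/2 at y. *)
Lemma slope_kernelE x y : chord x p1 < 1 -> chord x p2 < 1 -> chord x y < 1 ->
  slope_kernel x y =
  2 * expR (- 2^-1 * pole_log p1 p2 x + 2^-1 * neg_log (chord x y)).
Proof.
move=> c1 c2 c; have e := chord_antipodal antipodal x.
have e1 : chord x p2 = expR (- neg_log (chord x p1)).
  by rewrite expRN neg_log_exp// invrK -e addrC addKr.
have e2 : chord x p1 = expR (- neg_log (chord x p2)).
  by rewrite expRN neg_log_exp// invrK -e addrK.
have ey : 1 - chord x y = expR (- neg_log (chord x y)).
  by rewrite expRN neg_log_exp// invrK.
rewrite /slope_kernel ey {1}e2 {2}e1 -expRD !sqrt_expR -expRN -mulrA -expRD.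
by congr (_ * expR _); rewrite /pole_log; ring.
Qed.

(** The kernel lowers the exponent A at the poles by 1/2, and the exponent 1/2 at
   y is compensated: max 0 (A - 1/2) + 1/2 < 1. *)
Lemma L1prod_slope_kernel (A c : R) F : 0 <= A -> A < 1 -> 0 <= c -> L1 area F ->
  L1prod area area (fun z : sphere R * sphere R =>
    expR (A * pole_log p1 p2 z.1 + c * potential (fun y => `|F y|) z.1) *
    slope_kernel z.1 z.2 * `|F z.2|).
Proof.
move=> A0 A1 c0 lF.
pose A' := Num.max 0 (A - 2^-1).
have A'0 : 0 <= A' by rewrite /A' le_max lexx.
have A'1 : A' + 2^-1 < 1 by rewrite -ltrBrDr /A' gt_max; apply/andP; split; lra.
have A'2 : A - 2^-1 <= A' by rewrite /A' le_max lexx orbT.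
have h2 : 0 <= 2^-1 :> R by [].
have [C hC] := integral_exp_logs_potential antipodal A'0 h2 A'1 c0 lF.
have mP : measurable_fun [set: sphere R] (potential (fun y => `|F y|)).
  exact: measurable_potential (L1_norm lF).
have mpl := measurable_pole_log p1 p2.
have mk : measurable_fun [set: sphere R * sphere R] (fun z : sphere R * sphere R =>
    expR (A * pole_log p1 p2 z.1 + c * potential (fun y => `|F y|) z.1) *
    slope_kernel z.1 z.2).
  apply: measurable_funM; last exact: measurable_slope_kernel.
  apply: (measurableT_comp (@measurable_expR R)); apply: measurable_funD.
    by apply: measurable_funM => //; exact: (measurableT_comp mpl).
  by apply: measurable_funM => //; exact: (measurableT_comp mP).
apply: (L1prod_kernel (C := 2 * C) (g := fun y => `|F y|) mk); last exact: L1_norm.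
  by move=> z; rewrite mulr_ge0 ?expR_ge0 ?slope_kernel_ge0.
move=> y; pose g (x : sphere R) := A' * pole_log p1 p2 x + 2^-1 * neg_log (chord x y) +
     c * potential (fun y => `|F y|) x.
have mg : measurable_fun [set: sphere R] (fun x => expR (g x)).
  apply: (measurableT_comp (@measurable_expR R)); apply: measurable_funD.
    apply: measurable_funD; first exact: measurable_funM.
    apply: measurable_funM => //; apply: measurable_chord_comp.
    exact: measurable_neg_log.
  exact: measurable_funM.
have lg : L1 area (fun x => expR (g x)).
  apply/L1_lty => //.
  by apply: le_lt_trans (hC y) _; exact: ltry.
have gC : \int[area]_x expR (g x) <= C by rewrite -lee_fin EFin_integral1//; exact: hC.
have l2g := L1Z 2 lg.
apply: (@le_trans _ _ (\int[area]_x (2 * expR (g x))%:E)%E); last first.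
  by rewrite -(EFin_integral1 l2g) lee_fin (integralZ1 _ lg) ler_wpM2l.
apply: (@ae_ge0_le_integral _ _ _ area _ measurableT) => //.
- by move=> x _; rewrite lee_fin mulr_ge0 ?expR_ge0 ?slope_kernel_ge0.
- apply/measurable_EFinP.
  exact: (measurableT_comp mk (pair2_measurable y)).
- by apply/measurable_EFinP; exact: L1_measurable l2g.
have := chord_lt1_ae y; have := chord_lt1_ae p2; have := chord_lt1_ae p1.
apply: filterS3 => x /= c1 c2 cy _.
rewrite lee_fin slope_kernelE// mulrCA -expRD ler_wpM2l// ler_expR /g.
have := ler_wpM2r (pole_log_ge0 p1 p2 x) A'2.
by rewrite mulrBl; lra.
Qed.

End slope_kernel.

(** * The balance of a single density *)

Section density.
Context {R : realType}.
Variables (p1 p2 : sphere R).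
Hypothesis antipodal : sphere_val p2 = - sphere_val p1.
Variables (a b : R) (F : sphere R -> R).
Hypotheses (aN1 : -1 < a) (bN1 : -1 < b) (lF : L1 area F).
Implicit Types (x y : sphere R) (n : nat).

Let c : R := (4 * pi)^-1.
Let c0 : 0 <= c. Proof. by rewrite invr_ge0 ltW// fourpi_gt0. Qed.
Let A : R := Num.max 0 (Num.max (- a) (- b)).
Let A0 : 0 <= A. Proof. by rewrite le_max lexx. Qed.
Let A1 : A < 1.
Proof.
by rewrite gt_max gt_max ltr01 ltrNl aN1 ltrNl bN1.
Qed.
Let aA : - a <= A. Proof. by rewrite !le_max lexx orbT. Qed.
Let bA : - b <= A. Proof. by rewrite !le_max lexx !orbT. Qed.
Let U x := potential (fun y => `|F y|) x.
Let z x : R := dot x p1.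

(** The logarithm, up to a constant, of a density with weights a, b at the poles
   and with Laplacian prescribed by F. *)
Definition log_density x : R := - a * neg_log (chord x p1) +
  - b * neg_log (chord x p2) + c * potential F x.

Definition log_density_trunc n x : R := - a * log_sum n (chord x p1) +
  - b * log_sum n (chord x p2) + c * trunc_potential n F x.

Let W := log_density.
Let Wn := log_density_trunc.
(** Dominates e^Wn and e^W; only the weights of the sign that creates a
   singularity enter the exponent A. *)
Let dom x := expR (A * pole_log p1 p2 x + c * U x).

Let mz : measurable_fun [set: sphere R] z.
Proof. exact: measurable_dot_l. Qed.

Let z1 x : `|z x| <= 1.
Proof. by rewrite ler_norml dot_sphere_le1 dot_sphere_geN1. Qed.

Lemma measurable_log_density : measurable_fun [set: sphere R] log_density.
Proof.
apply: measurable_funD; last by apply: measurable_funM => //; exact: measurable_potential.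
by apply: measurable_funD; apply: measurable_funM => //; apply: measurable_chord_comp;
  exact: measurable_neg_log.
Qed.

Let measurable_Wn n : measurable_fun [set: sphere R] (Wn n).
Proof.
apply: measurable_funD; last by apply: measurable_funM => //; exact: measurable_trunc_potential.
by apply: measurable_funD; apply: measurable_funM => //; apply: measurable_chord_comp;
  exact: measurable_log_sum.
Qed.

Let meW : measurable_fun [set: sphere R] (fun x => expR (W x)).
Proof. exact: (measurableT_comp (@measurable_expR R) measurable_log_density). Qed.

Let meWn n : measurable_fun [set: sphere R] (fun x => expR (Wn n x)).
Proof. exact: (measurableT_comp (@measurable_expR R) (measurable_Wn n)). Qed.

Let mU : measurable_fun [set: sphere R] U.
Proof. exact: measurable_potential (L1_norm lF). Qed.

Let mdom : measurable_fun [set: sphere R] dom.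
Proof.
apply: (measurableT_comp (@measurable_expR R)); apply: measurable_funD.
  by apply: measurable_funM => //; exact: measurable_pole_log.
exact: measurable_funM.
Qed.

Let ldom : L1 area dom.
Proof.
have AB : A + 0 < 1 by rewrite addr0.
have [C hC] := integral_exp_logs_potential antipodal A0 (lexx 0) AB c0 lF.
apply/L1_lty => //; first by move=> x; exact: expR_ge0.
apply: le_lt_trans (ltry C); apply: le_trans (hC p1).
by under [leRHS]eq_integral do rewrite mul0r addr0.
Qed.

Let Wn_cvg : {ae area, forall x,
  (forall n, expR (Wn n x) <= dom x) /\ (fun n => Wn n x) @ \oo --> W x}.
Proof.
have := trunc_potential_cvg lF; have := chord_lt1_ae p2; have := chord_lt1_ae p1.
apply: filterS3 => x h1 h2 [hb hc]; split.
  move=> n; rewrite ler_expR /pole_log mulrDr !lerD//.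
  - apply: (@le_trans _ _ (A * log_sum n (chord x p1))).
      by rewrite ler_wpM2r// log_sum_ge0// chord_ge0.
    by rewrite ler_wpM2l// log_sum_le// chord_ge0.
  - apply: (@le_trans _ _ (A * log_sum n (chord x p2))).
      by rewrite ler_wpM2r// log_sum_ge0// chord_ge0.
    by rewrite ler_wpM2l// log_sum_le// chord_ge0.
  - by rewrite ler_wpM2l// (le_trans _ (hb n))// ler_norm.
have := cvg_log_sum (chord_ge0 x p1) h1; have := cvg_log_sum (chord_ge0 x p2) h2.
move=> k2 k1; apply: cvgD; last by apply: cvgM; [exact: cvg_cst|exact: hc].
by apply: cvgD; (apply: cvgM; first exact: cvg_cst).
Qed.

Let eWn_cvg : {ae area, forall x, [/\ forall n, expR (Wn n x) <= dom x,
  expR (W x) <= dom x & (fun n => expR (Wn n x)) @ \oo --> expR (W x)]}.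
Proof.
apply: filterS Wn_cvg => x [h1 h2].
have h3 : (fun n => expR (Wn n x)) @ \oo --> expR (W x).
  by apply: continuous_cvg; first exact: continuous_expR.
split => //; rewrite -(cvg_lim (@Rhausdorff R) h3); apply: limr_le.
  by apply/cvg_ex; exists (expR (W x)).
exact: nearW.
Qed.

Lemma L1_exp_log_density : L1 area (fun x => expR (log_density x)).
Proof.
have l : L1 area (fun x => Num.min (expR (W x)) (dom x)).
  apply: (L1_dom _ ldom); first exact: measurable_minr.
  by move=> x; rewrite ger0_norm ?le_min ?expR_ge0// ge_min lexx orbT.
by apply: (ae_L1 _ _ l) => //; apply: filterS eWn_cvg => x [_ h _]; rewrite min_l.
Qed.

Let DT x : R := \int[area]_y (dom x * slope_kernel p1 p2 x y * `|F y|).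

Let lK : L1prod area area (fun w : sphere R * sphere R =>
  dom w.1 * slope_kernel p1 p2 w.1 w.2 * `|F w.2|).
Proof. exact (L1prod_slope_kernel antipodal A0 A1 c0 lF). Qed.

Let lDT : L1 area DT. Proof. exact: L1_integral_snd lK. Qed.

Let DT_bound : {ae area, forall x, forall n, dom x * `|transport p1 n F x| <= DT x}.
Proof.
apply: filterS (L1prod_ae1 lK) => x /= lx n.
have lt := L1_transport_kernel p1 n x lF.
have -> : dom x * `|transport p1 n F x| = `|dom x * transport p1 n F x|.
  by rewrite normrM [`|dom x|]ger0_norm ?expR_ge0.
rewrite /transport -(integralZ1 _ lt).
rewrite (le_trans (le_normr_Rintegral _ _))//; first exact: L1Z.
apply: le_integral1 => //; first by apply/L1_norm/L1Z.
move=> y; rewrite normrM [`|dom x|]ger0_norm ?expR_ge0// -[leRHS]mulrA ler_wpM2l ?expR_ge0//.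
by rewrite normrM ler_wpM2r// geom_slope_bound.
Qed.

Let pole_slope1 n x : geom_sum n (chord x p1) * chord_slope p1 x p1 =
  (1 + z x) * (1 - chord x p1 ^+ n).
Proof. by rewrite -geom_sumE /chord_slope dot_sphere /chord -/(z x); field. Qed.

Let pole_slope2 n x : geom_sum n (chord x p2) * chord_slope p1 x p2 =
  - ((1 - z x) * (1 - chord x p2 ^+ n)).
Proof.
by rewrite -geom_sumE /chord_slope /chord antipodal !dotNr dot_sphere -/(z x); field.
Qed.

Let rhs n x : R := 2 * z x + a * ((1 + z x) * (1 - chord x p1 ^+ n)) -
  b * ((1 - z x) * (1 - chord x p2 ^+ n)).

Let M n : R := `|a| * n%:R + `|b| * n%:R + c * (n%:R * \int[area]_y `|F y|).

(** meridian_ibp for the function e^Wn, whose derivative involves those of the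
   pole logarithms: these are (1 + z)(1 - s1^n) and - (1 - z)(1 - s2^n). *)
Let transport_ibp n : \int[area]_x (expR (Wn n x) * (c * transport p1 n F x)) =
  \int[area]_x (expR (Wn n x) * rhs n x).
Proof.
pose D x := - a * (geom_sum n (chord x p1) * chord_slope p1 x p1) +
  - b * (geom_sum n (chord x p2) * chord_slope p1 x p2) + c * transport p1 n F x.
have md : meridian_derivative p1 (fun x => expR (Wn n x)) (fun x => expR (Wn n x) * D x).
  apply: meridian_derivative_exp; apply: meridian_derivativeD; last first.
    by apply: meridian_derivativeZ; exact: meridian_trunc_potential.
  by apply: meridian_derivativeD; apply: meridian_derivativeZ; exact: meridian_log_sum.
have WM x : `|Wn n x| <= M n.
  rewrite (le_trans (ler_normD _ _))// lerD//.
    rewrite (le_trans (ler_normD _ _))// lerD// normrM normrN ler_wpM2l//;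
      by rewrite log_sum_bound// chord_itv.
  by rewrite normrM ger0_norm// ler_wpM2l//; exact: trunc_potential_bound.
have gs (q : sphere R) x : `|geom_sum n (chord x q) * chord_slope p1 x q| <= n%:R.
  rewrite normrM -[leRHS]mulr1.
  by rewrite ler_pM// ?geom_sum_bound ?chord_itv// chord_slope_bound.
have DM x : `|D x| <= M n.
  rewrite (le_trans (ler_normD _ _))// lerD//.
    by rewrite (le_trans (ler_normD _ _))// lerD// normrM normrN ler_wpM2l.
  by rewrite normrM ger0_norm// ler_wpM2l//; exact: transport_bound.
have msl (q : sphere R) : measurable_fun [set: sphere R]
    (fun x => geom_sum n (chord x q) * chord_slope p1 x q).
  apply: measurable_funM; first by apply: measurable_chord_comp; exact: measurable_geom_sum.
  exact: (measurableT_comp (measurable_chord_slope2 p1) (pair2_measurable q)).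
have mD : measurable_fun [set: sphere R] D.
  apply: measurable_funD; last by apply: measurable_funM => //; exact: measurable_transport.
  by apply: measurable_funD; apply: measurable_funM.
have eM x : `|expR (Wn n x)| <= expR (M n).
  by rewrite ger0_norm ?expR_ge0// ler_expR (le_trans _ (WM x))// ler_norm.
have lD : L1 area (fun x => expR (Wn n x) * D x).
  by apply: (L1M (L1_bounded _ (meWn n) eM) mD DM).
have lz : L1 area (fun x => expR (Wn n x) * z x) by exact: L1M (L1_bounded _ (meWn n) eM) mz z1.
have lt : L1 area (fun x => expR (Wn n x) * (c * transport p1 n F x)).
  apply: (L1M (M := c * (n%:R * \int[area]_y `|F y|)) (L1_bounded _ (meWn n) eM)).
    by apply: measurable_funM => //; exact: measurable_transport.
  by move=> x; rewrite normrM ger0_norm// ler_wpM2l//; exact: transport_bound.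
have := meridian_ibp md (meWn n) (measurable_funM (meWn n) mD) eM
  (M' := expR (M n) * M n).
move=> /(_ (fun x => _)) ibp.
have {}ibp : \int[area]_x (expR (Wn n x) * D x) = 2 * \int[area]_x (z x * expR (Wn n x)).
  by apply: ibp => x; rewrite normrM ler_pM.
have e : \int[area]_x (expR (Wn n x) * (c * transport p1 n F x)) -
    \int[area]_x (expR (Wn n x) * D x) + 2 * \int[area]_x (expR (Wn n x) * z x) =
    \int[area]_x (expR (Wn n x) * rhs n x).
  rewrite -(integralB1 lt lD) -(integralZ1 2 lz) -(integralD1 (L1B lt lD) (L1Z 2 lz)).
  by apply: eq_Rintegral => x _; rewrite /D /rhs pole_slope1 pole_slope2; ring.
rewrite -e ibp; under [X in _ - 2 * X]eq_Rintegral do rewrite mulrC.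
by rewrite subrK.
Qed.

(** In transport_ibp the right-hand side converges by domination. On the left,
   e^Wn may be replaced by e^W, because the error is dominated by the integrals
   of the slope kernel against |F|. *)
Lemma transport_limit :
  (fun n => \int[area]_x (expR (W x) * (c * transport p1 n F x))) @ \oo -->
  \int[area]_x (expR (W x) * (2 * z x + a * (1 + z x) - b * (1 - z x))).
Proof.
pose B : R := 2 + `|a| * 2 + `|b| * 2.
have rB n x : `|rhs n x| <= B.
  have h (q : sphere R) : `|1 - chord x q ^+ n| <= 1.
    have s0 := exprn_ge0 n (chord_ge0 x q).
    have s1 := exprn_ile1 n (chord_ge0 x q) (chord_le1 x q).
    by rewrite ger0_norm; lra.
  have := z1 x; rewrite ler_norml => /andP[zl zr].
  rewrite (le_trans (ler_normB _ _))// lerD//.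
    rewrite (le_trans (ler_normD _ _))// lerD//.
      by rewrite normrM ger0_norm// -[leRHS]mulr1 ler_wpM2l.
    rewrite normrM ler_wpM2l// normrM -[leRHS]mulr1 ler_pM//.
    by rewrite ger0_norm; lra.
  rewrite normrM ler_wpM2l// normrM -[leRHS]mulr1 ler_pM//.
  by rewrite ger0_norm; lra.
have mrhs n : measurable_fun [set: sphere R] (rhs n).
  have ms (q : sphere R) : measurable_fun [set: sphere R] (fun x => 1 - chord x q ^+ n).
    by apply: measurable_funB => //; apply: measurable_funX; exact: measurable_chord.
  apply: measurable_funB.
    apply: measurable_funD; first exact: measurable_funM.
    apply: measurable_funM => //; apply: measurable_funM => //; exact: measurable_funD.
  apply: measurable_funM => //; apply: measurable_funM => //; exact: measurable_funB.
have lim1 : (fun n => \int[area]_x (expR (Wn n x) * rhs n x)) @ \oo -->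
    \int[area]_x (expR (W x) * (2 * z x + a * (1 + z x) - b * (1 - z x))).
  have [|||||_ h] := @dominated_convergence1 _ _ _ area
    (fun n x => expR (Wn n x) * rhs n x)
    (fun x => expR (W x) * (2 * z x + a * (1 + z x) - b * (1 - z x)))
    (fun x => B * dom x) => //.
  - by move=> n; exact: (measurable_funM (meWn n) (mrhs n)).
  - have mc (r : R) : measurable_fun [set: sphere R] (fun=> r) by [].
    exact: (measurable_funM meW (measurable_funB (measurable_funD
      (measurable_funM (mc 2) mz) (measurable_funM (mc a) (measurable_funD (mc 1) mz)))
      (measurable_funM (mc b) (measurable_funB (mc 1) mz)))).
  - have := chord_lt1_ae p2; have := chord_lt1_ae p1; move: eWn_cvg.
    apply: filterS3 => x [_ _ hW] s1 s2; apply: cvgM => //.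
    have hs (q : sphere R) : chord x q < 1 -> (fun n => 1 - chord x q ^+ n) @ \oo --> (1 : R).
      move=> sq; rewrite -[X in _ --> X]subr0; apply: cvgB; first exact: cvg_cst.
      by apply: cvg_expr; rewrite ger0_norm ?chord_ge0.
    have k1 := hs _ s1; have k2 := hs _ s2.
    rewrite -[1 + z x]mulr1 -[1 - z x]mulr1.
    apply: cvgB; last by do 2 (apply: cvgM; first exact: cvg_cst).
    apply: cvgD; first exact: cvg_cst.
    by do 2 (apply: cvgM; first exact: cvg_cst).
  - exact: L1Z.
  - apply: filterS eWn_cvg => x [h _ _] n.
    by rewrite normrM mulrC ler_pM// ger0_norm ?expR_ge0.
have lim2 : (fun n => \int[area]_x ((expR (Wn n x) - expR (W x)) * (c * transport p1 n F x)))
    @ \oo --> (0 : R).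
  have [|||||_ h] := @dominated_convergence1 _ _ _ area
    (fun n x => (expR (Wn n x) - expR (W x)) * (c * transport p1 n F x))
    (fun=> 0) (fun x => c * DT x) => //.
  - move=> n; have mc : measurable_fun [set: sphere R] (fun=> c) by [].
    exact: (measurable_funM (measurable_funB (meWn n) meW)
      (measurable_funM mc (measurable_transport p1 n lF))).
  - move: eWn_cvg DT_bound; apply: filterS2 => x [_ _ hW] hD.
    have dx : 0 < dom x := expR_gt0 _.
    apply: (@cvg_dist_bound _ _ (fun n => `|expR (Wn n x) - expR (W x)| * (c * (DT x / dom x)))).
      apply: nearW => n; rewrite subr0 normrM ler_wpM2l// normrM ger0_norm// ler_wpM2l//.
      by rewrite ler_pdivlMr// mulrC.
    rewrite -[X in _ --> X](mul0r (c * (DT x / dom x))); apply: cvgMl.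
    have k : (fun n => expR (Wn n x) - expR (W x)) @ \oo --> expR (W x) - expR (W x).
      exact: (cvgB hW (cvg_cst _)).
    rewrite subrr in k; have := cvg_norm k; rewrite normr0 => k0; exact: k0.
  - exact: L1Z.
  - move: eWn_cvg DT_bound; apply: filterS2 => x [h1 h2 _] hD n.
    rewrite mulrCA normrM ger0_norm// ler_wpM2l// normrM.
    apply: le_trans (hD n); rewrite ler_wpM2r//.
    have e1 := expR_ge0 (Wn n x); have e2 := expR_ge0 (W x).
    by rewrite ler_norml; apply/andP; split; have := h1 n; lra.
  by move: h; rewrite Rintegral_cst// mul0r.
have l := cvgB lim1 lim2; rewrite subr0 in l.
suff -> : (fun n => \int[area]_x (expR (W x) * (c * transport p1 n F x))) =
  (fun n => \int[area]_x (expR (Wn n x) * rhs n x)) -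
  (fun n => \int[area]_x ((expR (Wn n x) - expR (W x)) * (c * transport p1 n F x))) by exact: l.
apply/funext => n /=; rewrite [RHS]/GRing.add/= [X in _ + X]/GRing.opp/=.
have eM x : `|expR (Wn n x)| <= expR (M n).
  rewrite ger0_norm ?expR_ge0// ler_expR (le_trans (ler_norm _))//.
  rewrite (le_trans (ler_normD _ _))// lerD//.
    rewrite (le_trans (ler_normD _ _))// lerD// normrM normrN ler_wpM2l//;
      by rewrite log_sum_bound// chord_itv.
  by rewrite normrM ger0_norm// ler_wpM2l//; exact: trunc_potential_bound.
have mt : measurable_fun [set: sphere R] (fun x => c * transport p1 n F x).
  by apply: measurable_funM => //; exact: measurable_transport.
have bt x : `|c * transport p1 n F x| <= c * (n%:R * \int[area]_y `|F y|).
  by rewrite normrM ger0_norm// ler_wpM2l//; exact: transport_bound.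
have ln := L1M (L1_bounded area (meWn n) eM) mt bt.
have lw := L1M L1_exp_log_density mt bt.
have i1 : \int[area]_x ((expR (Wn n x) - expR (W x)) * (c * transport p1 n F x)) =
    \int[area]_x (expR (Wn n x) * (c * transport p1 n F x)) -
    \int[area]_x (expR (W x) * (c * transport p1 n F x)).
  rewrite -(integralB1 ln lw); apply: eq_Rintegral => x _.
  exact: mulrBl.
by rewrite i1 (transport_ibp n) subKr.
Qed.

End density.

(** * Symmetry of the interaction *)

Section transport_symmetry.
Context {R : realType}.
Variable p : sphere R.
Implicit Types (x y : sphere R) (n : nat) (f g : sphere R -> R).

Let S n x y : R := geom_sum n (chord x y) * chord_slope p x y.

Lemma chord_slope_symm n x y : S n x y + S n y x =
  (dot x p + dot y p) * (1 - chord x y ^+ n).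
Proof.
by rewrite /S (chordC y x) -geom_sumE /chord_slope /chord (dotC p y) (dotC p x) (dotC y x); field.
Qed.

Let S_bound n x y : `|S n x y| <= n%:R.
Proof.
rewrite normrM -[leRHS]mulr1.
by rewrite ler_pM// ?geom_sum_bound ?chord_itv// chord_slope_bound.
Qed.

Let mS n : measurable_fun [set: sphere R * sphere R]
  (fun w : sphere R * sphere R => S n w.1 w.2).
Proof.
apply: measurable_funM; last exact: measurable_chord_slope2.
by apply: measurable_chord_comp2; exact: measurable_geom_sum.
Qed.

Let L1prod_gf n f g : L1 area f -> L1 area g ->
  L1prod area area (fun w : sphere R * sphere R => g w.1 * S n w.1 w.2 * f w.2).
Proof.
move=> lf lg; have mf := L1_measurable lf; have mg := L1_measurable lg.
have mg1 : measurable_fun [set: sphere R * sphere R] (fun w : sphere R * sphere R => g w.1).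
  exact: (measurableT_comp mg).
have mf2 : measurable_fun [set: sphere R * sphere R] (fun w : sphere R * sphere R => f w.2).
  exact: (measurableT_comp mf).
have l : L1prod area area (fun w : sphere R * sphere R => (n%:R * `|g w.1|) * `|f w.2|).
  apply: (L1prod_kernel (C := n%:R * \int[area]_x `|g x|) (g := fun y => `|f y|)).
  - by apply: measurable_funM => //; exact: measurableT_comp.
  - by move=> w; rewrite mulr_ge0.
  - move=> y; rewrite -(integralZ1 _ (L1_norm lg)).
    by rewrite (EFin_integral1 (L1Z _ (L1_norm lg))).
  - exact: L1_norm.
apply: (L1prod_dom _ l).
  by do 2 apply: measurable_funM => //.
move=> w; have := S_bound n w.1 w.2; move: (S n w.1 w.2) => s sn.
by rewrite !normrM ler_wpM2r// mulrC ler_wpM2r.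
Qed.

(** The symmetrised kernel is (z x + z y)(1 - chord^n). Its first part integrates
   to 0 against mean zero densities, and the part with chord^n tends to 0. *)
Lemma transport_symm f g : L1 area f -> L1 area g ->
  \int[area]_x f x = 0 -> \int[area]_x g x = 0 ->
  (fun n => \int[area]_x (f x * transport p n g x) +
            \int[area]_x (g x * transport p n f x)) @ \oo --> (0 : R).
Proof.
move=> lf lg f0 g0.
pose k n x y : R := (dot x p + dot y p) * chord x y ^+ n.
pose r n x : R := \int[area]_y (k n x y * g y).
have mz : measurable_fun [set: sphere R] (fun x : sphere R => dot x p).
  exact: measurable_dot_l.
have z1 x : `|dot x p| <= 1 by rewrite ler_norml dot_sphere_le1 dot_sphere_geN1.
have kb n x y : `|k n x y| <= 2.
  rewrite normrM -[leRHS]mulr1 ler_pM//.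
    by rewrite (le_trans (ler_normD _ _))//; have := z1 x; have := z1 y; lra.
  by rewrite ger0_norm ?exprn_ile1 ?exprn_ge0 ?chord_ge0 ?chord_le1.
have mk n : measurable_fun [set: sphere R * sphere R]
    (fun w : sphere R * sphere R => k n w.1 w.2).
  apply: measurable_funM; last by apply: measurable_funX; exact: measurable_chord2.
  by apply: measurable_funD; exact: (measurableT_comp mz).
have mkx n x : measurable_fun [set: sphere R] (k n x).
  exact: (measurableT_comp (mk n) (pair1_measurable x)).
have lk n x : L1 area (fun y => k n x y * g y).
  by have := L1M lg (mkx n x) (kb n x); congr L1; apply/funext => y; rewrite mulrC.
have mr n : measurable_fun [set: sphere R] (r n).
  by apply: (measurable_integral_snd (m1 := area)
    (h := fun w : sphere R * sphere R => k n w.1 w.2 * g w.2)); apply: (L1prod_bounded _ (mk n)).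
have rb n x : `|r n x| <= 2 * \int[area]_y `|g y|.
  rewrite (le_trans (le_normr_Rintegral _ _))//; first exact: lk.
  rewrite -(integralZ1 2 (L1_norm lg)).
  apply: le_integral1; [exact/L1_norm/lk|exact/L1Z/L1_norm|move=> y].
  by rewrite normrM ler_wpM2r.
have rc x : (fun n => r n x) @ \oo --> (0 : R).
  have [|||||_ h] := @dominated_convergence1 _ _ _ area (fun n y => k n x y * g y)
    (fun=> 0) (fun y => 2 * `|g y|) => //.
  - by move=> n; exact: L1_measurable (lk n x).
  - apply: filterS (chord_lt1_ae x) => y; rewrite chordC => cy.
    rewrite -(mul0r (g y)); apply: cvgMl.
    rewrite -(mulr0 (dot x p + dot y p)); apply: cvgM; first exact: cvg_cst.
    by apply: cvg_expr; rewrite ger0_norm ?chord_ge0.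
  - exact/L1Z/L1_norm.
  - by apply: aeW => y n; rewrite normrM ler_wpM2r.
  by move: h; rewrite Rintegral_cst// mul0r.
have frc : (fun n => \int[area]_x (f x * r n x)) @ \oo --> (0 : R).
  have [|||||_ h] := @dominated_convergence1 _ _ _ area (fun n x => f x * r n x)
    (fun=> 0) (fun x => 2 * \int[area]_y `|g y| * `|f x|) => //.
  - by move=> n; apply: measurable_funM => //; exact: L1_measurable lf.
  - apply: aeW => x; rewrite -(mulr0 (f x)); apply: cvgM; first exact: cvg_cst.
    exact: rc.
  - exact/L1Z/L1_norm.
  - by apply: aeW => x n; rewrite normrM mulrC ler_wpM2r.
  by move: h; rewrite Rintegral_cst// mul0r.
pose Q n x : R := \int[area]_y (S n y x * g y).
have mSx n x : measurable_fun [set: sphere R] (fun y => S n y x).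
  exact: (measurableT_comp (mS n) (pair2_measurable x)).
have lSx n x : L1 area (fun y => S n y x * g y).
  have := L1M lg (mSx n x) (fun y => S_bound n y x).
  by congr L1; apply/funext => y; rewrite mulrC.
have QE n x : f x * Q n x = \int[area]_y (g y * S n y x * f x).
  rewrite /Q -(integralZ1 _ (lSx n x)); apply: eq_Rintegral => y _; ring.
have swap n : \int[area]_x (g x * transport p n f x) = \int[area]_x (f x * Q n x).
  transitivity (\int[area]_x \int[area]_y (g x * S n x y * f y)).
    apply: eq_Rintegral => x _; rewrite /transport -integralZ1; last exact: L1_transport_kernel.
    by apply: eq_Rintegral => y _; rewrite /S !mulrA.
  rewrite (Fubini1 (L1prod_gf n lf lg)); apply: eq_Rintegral => x _.
  by rewrite QE.
have lfQ n : L1 area (fun x => f x * Q n x).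
  by have := L1_integral_fst (L1prod_gf n lf lg); congr L1; apply/funext => x; rewrite QE.
have lft n : L1 area (fun x => f x * transport p n g x).
  exact: (L1M lf (measurable_transport p n lg) (fun x => transport_bound p n x lg)).
have lfr n : L1 area (fun x => f x * r n x) by exact: L1M lf (mr n) (rb n).
have lgz : L1 area (fun y => dot y p * g y).
  by have := L1M lg mz z1; congr L1; apply/funext => y; rewrite mulrC.
suff -> : (fun n => \int[area]_x (f x * transport p n g x) +
            \int[area]_x (g x * transport p n f x)) =
  (fun n => - \int[area]_x (f x * r n x)).
  by rewrite -oppr0; apply: cvgN.
apply/funext => n; rewrite swap -(integralD1 (lft n) (lfQ n)).
pose G := \int[area]_y (dot y p * g y).
transitivity (\int[area]_x (G * f x - f x * r n x)); last first.
  by rewrite (integralB1 (L1Z G lf) (lfr n)) (integralZ1 _ lf) f0 mulr0 sub0r.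
apply: eq_Rintegral => x _; rewrite -mulrDr [G * _]mulrC -mulrBr; congr (_ * _).
rewrite /transport /Q -(integralD1 (L1_transport_kernel p n x lg) (lSx n x)).
rewrite /r /G; transitivity (\int[area]_y (dot x p * g y + dot y p * g y - k n x y * g y)).
  apply: eq_Rintegral => y _; rewrite -mulrDl -[_ * chord_slope _ _ _]/(S n x y).
  by rewrite chord_slope_symm /k; ring.
rewrite (integralB1 (L1D (L1Z _ lg) lgz) (lk n x)) (integralD1 (L1Z _ lg) lgz).
by rewrite (integralZ1 _ lg) g0 mulr0 add0r.
Qed.

End transport_symmetry.

(** * Mean field equations *)

Section mean_field_equations.
Context {R : realType}.
Implicit Types (x y p : sphere R) (n : nat) (f g u h F : sphere R -> R).

Lemma area_cst (r : R) : \int[area]_(_ in [set: sphere R]) r = r * (4 * pi).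
Proof.
rewrite Rintegral_cst//; have -> : fine (area [set: sphere R]) = 4 * pi by rewrite area_setT.
by [].
Qed.

Lemma L1_Lfun2 u : u \in Lfun area 2%:E -> L1 area u.
Proof.
move=> u2; apply/(Lfun1_integrable area); apply: (Lfun_subset12 _ u2).
exact: fin_num_measure.
Qed.

Lemma area_height p : \int[area]_(x in [set: sphere R]) dot x p = 0.
Proof.
have b1 (x : sphere R) : `|1 : R| <= 1 by rewrite normr1.
have b0 (x : sphere R) : `|0 : R| <= 0 by rewrite normr0.
have mc (r : R) : measurable_fun [set: sphere R] (fun=> r) by [].
have := meridian_ibp (meridian_derivativeC p 1) (mc 1) (mc 0) b1 b0.
rewrite area_cst mul0r => /esym/eqP; rewrite mulf_eq0 pnatr_eq0/= => /eqP <-.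
by apply: eq_Rintegral => x _; rewrite mulr1.
Qed.

Lemma L1_height f p : L1 area f -> L1 area (fun x => f x * dot x p).
Proof.
move=> lf; apply: (L1M lf (measurable_dot_l p) (M := 1)) => x.
by rewrite ler_norml dot_sphere_le1 dot_sphere_geN1.
Qed.

(** Test with a constant. *)
Lemma weak_poisson_mean0 u f : L1 area u -> weak_poisson u f ->
  \int[area]_x f x = 0.
Proof.
move=> lu uf; have := weak_poisson_chord_power point 0 uf.
rewrite laplace_integral// expr0n !mul0r subrr oppr0 => <-.
by apply: eq_Rintegral => x _; rewrite expr0 mulr1.
Qed.

(** Test with the height, an eigenfunction of eigenvalue 2. *)
Lemma weak_poisson_height u f p : L1 area u -> L1 area f -> weak_poisson u f ->
  \int[area]_x (f x * dot x p) = 2 * \int[area]_x (u x * dot x p).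
Proof.
move=> lu lf uf; have f0 := weak_poisson_mean0 lu uf.
have := weak_poisson_chord_power p 1 uf.
rewrite laplace_integral// expr1n !mul1r.
have h g : L1 area g -> \int[area]_x (g x * chord x p ^+ 1) =
    2^-1 * (\int[area]_x g x + \int[area]_x (g x * dot x p)).
  move=> lg; rewrite -(integralD1 lg (L1_height p lg)).
  rewrite -(integralZ1 _ (L1D lg (L1_height p lg))).
  by apply: eq_Rintegral => x _; rewrite expr1 /chord; field.
rewrite !h// f0.
have -> : \int[area]_x (u x * chord x p ^+ 0) = \int[area]_x u x.
  by apply: eq_Rintegral => x _; rewrite expr0 mulr1.
move: (\int[area]_x u x) (\int[area]_x (u x * dot x p)) (\int[area]_x (f x * dot x p)).
move=> s t r; lra.
Qed.

(** If the normalising integral diverges, its value as a real number is 0, and so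
   is the quotient. *)
Lemma L1_normalized h u : measurable_fun [set: sphere R] h -> (forall x, 0 <= h x) ->
  L1 area u -> L1 area (fun x => h x * expR (u x) / (\int[area]_y (h y * expR (u y)))).
Proof.
move=> mh h0 lu.
have m : measurable_fun [set: sphere R] (fun x => h x * expR (u x)).
  apply: measurable_funM => //; apply: (measurableT_comp (@measurable_expR R)).
  exact: L1_measurable lu.
have p0 x : 0 <= h x * expR (u x) by rewrite mulr_ge0 ?expR_ge0.
have [l|nl] := pselect (L1 area (fun x => h x * expR (u x))).
  have := L1Z (\int[area]_y (h y * expR (u y)))^-1 l.
  by congr L1; apply/funext => x; rewrite mulrC.
have I0 : \int[area]_y (h y * expR (u y)) = 0.
  rewrite /Rintegral; suff -> : (\int[area]_y (h y * expR (u y))%:E = +oo)%E by [].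
  apply/eqP; rewrite eq_le leey/= leNgt; apply/negP => lt.
  by apply: nl; apply/L1_lty.
rewrite I0; have := L1_cst area (0 : R); congr L1; apply/funext => x.
by rewrite invr0 mulr0.
Qed.

Lemma transport_mean p n f : L1 area f -> \int[area]_x transport p n f x =
  2 * \int[area]_x (dot x p * trunc_potential n f x).
Proof.
move=> lf; exact: (meridian_ibp (meridian_trunc_potential p n lf)
  (measurable_trunc_potential n lf) (measurable_transport p n lf)
  (fun x => trunc_potential_bound n x lf) (fun x => transport_bound p n x lf)).
Qed.

(** Integrate by parts along meridians and use that the potential of f is 4 pi u
   up to a constant. *)
Lemma transport_mean_limit p u f : L1 area u -> L1 area f -> weak_poisson u f ->
  (fun n => \int[area]_x transport p n f x) @ \oo -->
  4 * pi * \int[area]_x (f x * dot x p).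
Proof.
move=> lu lf uf; rewrite (weak_poisson_height p lu lf uf).
have lpf := L1_potential lf.
have mz := measurable_dot_l p.
have z1 x : `|dot x p| <= 1 by rewrite ler_norml dot_sphere_le1 dot_sphere_geN1.
have [|||||_ h] := @dominated_convergence1 _ _ _ area
  (fun n x => dot x p * trunc_potential n f x) (fun x => dot x p * potential f x)
  (potential (fun y => `|f y|)).
- by move=> n; exact: (measurable_funM mz (measurable_trunc_potential n lf)).
- exact: (measurable_funM mz (L1_measurable lpf)).
- apply: filterS (trunc_potential_cvg lf) => x [_ k].
  by apply: cvgM; [exact: cvg_cst|exact: k].
- exact: L1_potential (L1_norm lf).
- apply: filterS (trunc_potential_cvg lf) => x [k _] n.
  by rewrite normrM -[leRHS]mul1r ler_pM.
suff e : \int[area]_x (dot x p * potential f x) = 4 * pi * \int[area]_x (u x * dot x p).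
  rewrite mulrCA -e; have := cvgM (cvg_cst (2 : R)) h.
  suff -> : (fun n => \int[area]_x transport p n f x) =
    (fun n => 2 * \int[area]_x (dot x p * trunc_potential n f x)) by exact.
  by apply/funext => n; exact: transport_mean.
have lpz := L1_height p lpf.
set I := \int[area]_y u y.
have lc : L1 area (fun x => I * dot x p).
  by apply: L1Z; have := L1_height p (L1_cst area 1); congr L1; apply/funext => x; rewrite mul1r.
have -> : \int[area]_x (u x * dot x p) =
    \int[area]_x ((4 * pi)^-1 * (I * dot x p + potential f x * dot x p)).
  apply: ae_eq_integral1; [exact: L1_height|by apply: L1Z; exact: L1D|].
  by apply: filterS (weak_poisson_potential lu lf uf) => x ->; rewrite -/I; ring.
rewrite (integralZ1 _ (L1D lc lpz)) (integralD1 lc lpz) mulrA mulfV ?mul1r; last first.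
  by rewrite gt_eqF// fourpi_gt0.
have -> : \int[area]_x (I * dot x p) = 0.
  rewrite integralZ1 ?area_height ?mulr0//.
  by have := L1_height p (L1_cst area 1); congr L1; apply/funext => x; rewrite mul1r.
by rewrite add0r; apply: eq_Rintegral => x _; rewrite mulrC.
Qed.

End mean_field_equations.

Section toda.
Context {R : realType}.
Variables (p1 p2 : sphere R).
Hypothesis antipodal : sphere_val p2 = - sphere_val p1.
Variables (G1 G2 : sphere R -> R).
Hypotheses (hG1 : green p1 G1) (hG2 : green p2 G2).
Implicit Types (x y p : sphere R) (n : nat) (f g u h F : sphere R -> R).

Lemma measurable_singular_weight (a b : R) :
  measurable_fun [set: sphere R] (singular_weight a b G1 G2).
Proof.
have mG (q : sphere R) (G : sphere R -> R) : green q G -> measurable_fun [set: sphere R] G.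
  by move=> [lG _ _]; apply: L1_measurable; apply/(Lfun1_integrable area); exact: lG.
have m1 := mG _ _ hG1; have m2 := mG _ _ hG2.
apply: (measurableT_comp (@measurable_expR R)); apply: measurable_funM => //.
by apply: measurable_funD; exact: measurable_funM.
Qed.

Lemma L1_mean_field (rho a b : R) u : u \in Lfun area 2%:E ->
  L1 area (mean_field rho (singular_weight a b G1 G2) u).
Proof.
move=> /L1_Lfun2 lu; apply: L1Z; apply: L1B; last exact: L1_cst.
apply: L1_normalized => //; first exact: measurable_singular_weight.
by move=> x; exact: expR_ge0.
Qed.

Lemma singular_weight_density (a b : R) u F : L1 area u -> L1 area F ->
  weak_poisson u F -> exists2 C : R, 0 < C & {ae area, forall x,
    singular_weight a b G1 G2 x * expR (u x) = C * expR (log_density p1 p2 a b F x)}.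
Proof.
move=> lu lF uF; exists (expR (a + b + (4 * pi)^-1 * \int[area]_y u y)); first exact: expR_gt0.
have := weak_poisson_potential lu lF uF.
have := green_neg_log hG2; have := green_neg_log hG1.
apply: filterS3 => x g1 g2 ux.
rewrite /singular_weight -!expRD g1 g2 ux /log_density; congr expR.
have := @fourpi_gt0 R; move: (4 * pi) => q q0; field.
by rewrite gt_eqF.
Qed.

(** Vanishing of the mean forces mu to have mass 1, which also excludes a
   divergent normalisation. Then mu is a multiple of e^W, for which
   transport_limit gives the term with the weights; the constant part of f
   contributes the moment of F. *)
Lemma component_balance (rho a b : R) u F f :
  f = mean_field rho (singular_weight a b G1 G2) u ->
  -1 < a -> -1 < b -> 0 < rho -> u \in Lfun area 2%:E -> L1 area F -> weak_poisson u F ->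
  \int[area]_x f x = 0 -> exists m : R, [/\ -1 < m, m < 1,
    \int[area]_x (f x * dot x p1) = rho * m &
    (fun n => \int[area]_x (f x * transport p1 n F x)) @ \oo -->
      rho * (4 * pi * ((1 + a) * (1 + m) - (1 + b) * (1 - m)) -
             \int[area]_x (F x * dot x p1))].
Proof.
move=> fdef a1 b1 rho0 u2 lF uF f0; have lu := L1_Lfun2 u2.
have q0 := @fourpi_gt0 R.
pose h := singular_weight a b G1 G2.
pose I := \int[area]_y (h y * expR (u y)).
pose mu x := h x * expR (u x) / I.
have lmu : L1 area mu.
  apply: L1_normalized => //; first exact: measurable_singular_weight.
  by move=> x; exact: expR_ge0.
have lc := L1_cst area ((4 * pi)^-1 : R).
have fE x : f x = rho * (mu x - (4 * pi)^-1) by rewrite fdef.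
have mu1 : \int[area]_x mu x = 1.
  have : \int[area]_x f x = rho * (\int[area]_x mu x - 1).
    rewrite (@eq_Rintegral _ _ _ area setT (fun x => rho * (mu x - (4 * pi)^-1)))//.
    rewrite (integralZ1 _ (L1B lmu lc)) (integralB1 lmu lc) area_cst mulVf//.
    by rewrite gt_eqF.
  by rewrite f0 => /esym/eqP; rewrite mulf_eq0 gt_eqF//= subr_eq0 => /eqP.
have I0 : 0 < I.
  rewrite lt_neqAle Rintegral_ge0 ?andbT; last first.
    by move=> x _; rewrite mulr_ge0 ?expR_ge0.
  apply/eqP => I0; move: mu1.
  rewrite (@eq_Rintegral _ _ _ area setT (fun=> 0)) ?area_cst ?mul0r; last first.
    by move=> x _; rewrite /mu -I0 invr0 mulr0.
  by move=> /esym/eqP; rewrite oner_eq0.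
have mu0 x : 0 < mu x by rewrite divr_gt0// mulr_gt0 ?expR_gt0.
have lz := L1_height p1 lmu.
pose m := \int[area]_x (mu x * dot x p1).
have zl x := dot_sphere_geN1 x p1; have zr x := dot_sphere_le1 x p1.
have area0 : (0 < area [set: sphere R])%E by rewrite area_setT lte_fin.
have mp : 0 < 1 + m.
  rewrite -mu1 -(integralD1 lmu lz); apply: integral1_gt0 => //; first exact: L1D.
    by move=> x; have := mu0 x; have := zl x; nra.
  apply: filterS (chord_lt1_ae p2) => x; rewrite /chord antipodal dotNr => zx.
  by have := mu0 x; nra.
have mm : 0 < 1 - m.
  rewrite -mu1 -(integralB1 lmu lz); apply: integral1_gt0 => //; first exact: L1B.
    by move=> x; have := mu0 x; have := zr x; nra.
  apply: filterS (chord_lt1_ae p1) => x; rewrite /chord => zx.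
  by have := mu0 x; nra.
exists m; split; [lra|lra| |].
  have lcz := L1_height p1 lc.
  rewrite (@eq_Rintegral _ _ _ area setT (fun x => rho * (mu x * dot x p1 - (4 * pi)^-1 * dot x p1))); last first.
    by move=> x _; rewrite fE; ring.
  rewrite (integralZ1 _ (L1B lz lcz)) (integralB1 lz lcz).
  rewrite integralZ1 ?area_height ?mulr0 ?subr0//.
  by have := L1_height p1 (L1_cst area 1); congr L1; apply/funext => x; rewrite mul1r.
have [C C0 hC] := singular_weight_density a b lu lF uF.
pose e x := expR (log_density p1 p2 a b F x).
have le : L1 area e by exact (L1_exp_log_density antipodal a1 b1 lF).
have muE : {ae area, forall x, mu x = C / I * e x}.
  by apply: filterS hC => x hx; rewrite /mu /h hx mulrAC.
have lim1 := transport_limit antipodal a1 b1 lF.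
have lim2 := @transport_mean_limit _ p1 u F lu lF uF.
have mt n := measurable_transport p1 n lF.
have bt n x := transport_bound p1 n x lF.
have lmt n := L1M lmu (mt n) (bt n).
have lt n : L1 area (transport p1 n F) by exact: L1_bounded (mt n) (bt n).
have bal : 4 * pi * (C / I) *
    \int[area]_x (e x * (2 * dot x p1 + a * (1 + dot x p1) - b * (1 - dot x p1))) =
    4 * pi * ((1 + a) * (1 + m) - (1 + b) * (1 - m)).
  rewrite -mulrA; congr (_ * _).
  pose v x : R := 2 * dot x p1 + a * (1 + dot x p1) - b * (1 - dot x p1).
  have mz := measurable_dot_l p1.
  have mv : measurable_fun [set: sphere R] v.
    have mc (r : R) : measurable_fun [set: sphere R] (fun=> r) by [].
    exact: (measurable_funB (measurable_funD
      (measurable_funM (mc 2) mz) (measurable_funM (mc a) (measurable_funD (mc 1) mz)))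
      (measurable_funM (mc b) (measurable_funB (mc 1) mz))).
  have bv x : `|v x| <= 2 + `|a| * 2 + `|b| * 2.
    rewrite (le_trans (ler_normB _ _))// lerD//.
      rewrite (le_trans (ler_normD _ _))// lerD// normrM.
        by rewrite ger0_norm// -[leRHS]mulr1 ler_wpM2l// ler_norml zl zr.
      by rewrite ler_wpM2l// ger0_norm; have := zl x; have := zr x; lra.
    by rewrite normrM ler_wpM2l// ger0_norm; have := zl x; have := zr x; lra.
  have lev := L1M le mv bv; have lmv := L1M lmu mv bv.
  rewrite -[LHS](integralZ1 (C / I) lev).
  transitivity (\int[area]_x (mu x * v x)).
    apply: ae_eq_integral1; [exact: L1Z|exact: lmv|].
    by apply: filterS muE => x ->; rewrite mulrA.
  transitivity (\int[area]_x ((a - b) * mu x + (2 + a + b) * (mu x * dot x p1))).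
    by apply: eq_Rintegral => x _; rewrite /v; ring.
  rewrite (integralD1 (L1Z _ lmu) (L1Z _ lz)) (integralZ1 _ lmu) (integralZ1 _ lz) mu1 -/m.
  by ring.
have := cvgM (cvg_cst rho) (cvgB (cvgM (cvg_cst (4 * pi * (C / I))) lim1)
  (cvgM (cvg_cst (4 * pi)^-1) lim2)).
rewrite bal mulKf ?gt_eqF// => lim.
suff -> : (fun n => \int[area]_x (f x * transport p1 n F x)) = (fun n =>
  rho * (4 * pi * (C / I) * \int[area]_x (e x * ((4 * pi)^-1 * transport p1 n F x)) -
    (4 * pi)^-1 * \int[area]_x transport p1 n F x)) by exact: lim.
apply/funext => n.
have -> : \int[area]_x (f x * transport p1 n F x) = rho * (\int[area]_x (mu x * transport p1 n F x) -
    (4 * pi)^-1 * \int[area]_x transport p1 n F x).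
  rewrite -(integralZ1 _ (lt n)) -(integralB1 (lmt n) (L1Z _ (lt n))).
  rewrite -(integralZ1 rho (L1B (lmt n) (L1Z _ (lt n)))).
  by apply: eq_Rintegral => x _; rewrite fE; ring.
have let_ := L1M le (mt n) (bt n).
congr (_ * (_ - _)).
transitivity (\int[area]_x (C / I * (e x * transport p1 n F x))).
  apply: ae_eq_integral1; [exact: lmt|exact: L1Z|].
  by apply: filterS muE => x ->; rewrite mulrA.
have -> : \int[area]_x (e x * ((4 * pi)^-1 * transport p1 n F x)) =
    (4 * pi)^-1 * \int[area]_x (e x * transport p1 n F x).
  by rewrite -(integralZ1 _ let_); apply: eq_Rintegral => x _; rewrite mulrCA.
by rewrite (integralZ1 _ let_) mulrACA mulfV ?mul1r// gt_eqF.
Qed.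

End toda.

(** * The coupled system *)

(** All terms on the left are nonpositive, those on the right nonnegative, and one
   of them is nonzero. *)
Lemma corner_balance (R : realFieldType) (w1 w2 w3 w4 E1 E2 E3 E4 : R) :
  0 < w1 -> 0 < w2 -> 0 < w3 -> 0 < w4 ->
  w1 * E1 + w3 * E3 = w2 * E2 + w4 * E4 ->
  ~ ([/\ E1 <= 0, E2 >= 0, E3 <= 0 & E4 >= 0] /\
     [\/ E1 < 0, E2 > 0, E3 < 0 | E4 > 0]).
Proof.
move=> w10 w20 w30 w40 bal [[h1 h2 h3 h4] s].
have k1 : w1 * E1 <= 0 by rewrite pmulr_rle0.
have k2 : 0 <= w2 * E2 by rewrite pmulr_rge0.
have k3 : w3 * E3 <= 0 by rewrite pmulr_rle0.
have k4 : 0 <= w4 * E4 by rewrite pmulr_rge0.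
case: s => s.
- have h : w1 * E1 < 0 by rewrite pmulr_rlt0. lra.
- have h : 0 < w2 * E2 by rewrite pmulr_rgt0. lra.
- have h : w3 * E3 < 0 by rewrite pmulr_rlt0. lra.
- have h : 0 < w4 * E4 by rewrite pmulr_rgt0. lra.
Qed.

Section cartan_coupling.
Context {R : realType}.
Variable p : sphere R.
Implicit Types (f g u : sphere R -> R).

Lemma L1_2B f g : L1 area f -> L1 area g -> L1 area (fun x => 2 * f x - g x).
Proof. by move=> lf lg; exact: (L1B (L1Z 2 lf) lg). Qed.

Lemma integral_2B f g : L1 area f -> L1 area g ->
  \int[area]_x (2 * f x - g x) = 2 * \int[area]_x f x - \int[area]_x g x.
Proof. by move=> lf lg; rewrite (integralB1 (L1Z 2 lf) lg) (integralZ1 2 lf). Qed.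

Lemma height_2B f g : L1 area f -> L1 area g ->
  \int[area]_x ((2 * f x - g x) * dot x p) =
  2 * \int[area]_x (f x * dot x p) - \int[area]_x (g x * dot x p).
Proof.
move=> lf lg; rewrite -(integral_2B (L1_height p lf) (L1_height p lg)).
by apply: eq_Rintegral => x _; ring.
Qed.

Lemma transport_2B n f g x : L1 area f -> L1 area g ->
  transport p n (fun y => 2 * f y - g y) x = 2 * transport p n f x - transport p n g x.
Proof.
move=> lf lg; have kf := L1_transport_kernel p n x lf; have kg := L1_transport_kernel p n x lg.
rewrite /transport -(integral_2B kf kg).
by apply: eq_Rintegral => y _; ring.
Qed.

(** The coupling matrix is invertible. *)
Lemma mean_fields_mean0 u1 u2 f1 f2 : L1 area u1 -> L1 area u2 ->
  L1 area f1 -> L1 area f2 ->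
  weak_poisson u1 (fun x => 2 * f1 x - f2 x) ->
  weak_poisson u2 (fun x => 2 * f2 x - f1 x) ->
  \int[area]_x f1 x = 0 /\ \int[area]_x f2 x = 0.
Proof.
move=> k1 k2 l1 l2 /(weak_poisson_mean0 k1) e1 /(weak_poisson_mean0 k2) e2.
move: e1 e2; rewrite !integral_2B//.
by move: (\int[area]_x f1 x) (\int[area]_x f2 x) => s t e1 e2; split; lra.
Qed.

(** By symmetry of the coupling matrix, every interaction occurs together with its
   transpose. *)
Lemma coupled_transport_limit f1 f2 : L1 area f1 -> L1 area f2 ->
  \int[area]_x f1 x = 0 -> \int[area]_x f2 x = 0 ->
  (fun n => \int[area]_x (f1 x * transport p n (fun y => 2 * f1 y - f2 y) x) +
    \int[area]_x (f2 x * transport p n (fun y => 2 * f2 y - f1 y) x)) @ \oo --> (0 : R).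
Proof.
move=> l1 l2 f10 f20.
pose B n f g : R := \int[area]_x (f x * transport p n g x).
have lB n f g : L1 area f -> L1 area g -> L1 area (fun x => f x * transport p n g x).
  move=> lf lg.
  exact: (L1M lf (measurable_transport p n lg) (fun x => transport_bound p n x lg)).
have B2 n f g : L1 area f -> L1 area g ->
    \int[area]_x (f x * transport p n (fun y => 2 * f y - g y) x) = 2 * B n f f - B n f g.
  move=> lf lg; rewrite /B -(integral_2B (lB n _ _ lf lf) (lB n _ _ lf lg)).
  by apply: eq_Rintegral => x _; rewrite transport_2B//; ring.
have lim := cvgB (cvgD (transport_symm p l1 l1 f10 f10) (transport_symm p l2 l2 f20 f20))
  (transport_symm p l1 l2 f10 f20).
rewrite addr0 subr0 in lim.
suff -> : (fun n => \int[area]_x (f1 x * transport p n (fun y => 2 * f1 y - f2 y) x) +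
    \int[area]_x (f2 x * transport p n (fun y => 2 * f2 y - f1 y) x)) =
  (fun n => B n f1 f1 + B n f1 f1 + (B n f2 f2 + B n f2 f2) - (B n f1 f2 + B n f2 f1)).
  exact: lim.
apply/funext => n; rewrite (B2 n _ _ l1 l2) (B2 n _ _ l2 l1).
by move: (B n f1 f1) (B n f2 f2) (B n f1 f2) (B n f2 f1) => b1 b2 b3 b4; ring.
Qed.

End cartan_coupling.

Theorem theorem1p4 (R : realType) (p1 p2 : sphere R)
    (antipodal : sphere_val p2 = - sphere_val p1)
    (G1 G2 : sphere R -> R) (hG1 : green p1 G1) (hG2 : green p2 G2)
    (alpha11 alpha12 alpha21 alpha22 : R)
    (h11 : -1 < alpha11) (h12 : -1 < alpha12)
    (h21 : -1 < alpha21) (h22 : -1 < alpha22)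
    (hne : (alpha11, alpha21) <> (alpha12, alpha22))
    (rho1 rho2 : R) (hrho1 : 0 < rho1) (hrho2 : 0 < rho2) :
  let E1 := rho1 ^+ 2 + rho2 ^+ 2 - rho1 * rho2
            - 4 * pi * (1 + alpha11) * rho1 - 4 * pi * (1 + alpha21) * rho2 in
  let E2 := rho1 ^+ 2 + rho2 ^+ 2 - rho1 * rho2
            - 4 * pi * (1 + alpha12) * rho1 - 4 * pi * (1 + alpha22) * rho2 in
  let E3 := rho1 ^+ 2 - rho2 ^+ 2
            - 4 * pi * (1 + alpha11) * rho1 + 4 * pi * (1 + alpha22) * rho2 in
  let E4 := rho1 ^+ 2 - rho2 ^+ 2
            - 4 * pi * (1 + alpha12) * rho1 + 4 * pi * (1 + alpha21) * rho2 in
  ([/\ E1 <= 0, E2 >= 0, E3 <= 0 & E4 >= 0] /\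
     [\/ E1 < 0, E2 > 0, E3 < 0 | E4 > 0]) \/
  ([/\ E1 >= 0, E2 <= 0, E3 >= 0 & E4 <= 0] /\
     [\/ E1 > 0, E2 < 0, E3 > 0 | E4 < 0]) ->
  ~ exists u1 u2 : sphere R -> R,
      [/\ H1 u1, H1 u2 &
          toda_solution rho1 rho2
            (singular_weight alpha11 alpha12 G1 G2)
            (singular_weight alpha21 alpha22 G1 G2) u1 u2].
Proof.
move=> E1 E2 E3 E4 signs [u1 [u2 [[u1L2 _] [u2L2 _] [eq1 eq2]]]].
have [f1 f1E] : exists f, f = mean_field rho1 (singular_weight alpha11 alpha12 G1 G2) u1.
  exact: (ex_intro _ _ erefl).
have [f2 f2E] : exists f, f = mean_field rho2 (singular_weight alpha21 alpha22 G1 G2) u2.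
  exact: (ex_intro _ _ erefl).
rewrite -f1E -f2E in eq1 eq2.
have l1 : L1 area f1 by rewrite f1E; exact: (L1_mean_field hG1 hG2).
have l2 : L1 area f2 by rewrite f2E; exact: (L1_mean_field hG1 hG2).
have [f10 f20] := mean_fields_mean0 (L1_Lfun2 u1L2) (L1_Lfun2 u2L2) l1 l2 eq1 eq2.
have [m1 [m1l m1r z1 lim1]] := component_balance antipodal hG1 hG2 f1E h11 h12 hrho1
  u1L2 (L1_2B l1 l2) eq1 f10.
have [m2 [m2l m2r z2 lim2]] := component_balance antipodal hG1 hG2 f2E h21 h22 hrho2
  u2L2 (L1_2B l2 l1) eq2 f20.
rewrite (height_2B p1 l1 l2) z1 z2 in lim1; rewrite (height_2B p1 l2 l1) z1 z2 in lim2.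
have := cvg_lim (@Rhausdorff R) (cvgD lim1 lim2).
rewrite (cvg_lim (@Rhausdorff R) (coupled_transport_limit p1 l1 l2 f10 f20)) => bal.
pose w1 := (1 + m1) * (1 + m2); pose w2 := (1 - m1) * (1 - m2).
pose w3 := (1 + m1) * (1 - m2); pose w4 := (1 - m1) * (1 + m2).
have a1 : 0 < 1 + m1 by rewrite -ltrBlDl sub0r.
have a2 : 0 < 1 + m2 by rewrite -ltrBlDl sub0r.
have b1 : 0 < 1 - m1 by rewrite subr_gt0.
have b2 : 0 < 1 - m2 by rewrite subr_gt0.
have w10 : 0 < w1 := mulr_gt0 a1 a2; have w20 : 0 < w2 := mulr_gt0 b1 b2.
have w30 : 0 < w3 := mulr_gt0 a1 b2; have w40 : 0 < w4 := mulr_gt0 b1 a2.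
have corners : w1 * E1 + w3 * E3 = w2 * E2 + w4 * E4.
  apply/eqP; rewrite -subr_eq0; apply/eqP.
  rewrite -[RHS](mulr0 (- 2)) bal.
  rewrite /w1 /w2 /w3 /w4 /E1 /E2 /E3 /E4; ring.
case: signs => [pos|[[s1 s2 s3 s4] s]].
  exact: (corner_balance w10 w20 w30 w40 corners pos).
apply: (@corner_balance R w1 w2 w3 w4 (- E1) (- E2) (- E3) (- E4)) => //.
  by rewrite !mulrN -!opprD corners.
by split; [split; rewrite ?oppr_le0 ?oppr_ge0|case: s => ?; [constructor 1|constructor 2|
  constructor 3|constructor 4]; rewrite ?oppr_lt0 ?oppr_gt0].
Qed.
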